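(* Let $d\ge2$ and let $f_{in},f_{out}$ be connection functions in the sparse regime which are not equal Lebesgue almost everywhere. Set $\lambda_{lower}:=\left(\int_{\mathbb{R}^d}(f_{in}(\|x\|)-f_{out}(\|x\|))dx\right)^{-1}$. If $\lambda\le\lambda_{lower}$, then weak recovery cannot be solved. Thus $\lambda_c>\left(\int_{\mathbb{R}^d}(f_{in}(\|x\|)-f_{out}(\|x\|))dx\right)^{-1}$.
   Context: Sparse model: $f_{in},f_{out}:\mathbb{R}_+\to[0,1]$ are measurable with $f_{in}(r)\ge f_{out}(r)$ for all $r\ge 0$ and $0<\int_{\mathbb{R}^d}(f_{in}(\|x\|)+f_{out}(\|x\|))dx<\infty$ ($\|\cdot\|$ Euclidean). For $\lambda>0$, let $\phi=\{X_1,X_2,\dots\}$ be a homogeneous Poisson point process of intensity $\lambda$ on $\mathbb{R}^d$, enumerated so that $\|X_i\|_\infty$ is non-decreasing in $i$; independently let $(Z_i)_{i\in\mathbb{N}}$ be i.i.d. uniform on $\{-1,+1\}$ (community labels). Conditionally on locations and labels, the graph $G$ on $\mathbb{N}$ joins each pair $i\ne j$ independently with probability $f_{in}(\|X_i-X_j\|)$ if $Z_i=Z_j$ and $f_{out}(\|X_i-X_j\|)$ if $Z_i\neq Z_j$. Let $B_n=[-n^{1/d}/2,n^{1/d}/2]^d$, $\phi_n=\phi\cap B_n$ (with the locations attached to the vertices), $N_n=|\phi_n|$, and let $G_n$ be the subgraph of $G$ induced on the vertices located in $B_n$. Weak recovery is solvable at $\lambda$ if there are a constant $\gamma>0$ and,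 for every $n$, $\{-1,+1\}$-valued random variables $(\tau^{(n)}_i)_{i\le N_n}$ which are a deterministic function of $(G_n,\phi_n)$ (the function may depend on the model parameters) such that $\lim_{n\to\infty}\mathbb{P}[\mathcal{O}_n\ge\gamma]=1$, where $\mathcal{O}_n=\frac{1}{N_n}\left|\sum_{i=1}^{N_n}\tau_i^{(n)}Z_i\right|$ ($\mathcal{O}_n:=1$ if $N_n=0$). $\lambda_c\in[0,\infty]$ (depending on $f_{in},f_{out},d$) is the threshold such that weak recovery is not solvable for $\lambda<\lambda_c$ and is solvable for $\lambda>\lambda_c$. *)

(* Defs.v *)
From HB Require Import structures.
From mathcomp Require Import all_boot all_order all_algebra.
From mathcomp Require Import finmap.
From mathcomp Require Import all_classical all_reals all_analysis.
Set Implicit Arguments.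
Unset Strict Implicit.
Unset Printing Implicit Defensive.
Import Order.TTheory GRing.Theory Num.Theory.
Import numFieldNormedType.Exports.

Local Open Scope classical_set_scope.
Local Open Scope ring_scope.

(** R^d is [d.-tuple (measurableTypeR R)]: the library equips tuples with the
    product sigma-algebra, which here is the Borel sigma-algebra of R^d. *)
Notation Rspace R d := (d.-tuple (measurableTypeR R)).

Section LebesgueStep.
Context {R : realType} (d : nat).
Variable mu : {sigma_finite_measure set (Rspace R d) -> \bar R}.

Definition cons_pair (p : measurableTypeR R * Rspace R d) : Rspace R d.+1 :=
  [tuple of p.1 :: p.2].

Definition lebesgue_cons : set (Rspace R d.+1) -> \bar R :=
  pushforward (@lebesgue_measure R \x mu)%E cons_pair.

Lemma measurable_cons_pair : measurable_fun setT cons_pair.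
Proof. exact: measurable_cons. Qed.

Let lebesgue_cons0 : lebesgue_cons set0 = 0%E.
Proof. by rewrite /lebesgue_cons /pushforward preimage_set0 measure0. Qed.

Let lebesgue_cons_ge0 A : (0 <= lebesgue_cons A)%E.
Proof. exact: (measure_ge0 (@lebesgue_measure R \x mu)%E _). Qed.

Let lebesgue_cons_sigma_additive : semi_sigma_additive lebesgue_cons.
Proof.
exact: (@measure_semi_sigma_additive _ _ _
  (measure_function_pushforward__canonical__measure_function_Measure
     (@lebesgue_measure R \x mu)%E measurable_cons_pair)).
Qed.

HB.instance Definition _ := isMeasure.Build _ _ _ lebesgue_cons
  lebesgue_cons0 lebesgue_cons_ge0 lebesgue_cons_sigma_additive.

Let lebesgue_cons_sigma_finite : sigma_finite setT lebesgue_cons.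
Proof.
have [F TF Ffin] : sigma_finite setT (@lebesgue_measure R \x mu)%E.
  have /sigma_finiteP[F [TF ndF Ffin]] := sigma_finiteT (@lebesgue_measure R).
  have /sigma_finiteP[G [TG ndG Gfin]] := sigma_finiteT mu.
  exists (fun n => F n `*` G n).
    apply/seteqP; split=> // -[x y] _.
    have [n _ Fnx] : (\bigcup_i F i) x by rewrite -TF.
    have [k _ Gky] : (\bigcup_i G i) y by rewrite -TG.
    exists (maxn n k) => //; split.
      by move: x Fnx; exact/subsetPset/ndF/leq_maxl.
    by move: y Gky; exact/subsetPset/ndG/leq_maxr.
  move=> k; have [mF Fk] := Ffin k; have [mG Gk] := Gfin k.
  split; first exact: measurableX.
  by rewrite product_measure1E// lte_mul_pinfty// ge0_fin_numE.
pose g (t : Rspace R d.+1) : measurableTypeR R * Rspace R d :=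
  (thead t, [tuple of behead t]).
have gK p : g (cons_pair p) = p.
  by case: p => a t; congr pair; apply: val_inj.
have mg : measurable_fun setT g.
  by apply/measurable_fun_pairP; split; [exact: measurable_tnth
                                       |exact: measurable_behead].
exists (fun i => g @^-1` F i).
  by rewrite -preimage_bigcup -TF preimage_setT.
move=> i; have [mF Fi] := Ffin i; split.
  by rewrite -[X in measurable X]setTI; exact: mg.
by rewrite /lebesgue_cons /pushforward -comp_preimage (_ : g \o _ = id)//;
  apply/funext => p /=; rewrite gK.
Qed.

HB.instance Definition _ := Measure_isSigmaFinite.Build _ _ _ lebesgue_cons
  lebesgue_cons_sigma_finite.

End LebesgueStep.

(** Lebesgue measure on R^d, as an iterated product; [lebesgue_box] gives the
    volume of boxes, which characterises it. *)
Fixpoint lebesgue {R : realType} (d : nat) :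
    {sigma_finite_measure set (Rspace R d) -> \bar R} :=
  match d with
  | 0 => [the {sigma_finite_measure set (Rspace R 0) -> \bar R}
            of dirac ([tuple] : Rspace R 0)]
  | d'.+1 => [the {sigma_finite_measure set (Rspace R d'.+1) -> \bar R}
            of lebesgue_cons (lebesgue d')]
  end.

Lemma lebesgue_box {R : realType} (d : nat)
    (A : 'I_d -> set (measurableTypeR R)) :
  (forall i, measurable (A i)) ->
  lebesgue d [set x | forall i, A i (tnth x i)]
  = (\prod_(i < d) lebesgue_measure (A i))%E.
Proof.
elim: d A => [|d IH] A mA /=.
  by rewrite big_ord0 diracE mem_set// => -[].
rewrite big_ord_recl /lebesgue_cons /pushforward.
pose B := [set x : Rspace R d | forall i, A (lift ord0 i) (tnth x i)].
have mB : measurable B.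
  rewrite (_ : B = \bigcap_(i in [set: 'I_d])
      ((fun x : Rspace R d => tnth x i) @^-1` A (lift ord0 i))); last first.
    by apply/seteqP; split=> [x h i _|x h i]; [exact: h|exact: (h i)].
  apply: fin_bigcap_measurable => [|i _]; first exact: finite_finset.
  by rewrite -[X in measurable X]setTI; exact: measurable_tnth.
rewrite (_ : @cons_pair R d @^-1` _ = A ord0 `*` B); last first.
  apply/seteqP; split=> [[a x] /= h|[a x] /= [h0 h] i].
    by split=> [|i]; [exact: (h ord0)|have := h (lift ord0 i); rewrite tnthS].
  by case: (unliftP ord0 i) => [j ->|->//]; rewrite tnthS.
by rewrite product_measure1E// -IH.
Qed.

Section Geometry.
Context {R : realType} (d : nat).
Implicit Types x y : Rspace R d.

Definition enorm x : R := Num.sqrt (\sum_(k < d) (tnth x k : R) ^+ 2).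

Definition edist x y : R :=
  Num.sqrt (\sum_(k < d) ((tnth x k : R) - tnth y k) ^+ 2).

Definition maxnorm x : R := \big[Num.max/0]_(k < d) `|tnth x k : R|.

(** The cube of volume n centred at the origin. *)
Definition box (n : nat) : set (Rspace R d) :=
  [set x | forall k, - (n%:R `^ d%:R^-1 / 2) <= (tnth x k : R)
                     <= n%:R `^ d%:R^-1 / 2].

End Geometry.

(** Connection functions are functions on all of R of which only the values on
    the half-line of nonnegative reals matter. *)
Record sparse_connection {R : realType} (d : nat) (f_in f_out : R -> R) : Prop := {
  measurable_f_in : measurable_fun (`[0, +oo[ : set R) f_in ;
  measurable_f_out : measurable_fun (`[0, +oo[ : set R) f_out ;
  f_in_range : forall r, 0 <= r -> 0 <= f_in r <= 1 ;
  f_out_range : forall r, 0 <= r -> 0 <= f_out r <= 1 ;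
  f_out_le_f_in : forall r, 0 <= r -> f_out r <= f_in r ;
  degree_gt0 :
    (0 < \int[lebesgue d]_x (f_in (enorm x) + f_out (enorm x))%:E)%E ;
  degree_lty :
    (\int[lebesgue d]_x (f_in (enorm x) + f_out (enorm x))%:E < +oo)%E
}.

(** The sigma-algebra generated by a sequence of random variables. *)
Definition sigma_of {d1 d2} {W : measurableType d1} {T : measurableType d2}
    (Y : nat -> W -> T) : set (set W) :=
  <<s \bigcup_i preimage_set_system setT (Y i) measurable >>.

(** Labels are Booleans: [true] stands for +1 and [false] for -1. *)
Definition spin {R : realType} (b : bool) : R := if b then 1 else -1.

Section Model.
Context {R : realType} (d : nat) (f_in f_out : R -> R) (lambda : R).
Context {disp : measure_display} {W : measurableType disp}.
Variable P : probability W R.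
Variable X : nat -> {mfun W >-> Rspace R d}.
Variable Z : nat -> {mfun W >-> bool}.
Variable E : nat -> nat -> {mfun W >-> bool}.

Definition npoints (A : set (Rspace R d)) (w : W) : \bar R :=
  counting [set i | A (X i w)].

Definition poisson_weight (m : R) (k : nat) : R := m ^+ k / k`!%:R * expR (- m).

Record poisson_process : Prop := {
  poisson_counts : forall A, measurable A -> (lebesgue d A < +oo)%E ->
    forall k : nat, P [set w | npoints A w = k%:R%:E] =
      (poisson_weight (lambda * fine (lebesgue d A)) k)%:E ;
  poisson_indep : forall (m : nat) (A : 'I_m -> set (Rspace R d)),
    (forall j, measurable (A j)) -> (forall j, (lebesgue d (A j) < +oo)%E) ->
    trivIset setT A ->
    forall k : 'I_m -> nat,
      P [set w | forall j, npoints (A j) w = (k j)%:R%:E] =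
      (\prod_(j < m) P [set w | npoints (A j) w = (k j)%:R%:E])%E
}.

Definition edge_prob (i j : nat) (w : W) : R :=
  if Z i w == Z j w then f_in (edist (X i w) (X j w))
  else f_out (edist (X i w) (X j w)).

(** [X], [Z] and [E] realise the locations, the labels and the adjacency
    relation of the model on [(W, P)]. The field [edge_law] says that, for each
    m, the conditional law given sigma(X, Z) of the adjacency relation on the
    pairs i < j < m is the product of the Bernoulli laws of parameter
    [edge_prob i j]. *)
Record community_graph : Prop := {
  locations_poisson : poisson_process ;
  locations_ordered : forall w i j, (i <= j)%N ->
    maxnorm (X i w) <= maxnorm (X j w) ;
  labels_iid_uniform : forall (m : nat) (s : nat -> bool),
    P [set w | forall i, (i < m)%N -> Z i w = s i] = (2^-1 ^+ m)%:E ;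
  labels_indep_locations : forall A B : set W,
    sigma_of X A -> sigma_of Z B -> P (A `&` B) = (P A * P B)%E ;
  edges_sym : forall i j w, E i j w = E j i w ;
  edges_irrefl : forall i w, E i i w = false ;
  edge_law : forall (m : nat) (a : nat -> nat -> bool) (B : set W),
    <<s sigma_of X `|` sigma_of Z >> B ->
    P (B `&` [set w | forall i j, (i < j < m)%N -> E i j w = a i j]) =
    (\int[P]_(w in B) (\prod_(j < m) \prod_(i < j)
       (if a i j then edge_prob i j w else 1 - edge_prob i j w))%:E)%E
}.

(** N_n; since [fset_set] sends infinite sets to the empty one, it is 0 on the
    null event where the cube contains infinitely many points. *)
Definition Nbox (n : nat) (w : W) : nat :=
  #|` fset_set [set i | box n (X i w)] |%fset.

(** The locations are enumerated by nondecreasing sup norm, so the vertices in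
    the cube are those of index less than N_n, see [box_points]. *)
Definition locations (N : nat) (w : W) : N.-tuple (Rspace R d) :=
  [tuple X i w | i < N].

Definition graph_on (N : nat) (w : W) : 'M[bool]_N := \matrix_(i, j) E i j w.

End Model.

(** An estimator maps the number N of vertices of G_n, their locations and the
    adjacency matrix of G_n to a label for each vertex. It has to be a Borel
    function, for otherwise on a large enough sigma-algebra of events it could
    encode the labels in the locations. *)
Definition estimator (R : realType) (d : nat) : Type :=
  forall N : nat, N.-tuple (Rspace R d) -> 'M[bool]_N -> 'I_N -> bool.

Definition measurable_estimator {R : realType} {d : nat} (t : estimator R d) :=
  forall N (g : 'M[bool]_N) (i : 'I_N), measurable_fun setT (fun x => t N x g i).

Definition overlap {R : realType} {d : nat}
    {disp : measure_display} {W : measurableType disp}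
    (X : nat -> {mfun W >-> Rspace R d}) (Z : nat -> {mfun W >-> bool})
    (E : nat -> nat -> {mfun W >-> bool})
    (t : estimator R d) (n : nat) (w : W) : R :=
  let N := Nbox X n w in
  if N == 0%N then 1
  else N%:R^-1 *
    `|\sum_(i < N) spin (t N (locations X N w) (graph_on E N w) i)
                   * spin (Z i w)|.

(** The hypotheses [community_graph] determine the joint law of [X], [Z] and
    [E], on which alone the condition on [overlap] depends: it holds in all
    realisations of the model as soon as it holds in one. Negating the
    existential thus says that weak recovery fails in every realisation. *)
Definition weak_recovery_solvable {R : realType} (d : nat) (f_in f_out : R -> R)
    (lambda : R) : Prop :=
  exists (disp : measure_display) (W : measurableType disp)
    (P : probability W R) (X : nat -> {mfun W >-> Rspace R d})
    (Z : nat -> {mfun W >-> bool}) (E : nat -> nat -> {mfun W >-> bool}),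
    community_graph f_in f_out lambda P X Z E /\
    exists (gamma : R) (t : nat -> estimator R d),
      [/\ 0 < gamma,
          forall n, measurable_estimator (t n) &
          P [set w | gamma <= overlap X Z E (t n) n w] @[n --> \oo] --> 1%E].

Definition lambda_lower {R : realType} (d : nat) (f_in f_out : R -> R) : \bar R :=
  (\int[lebesgue d]_x (f_in (enorm x) - f_out (enorm x))%:E)^-1%E.

(** The infimum is taken in [0, +oo], with value +oo when weak recovery is never
    solvable; by [lambda_c_unique] it is the only possible threshold. *)
Definition lambda_c {R : realType} (d : nat) (f_in f_out : R -> R) : \bar R :=
  ereal_inf [set lambda%:E | lambda in
    [set lambda : R | 0 < lambda /\ weak_recovery_solvable d f_in f_out lambda]].

Lemma lambda_c_unique {R : realType} (d : nat) (f_in f_out : R -> R)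
    (l : \bar R) :
  (0 <= l)%E ->
  (forall lambda : R, 0 < lambda -> (lambda%:E < l)%E ->
     ~ weak_recovery_solvable d f_in f_out lambda) ->
  (forall lambda : R, 0 < lambda -> (l < lambda%:E)%E ->
     weak_recovery_solvable d f_in f_out lambda) ->
  l = lambda_c d f_in f_out.
Proof.
move=> l0 below above; apply/eqP; rewrite eq_le; apply/andP; split.
  apply: le_ereal_inf_tmp => _ [lambda [lambda0 slv] <-].
  by rewrite leNgt; apply/negP => /(below _ lambda0).
case: l l0 {below} above => [l|_ _|//]; last by rewrite leey.
rewrite lee_fin => l0 above; apply/lee_addgt0Pr => e e0.
apply: ereal_inf_lbound; exists (l + e); last by rewrite EFinD.
by split; [exact: ltr_wpDl|apply: above; [exact: ltr_wpDl|rewrite lte_fin ltrDl]].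
Qed.

Lemma box_maxnorm {R : realType} (d n : nat) (x : Rspace R d) :
  box n x <-> maxnorm x <= n%:R `^ d%:R^-1 / 2.
Proof.
have h0 : 0 <= (n%:R : R) `^ d%:R^-1 / 2 by rewrite divr_ge0// powR_ge0.
split=> [xn|xn k].
  by rewrite /maxnorm; apply/bigmax_leP; split=> // k _; rewrite ler_norml xn.
rewrite -ler_norml; apply: le_trans xn.
exact: (le_bigmax _ (fun k => `|tnth x k : R|)).
Qed.

Lemma box_points {R : realType} (d n : nat) {disp : measure_display}
    {W : measurableType disp} (X : nat -> {mfun W >-> Rspace R d}) (w : W) :
  (forall i j, (i <= j)%N -> maxnorm (X i w) <= maxnorm (X j w)) ->
  finite_set [set i | box n (X i w)] ->
  [set i | box n (X i w)] = `I_(Nbox X n w).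
Proof.
move=> mono fin.
have down i j : (i <= j)%N -> box n (X j w) -> box n (X i w).
  by move=> ij /box_maxnorm xj; apply/box_maxnorm/(le_trans (mono _ _ ij)).
suff [m mE] : exists m, [set i | box n (X i w)] = `I_m.
  by rewrite /Nbox mE (card_fset_set (card_eqxx _)).
have [i0 Ni0] : exists i, ~ box n (X i w).
  apply: contrapT => /forallNP all; apply: infinite_nat.
  by apply: sub_finite_set fin => i _; apply: contrapT; exact: all.
have ex : exists i, `[< ~ box n (X i w) >] by exists i0; apply/asboolP.
exists (ex_minn ex); case: ex_minnP => m /asboolP Nm mmin.
apply/seteqP; split=> i /=.
  move=> bi; rewrite ltnNge; apply/negP => mi; exact/Nm/(down _ _ mi).
move=> im; apply: contrapT => /asboolP/mmin; by rewrite leqNgt im.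
Qed.

(* Main.v *)
Require Import Defs.
From HB Require Import structures.
From mathcomp Require Import all_boot all_order all_algebra.
From mathcomp Require Import all_classical all_reals all_analysis.
From mathcomp Require Import measurable_realfun ring lra zify.
Set Implicit Arguments.
Unset Strict Implicit.
Unset Printing Implicit Defensive.
Import Order.TTheory GRing.Theory Num.Theory.
Import numFieldNormedType.Exports.

Local Open Scope classical_set_scope.
Local Open Scope ring_scope.

(** Write g = f_in - f_out and G for the integral of g(|x|) over R^d, so that
    lambda_lower is 1/G.

    Why detection is hard.  Since f_out <= f_in, the status of a pair i, j can
    be drawn in two stages: with probability g(|X_i - X_j|) it tells whether
    Z_i = Z_j, and otherwise it is drawn independently of the labels.  The pairs
    of the first kind form a random connection model H with connection function
    g.  Flipping all the labels of one component of H changes nothing that can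
    be observed, so given H two labels in different components are uncorrelated
    with any guess, and E[tau_i tau_j Z_i Z_j] is at most the probability that H
    connects i and j ([information_percolation]).  By Chebyshev's inequality the
    event that the overlap is at least gamma while there are m vertices has
    probability at most (gamma m)^-2 times the expected number of connected
    pairs of H ([overlap_bound], [recovery_event_bound]).

    Why 1/G is not the threshold.  Counting all paths of H would show that there
    are O(n) connected pairs when lambda G < 1.  But two connected vertices are
    joined by a geodesic x_0, x_1, ..., x_k of H, and then no edge of H joins
    x_{3b} to x_{3b+3}.  Such paths are chains of blocks of three steps whose
    end points are not adjacent, and a block has mass lambda^3 (G^3 - delta)
    rather than (lambda G)^3, where delta is the integral of (g * g)^2, the
    weight of the 4-cycles through a point ([block_integral]).  Hence the
    expected number of these paths is O(n) as soon as
    lambda^3 (G^3 - delta) < 1 ([expected_paths]), and then the overlap tends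
    to 0 in probability ([weak_recovery_unsolvable]).  As delta > 0, this
    condition holds up to some lambda strictly larger than 1/G
    ([subcritical_margin]).

    Two facts connect this with the model.  Sums over tuples of distinct points
    of the Poisson process are computed by a Mecke formula ([mecke]), which is
    derived from the laws of the numbers of points in disjoint sets.  And G > 0,
    because a nonnegative radial function of integral 0 vanishes at almost every
    radius ([radial_integral_eq0]). *)

(** * Information percolation *)

Section InformationPercolation.
Context {R : realType} {V : finType}.

Definition bern (b : bool) (p : R) : R := if b then p else 1 - p.

(** The conditional probability of an edge given the labels [z]; [q_in] and
    [q_out] already incorporate the locations. *)
Definition sbm_prob (q_in q_out : V * V -> R) (z : V -> bool) (e : V * V) : R :=
  if z e.1 == z e.2 then q_in e else q_out e.

Definition adj (H : {set V * V}) : rel V :=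
  fun x y => ((x, y) \in H) || ((y, x) \in H).

Lemma adj_sym H : symmetric (adj H).
Proof. by move=> x y; rewrite /adj orbC. Qed.

Variables q_in q_out : V * V -> R.
Hypothesis q_rng : forall e, [/\ 0 <= q_out e, q_out e <= q_in e & q_in e <= 1].

Let g e := q_in e - q_out e.
Let c e (b : bool) := if b then q_out e else 1 - q_in e.

(** The two stages of the drawing of a pair: [g e] is the probability that its
    status reveals whether the labels agree, [c e b] that it takes the value
    [b] whatever the labels are. *)
Let bernE z e b : bern b (sbm_prob q_in q_out z e) =
  (if b == (z e.1 == z e.2) then g e else 0) + c e b.
Proof. by rewrite /bern /sbm_prob /g /c; case: b; case: ifP => //= _; ring. Qed.

(** Flipping the component of [u] in [H] preserves the equality of the labels at
    the two ends of each edge of [H], see [flip_edge]. *)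
Definition flip (H : {set V * V}) (u : V) (z : {ffun V -> bool}) : {ffun V -> bool} :=
  [ffun x => z x (+) connect (adj H) u x].

Lemma flipK H u : involutive (flip H u).
Proof. by move=> z; apply/ffunP => x; rewrite !ffunE addbK. Qed.

Lemma flip_edge (H : {set V * V}) u z e : e \in H ->
  (flip H u z e.1 == flip H u z e.2) = (z e.1 == z e.2).
Proof.
case: e => x y /= xyH; rewrite !ffunE.
have -> : connect (adj H) u y = connect (adj H) u x.
  have sC := sym_connect_sym (adj_sym H).
  by rewrite ![connect _ u _]sC; apply: same_connect => //;
     apply: connect1; rewrite /adj xyH orbT.
by rewrite (can_eq (addbK _)).
Qed.

Lemma spinN (b : bool) : spin (~~ b) = - spin b :> R.
Proof. by case: b; rewrite /spin ?opprK. Qed.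

Lemma spin_norm (b : bool) : `|spin b| = 1 :> R.
Proof. by case: b; rewrite /spin ?normrN normr1. Qed.

(** Expand the law of the graph over the set [H] of the revealing pairs.  If
    [H] does not connect [u] and [v], then [flip H u] is a bijection of the
    labellings which preserves the weight and changes the sign of
    [spin (z u) * spin (z v)], so these terms cancel; the other terms are bounded
    by the weight, whose sum over [a] is the probability of [H].  The factor
    [2 ^+ #|V|] is the number of labellings. *)
Lemma information_percolation (T : {ffun V * V -> bool} -> V -> bool) (u v : V) :
  \sum_(z : {ffun V -> bool}) \sum_(a : {ffun V * V -> bool})
    spin (T a u) * spin (T a v) * (spin (z u) * spin (z v)) *
    \prod_e bern (a e) (sbm_prob q_in q_out z e)
  <= 2 ^+ #|V| * \sum_(H : {set V * V})
      (connect (adj H) u v)%:R * \prod_e bern (e \in H) (g e).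
Proof.
pose F (H : {set V * V}) (z : {ffun V -> bool}) (e : V * V) (b : bool) :=
  if e \in H then (if b == (z e.1 == z e.2) then g e else 0) else c e b.
have F0 H z e b : 0 <= F H z e b.
  have [? ? ?] := q_rng e; rewrite /F /g /c; do !case: ifP => _ //; lra.
rewrite [leLHS](_ : _ = \sum_(H : {set V * V}) \sum_(a : {ffun V * V -> bool})
   \sum_(z : {ffun V -> bool}) spin (T a u) * spin (T a v) *
       ((spin (z u) * spin (z v)) * \prod_e F H z e (a e))); last first.
  transitivity (\sum_(z : {ffun V -> bool}) \sum_(a : {ffun V * V -> bool})
     \sum_(H : {set V * V})
     spin (T a u) * spin (T a v) * (spin (z u) * spin (z v) * \prod_e F H z e (a e)) : R).
    apply: eq_bigr => z _; apply: eq_bigr => a _.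
    under eq_bigr do rewrite bernE.
    by rewrite bigA_distr !mulr_sumr; apply: eq_bigr => H _; rewrite -mulrA.
  rewrite exchange_big [RHS]exchange_big; apply: eq_bigr => a _.
  by rewrite exchange_big.
rewrite mulr_sumr; apply: ler_sum => H _.
have [cuv|ncuv] := boolP (connect (adj H) u v); last first.
  rewrite mul0r mulr0 big1// => a _.
  rewrite -mulr_sumr; set S := (X in _ * X); suff -> : S = 0 by rewrite mulr0.
  (* the flip of the component of u shows that the sum is its own opposite *)
  suff : S = - S by lra.
  rewrite {1}/S (reindex_inj (inv_inj (flipK H u))) /= -sumrN.
  apply: eq_bigr => z _; rewrite -mulNr; congr (_ * _).
    by rewrite !ffunE connect0 (negbTE ncuv) addbT addbF spinN mulNr.
  by apply: eq_bigr => e _; rewrite /F; case: ifPn => // eH; rewrite flip_edge.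
rewrite mul1r.
apply: (@le_trans _ _ (\sum_(z : {ffun V -> bool})
   \sum_(a : {ffun V * V -> bool}) \prod_e F H z e (a e))).
  rewrite exchange_big /=; apply: ler_sum => a _; apply: ler_sum => z _.
  apply: le_trans (ler_norm _) _.
  rewrite !normrM !spin_norm !mul1r ger0_norm//; exact: prodr_ge0.
rewrite [leLHS](_ : _ = \sum_(z : {ffun V -> bool}) \prod_e bern (e \in H) (g e)).
  by rewrite sumr_const card_ffun card_bool -[leLHS]mulr_natl natrX.
apply: eq_bigr => z _.
rewrite -(bigA_distr_bigA (fun e b => F H z e b)); apply: eq_bigr => e _.
rewrite big_bool /F /bern /g /c; case: (e \in H) => /=; last by ring.
by case: (z _ == z _) => /=; rewrite ?addr0 ?add0r.
Qed.

(** The pairs are independent, so the probability that finitely many distinct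
    pairs have a prescribed status is a product.  The sum over [H] is turned
    into a product over pairs by giving weight 0 to the excluded statuses. *)
Lemma prescribed_edges (L : seq ((V * V) * bool)) : uniq (map fst L) ->
  \sum_(H : {set V * V}) (all (fun eb => (eb.1 \in H) == eb.2) L)%:R *
     \prod_e bern (e \in H) (g e)
  = \prod_(eb <- L) bern eb.2 (g eb.1).
Proof.
move=> uL.
pose F (b : bool) e := if (e, ~~ b) \in L then 0 else bern b (g e).
transitivity (\prod_e (F true e + F false e)).
  rewrite bigA_distr; apply: eq_bigr => H _.
  rewrite [RHS](_ : _ = \prod_e F (e \in H) e); last first.
    by apply: eq_bigr => e _; case: ifP.
  have [/allP aL|/allPn[[e b] eL /= neb]] := boolP (all _ L).
    rewrite mul1r; apply: eq_bigr => e _; rewrite /F.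
    by case: ifP => // /aL /=; case: (e \in H).
  rewrite mul0r (bigD1 e) //= /F.
  suff -> : ~~ (e \in H) = b by rewrite eL mul0r.
  by case: (e \in H) neb; case: (b).
transitivity (\prod_(e <- map fst L) (F true e + F false e)).
  rewrite (big_uniq _ uL) /= (bigID (mem (map fst L))) /= [X in _ * X]big1 ?mulr1//.
  have nL e b : e \notin map fst L -> (e, b) \notin L.
    by apply: contra => eL; apply/mapP; exists (e, b).
  by move=> e eL; rewrite /F /bern !(negbTE (nL _ _ eL)) addrC subrK.
rewrite big_map [LHS]big_seq [RHS]big_seq; apply: eq_bigr => -[e b] eL /=.
have nL : (e, ~~ b) \notin L.
  elim: L uL eL {F} => //= -[e' b'] L IH /= /andP[e'L uL].
  rewrite !inE => /predU1P[[-> ->]|eL].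
    rewrite xpair_eqE eqxx negb_or; apply/andP; split; first by case: (b').
    by apply: contra e'L => h; apply/mapP; exists (e', ~~ b').
  rewrite negb_or IH// andbT; apply: contra e'L => /eqP[<- _].
  by apply/mapP; exists (e, b).
by rewrite /F; case: b eL nL => /= eL nL; rewrite eL (negbTE nL) ?addr0 ?add0r.
Qed.

End InformationPercolation.

(** * Geodesic paths *)

Section GeodesicPairs.
Context {V : Type}.

(** The pairs whose status is prescribed along a geodesic [x :: p]: consecutive
    vertices are adjacent, and in each block of three steps the two end points
    are not.  The remaining zero, one or two steps carry no such prescription.
    The prescribed pairs are distinct because the blocks only share end
    points. *)
Fixpoint geodesic_pairs (x : V) (p : seq V) : seq ((V * V) * bool) :=
  match p with
  | [:: y1, y2, y3 & p'] =>
      [:: ((x, y1), true), ((y1, y2), true), ((y2, y3), true), ((x, y3), false)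
        & geodesic_pairs y3 p']
  | [:: y1; y2] => [:: ((x, y1), true); ((y1, y2), true)]
  | [:: y1] => [:: ((x, y1), true)]
  | [::] => [::]
  end.

Lemma seq_ind3 (P : V -> seq V -> Prop) :
  (forall x, P x [::]) -> (forall x y, P x [:: y]) ->
  (forall x y z, P x [:: y; z]) ->
  (forall x y1 y2 y3 p, P y3 p -> P x [:: y1, y2, y3 & p]) ->
  forall x p, P x p.
Proof.
move=> P0 P1 P2 P3 x p; move: {2}(size p) (leqnn (size p)) x => n.
elim: n p => [|n IH] [|y1 [|y2 [|y3 p]]]//= sp x.
by apply: P3; apply: IH; move: sp; rewrite ltnS => sp; lia.
Qed.

End GeodesicPairs.

Definition geodesic_weight {R : realType} {V : Type} (h : V -> V -> R) x p : R :=
  \prod_(eb <- geodesic_pairs x p) bern eb.2 (h eb.1.1 eb.1.2).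

Lemma geodesic_weight_map {R : realType} {V U : Type} (f : V -> U)
    (h : U -> U -> R) x p :
  geodesic_weight h (f x) (map f p) = geodesic_weight (fun x y => h (f x) (f y)) x p.
Proof.
rewrite /geodesic_weight; move: x p; apply: seq_ind3 => [x|x y|x y z|x y1 y2 y3 p IH] /=;
  by rewrite ?big_cons ?big_nil //= IH.
Qed.

Lemma eq_geodesic_weight {R : realType} {V : eqType} (h h' : V -> V -> R) x p :
  {in x :: p &, forall y z, y != z -> h y z = h' y z} -> uniq (x :: p) ->
  geodesic_weight h x p = geodesic_weight h' x p.
Proof.
rewrite /geodesic_weight; move: x p; apply: seq_ind3 => [x|x y|x y z|x y1 y2 y3 p IH] hh.
- by rewrite !big_nil.
- rewrite /= inE andbT => xy; rewrite !big_cons !big_nil /= hh// !inE eqxx ?orbT//.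
- rewrite /= !inE negb_or => /and3P[/andP[xy xz] yz _].
  by rewrite !big_cons !big_nil /= !hh// !inE eqxx ?orbT.
- rewrite [uniq _]/= !inE !negb_or.
  move=> /and4P[/and4P[xy1 xy2 xy3 xp] /and3P[y12 y13 y1p] /andP[y23 y2p] up].
  rewrite /= !big_cons IH//=; last first.
    by move=> y z yp zp; apply: hh; rewrite 3!in_cons ?yp ?zp ?orbT.
  by rewrite !hh// !inE eqxx ?orbT.
Qed.

(** A path of minimal length is a geodesic: an edge between the end points of a
    block would shorten it by two steps. *)
Lemma connect_geodesic {V : finType} (h : rel V) (u v : V) : connect h u v ->
  exists p, [/\ (size p < #|V|)%N, uniq (u :: p), last u p = v &
    all (fun eb => h eb.1.1 eb.1.2 == eb.2) (geodesic_pairs u p)].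
Proof.
move=> /connectP[p0 p0P p0v].
have ex : exists n, [exists t : n.-tuple V, path h u t && (last u t == v)].
  by exists (size p0); apply/existsP; exists (in_tuple p0); rewrite p0P p0v eqxx.
case: (ex_minnP ex) => n /existsP[t /andP[tP /eqP tv]] nmin.
move: tv; case/shortenP: tP => p pP up pt pv.
have minp p2 : path h u p2 -> last u p2 = v -> (size p <= size p2)%N.
  move=> p2P p2v; apply: (@leq_trans n).
    by rewrite -(size_tuple t); apply: uniq_leq_size pt; case/andP: up.
  apply: nmin; apply/existsP; exists (in_tuple p2).
  by rewrite p2P p2v eqxx.
exists p; split=> //.
  by have := max_card (mem (u :: p)); rewrite (card_uniqP up).
move: minp pP; rewrite -pv; move: u p {p0P p0v ex t nmin up pt pv p0 n v}.
apply: seq_ind3 => [x|x y|x y z|x y1 y2 y3 p IH] minp /=.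
- by [].
- by rewrite andbT => ->.
- by rewrite andbT => /andP[-> ->].
- move=> /and4P[h1 h2 h3 pP]; rewrite h1 h2 h3 /=.
  have -> /= : h x y3 = false.
    apply/negP => xy3; have := minp (y3 :: p); rewrite /= xy3 pP.
    by move=> /(_ isT erefl); rewrite ltnS; lia.
  apply: IH => // p2 p2P p2v; have := minp [:: y1, y2, y3 & p2].
  by rewrite /= h1 h2 h3 p2P p2v => /(_ isT erefl); rewrite !ltnS.
Qed.

Section Ordinals.
Context {R : realType} {m : nat}.
Local Notation V := 'I_m.

(** The status of an unordered pair is stored at its increasing enumeration; the
    other ordered pairs have probability 0, see [q_unused] below. *)
Definition edge_of (x y : V) : V * V := if (x < y)%N then (x, y) else (y, x).

Lemma edge_ofP x y z t : edge_of x y = edge_of z t ->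
  (x = z /\ y = t) \/ (x = t /\ y = z).
Proof. by rewrite /edge_of; do 2!case: ifP => _; move=> [-> ->]; auto. Qed.

Lemma uniq_geodesic_edges (x : V) p : uniq (x :: p) ->
  uniq [seq edge_of eb.1.1 eb.1.2 | eb <- geodesic_pairs x p].
Proof.
have sub (y : V) q : {in geodesic_pairs y q, forall eb,
    (eb.1.1 \in y :: q) && (eb.1.2 \in y :: q)}.
  move: y q; apply: seq_ind3 => [y|y z|y z t|y y1 y2 y3 q IH] eb //=.
  - by rewrite !inE => /eqP -> /=; rewrite !eqxx ?orbT.
  - by rewrite !inE => /orP[]/eqP -> /=; rewrite !eqxx ?orbT.
  - rewrite !(inE, in_cons).
    do 4?[case/predU1P => [->|]; first by rewrite /= !eqxx ?orbT].
    by move=> /IH; rewrite !inE => /andP[/orP[]-> /orP[]->]; rewrite ?orbT.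
move: x p; apply: seq_ind3 => [x|x y|x y z|x y1 y2 y3 p IH] //.
- rewrite /= !inE !andbT negb_or => /andP[/andP[xy xz] yz].
  by apply/negP => /eqP/edge_ofP[[xyE _]|[xzE _]]; subst; rewrite eqxx in xy xz.
- rewrite [uniq (_ :: _)]/= !inE !negb_or.
  move=> /and4P[/and4P[xy1 xy2 xy3 xp] /and3P[y12 y13 y1p] /andP[y23 y2p] up].
  have nmem a b : (a \notin y3 :: p) || (b \notin y3 :: p) ->
      edge_of a b \notin [seq edge_of eb.1.1 eb.1.2 | eb <- geodesic_pairs y3 p].
    apply: contraL => /mapP[[[c e] f] /sub /= /andP[cP eP]].
    by move=> /edge_ofP[][-> ->]; rewrite negb_or !negbK ?cP ?eP.
  have ne a b c e : (a != c) && (a != e) || (b != c) && (b != e) -> edge_of a b != edge_of c e.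
    by apply: contraTneq => /edge_ofP[][-> ->]; rewrite !eqxx ?andbF.
  have [y31 y32] : (y3 != y1) /\ (y3 != y2) by rewrite ![y3 == _]eq_sym.
  have [y1x y3x] : (y1 != x) /\ (y3 != x) by rewrite ![_ == x]eq_sym.
  have y2x : y2 != x by rewrite eq_sym.
  rewrite /= !inE !negb_or !ne ?nmem ?IH ?inE ?negb_or ?xy3 ?y13 ?y23 ?xy2 ?xy1 ?y12
    ?y1x ?y2x ?y31 ?xp ?y1p ?y2p ?y32 ?y3x ?orbT ?andbT //.
Qed.

Variables q_in q_out : V * V -> R.
Hypothesis q_rng : forall e, [/\ 0 <= q_out e, q_out e <= q_in e & q_in e <= 1].
Hypothesis q_unused : forall e : V * V, ~~ (e.1 < e.2)%N -> q_in e = 0.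

Let g e := q_in e - q_out e.

Let g_rng e : 0 <= g e <= 1.
Proof. by have [? ? ?] := q_rng e; rewrite /g; lra. Qed.

Let bern_ge0 b e : 0 <= bern b (g e).
Proof. by have := g_rng e; rewrite /bern; case: b; lra. Qed.

(** Each connected pair [u], [v] is charged to one geodesic from [u] to [v].  A
    set [H] with an edge stored in the wrong order has probability 0; for the
    other ones [adj H] is the relation given by [edge_of]. *)
Lemma sum_connect_geodesics (H : {set V * V}) :
  (\sum_u \sum_v (connect (adj H) u v)%:R) * (\prod_e bern (e \in H) (g e)) <=
  \sum_(k < m) \sum_(t : k.+1.-tuple V | uniq t)
    (all (fun eb => (edge_of eb.1.1 eb.1.2 \in H) == eb.2)
       (geodesic_pairs (thead t) (behead t)))%:R *
     (\prod_e bern (e \in H) (g e)) :> R.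
Proof.
have [/existsP[e /andP[eH ne]]|] := boolP [exists e, (e \in H) && ~~ (e.1 < e.2)%N].
  have -> : \prod_e bern (e \in H) (g e) = 0.
    rewrite (bigD1 e)//= eH /bern.
    suff -> : g e = 0 by rewrite mul0r.
    by rewrite /g q_unused//; have [] := q_rng e; rewrite q_unused//; lra.
  rewrite mulr0; apply: sumr_ge0 => k _; apply: sumr_ge0 => t _.
  by rewrite mulr0.
move=> /existsPn sorted.
have {}sorted x y : (x, y) \in H -> (x < y)%N.
  by move=> xyH; have := sorted (x, y); rewrite xyH /= negbK.
under [leRHS]eq_bigr do rewrite -mulr_suml.
rewrite -mulr_suml; apply: ler_wpM2r; first by apply: prodr_ge0 => e _.
pose good k (t : k.+1.-tuple V) := all (fun eb => (edge_of eb.1.1 eb.1.2 \in H) == eb.2)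
       (geodesic_pairs (thead t) (behead t)).
apply: (@le_trans _ _ (\sum_u \sum_v \sum_(k < m) \sum_(t : k.+1.-tuple V | uniq t)
   ((thead t == u) && (last (thead t) (behead t) == v) && good k t)%:R)); last first.
  under eq_bigr do rewrite exchange_big.
  rewrite exchange_big; apply: ler_sum => k _.
  under eq_bigr do rewrite exchange_big.
  rewrite exchange_big; apply: ler_sum => t ut /=.
  rewrite (bigD1 (thead t))//= [X in _ + X]big1 ?addr0; last first.
    by move=> u ne; rewrite big1// => v _; rewrite eq_sym (negbTE ne).
  rewrite (bigD1 (last (thead t) (behead t)))//= [X in _ + X]big1 ?addr0; last first.
    by move=> u ne; rewrite [last _ _ == _]eq_sym (negbTE ne) andbF.
  by rewrite !eqxx.
apply: ler_sum => u _; apply: ler_sum => v _.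
have [|_] := boolP (connect (adj H) u v); last first.
  by apply: sumr_ge0 => k _; apply: sumr_ge0.
rewrite (@eq_connect _ (adj H) (fun x y => edge_of x y \in H)); last first.
  move=> x y; rewrite /adj /edge_of; case: ltnP => xy.
    by case: (boolP ((y, x) \in H)) => [/sorted|]; rewrite ?orbF// ltnNge (ltnW xy).
  by case: (boolP ((x, y) \in H)) => [/sorted|]; rewrite ?orbF// ltnNge xy.
move=> /connect_geodesic[p [sp up lp gp]].
move: sp; rewrite card_ord => sp.
rewrite (bigD1 (Ordinal sp)) //=.
rewrite (bigD1 [tuple of u :: in_tuple p]) //= theadE eqxx lp eqxx /=.
rewrite /good theadE /= gp -addrA lerDl addr_ge0//; first exact: sumr_ge0.
by apply: sumr_ge0 => k _; apply: sumr_ge0.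
Qed.

(** Chebyshev's inequality for the sum of the [spin (T a i) * spin (z i)], whose
    second moment is bounded by the expected number of connected pairs, hence by
    the expected number of geodesics. *)
Lemma overlap_bound (T : {ffun V * V -> bool} -> V -> bool) (b : R) : 0 < b ->
  \sum_(z : {ffun V -> bool}) \sum_(a : {ffun V * V -> bool})
    (b <= `|\sum_i spin (T a i) * spin (z i)|)%R%:R *
    (2^-1 ^+ m * \prod_e bern (a e) (sbm_prob q_in q_out z e))
  <= b ^- 2 * \sum_(k < m) \sum_(t : k.+1.-tuple V | uniq t)
    geodesic_weight (fun x y => g (edge_of x y)) (thead t) (behead t).
Proof.
move=> b0.
have pr0 z e a : 0 <= bern a (sbm_prob q_in q_out z e).
  by have [? ? ?] := q_rng e; rewrite /bern /sbm_prob; case: a; case: ifP; lra.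
apply: (@le_trans _ _ (b ^- 2 * (2^-1 ^+ m * \sum_(z : {ffun V -> bool}) \sum_(a : {ffun V * V -> bool})
  (\sum_i spin (T a i) * spin (z i)) ^+ 2 * \prod_e bern (a e) (sbm_prob q_in q_out z e)))).
  rewrite mulrA mulr_sumr; apply: ler_sum => z _; rewrite mulr_sumr; apply: ler_sum => a _.
  rewrite mulrA [leRHS]mulrA; apply: ler_wpM2r; first exact: prodr_ge0.
  rewrite [leRHS]mulrAC; apply: ler_wpM2r; first by rewrite exprn_ge0 ?invr_ge0.
  rewrite mulrC ler_pdivlMr ?exprn_gt0//.
  case: (lerP b) => [bs|_]; last by rewrite mul0r sqr_ge0.
  by rewrite mul1r -[leRHS]real_normK ?num_real// lerXn2r// nnegrE ltW.
apply: ler_wpM2l; first by rewrite invr_ge0 exprn_ge0// ltW.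
apply: (@le_trans _ _ (\sum_u \sum_v \sum_(H : {set V * V})
      (connect (adj H) u v)%:R * \prod_e bern (e \in H) (g e))).
  rewrite exprVn mulrC ler_pdivrMr ?exprn_gt0// mulr_suml.
  apply: (@le_trans _ _ (\sum_u \sum_v \sum_(z : {ffun V -> bool}) \sum_(a : {ffun V * V -> bool})
    spin (T a u) * spin (T a v) * (spin (z u) * spin (z v)) *
    \prod_e bern (a e) (sbm_prob q_in q_out z e))); last first.
    apply: ler_sum => u _; rewrite mulr_suml; apply: ler_sum => v _.
    by have := information_percolation q_rng T u v; rewrite card_ord mulrC.
  under [leRHS]eq_bigr do rewrite exchange_big.
  rewrite [leRHS]exchange_big; apply: ler_sum => z _ /=.
  under [leRHS]eq_bigr do rewrite exchange_big.
  rewrite [leRHS]exchange_big; apply: ler_sum => a _ /=.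
  rewrite expr2 -mulrA mulr_suml; apply: ler_sum => u _.
  rewrite mulrA mulr_sumr mulr_suml; apply: ler_sum => v _.
  by rewrite mulrACA.
under eq_bigr do rewrite exchange_big.
rewrite exchange_big.
apply: (@le_trans _ _ (\sum_(H : {set V * V}) \sum_(k < m) \sum_(t : k.+1.-tuple V | uniq t)
    (all (fun eb => (edge_of eb.1.1 eb.1.2 \in H) == eb.2)
       (geodesic_pairs (thead t) (behead t)))%:R *
     (\prod_e bern (e \in H) (g e)))).
  apply: ler_sum => H _; apply: le_trans (sum_connect_geodesics H).
  rewrite mulr_suml; apply: ler_sum => u _.
  by rewrite mulr_suml; apply: ler_sum => v _.
rewrite exchange_big; apply: ler_sum => k _.
rewrite exchange_big; apply: ler_sum => t ut /=.
pose L := [seq (edge_of eb.1.1 eb.1.2, eb.2) | eb <- geodesic_pairs (thead t) (behead t)].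
have uL : uniq (map fst L).
  rewrite -map_comp; apply: uniq_geodesic_edges.
  by rewrite {1}(tuple_eta t) in ut.
rewrite /geodesic_weight [leRHS](_ : _ = \prod_(eb <- L) bern eb.2 (g eb.1)); last first.
  by rewrite /L big_map.
rewrite -prescribed_edges//.
by apply: ler_sum => H _; rewrite /L all_map.
Qed.

End Ordinals.

(** * Product powers of a finite measure *)

Definition tuple_box {T : Type} k (A : 'I_k -> set T) : set (k.-tuple T) :=
  [set t | forall i, A i (tnth t i)].

Lemma measurable_tuple_box d (T : measurableType d) k (A : 'I_k -> set T) :
  (forall i, measurable (A i)) -> measurable (tuple_box A).
Proof.
move=> mA; rewrite (_ : tuple_box A =
    \bigcap_(i in [set: 'I_k]) ((fun t : k.-tuple T => tnth t i) @^-1` A i)); last first.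
  by apply/seteqP; split=> [t h i _|t h i]; [exact: h|exact: (h i)].
apply: fin_bigcap_measurable => [|i _]; first exact: finite_finset.
by rewrite -[X in measurable X]setTI; exact: measurable_tnth.
Qed.

Lemma tuple_box_cons {T : Type} k (A : 'I_k.+1 -> set T) (x : T) (t : k.-tuple T) :
  tuple_box A [tuple of x :: t] <-> A ord0 x /\ tuple_box (fun i => A (lift ord0 i)) t.
Proof.
split=> [h|[h0 h] i].
  by split=> [|i]; [exact: (h ord0)|have := h (lift ord0 i); rewrite tnthS].
by case: (unliftP ord0 i) => [j ->|->//]; rewrite tnthS; exact: h.
Qed.

Section MeasureTupleUnique.
Context {R : realType} d (T : measurableType d) (k : nat).

(** Boxes are stable under intersection and generate the product
    sigma-algebra. *)
Lemma measure_tuple_unique (m1 m2 : {measure set (k.-tuple T) -> \bar R}) :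
  (forall A : 'I_k -> set T, (forall i, measurable (A i)) ->
     m1 (tuple_box A) = m2 (tuple_box A)) ->
  (m1 setT < +oo)%E -> forall A, measurable A -> m1 A = m2 A.
Proof.
move=> m12 m1oo; pose G := [set tuple_box A | A in
  [set A : 'I_k -> set T | forall i, measurable (A i)]].
have TT : tuple_box (fun _ : 'I_k => [set: T]) = setT by apply/seteqP; split.
have GT : G setT by exists (fun=> setT).
apply: (measure_unique G (fun=> setT)) => //.
- apply/seteqP; split.
    apply: smallest_sub; first exact: smallest_sigma_algebra.
    rewrite -bigcup_seq => A [i _ [B mB <-]]; apply: sub_sigma_algebra.
    exists (fun j => if j == i then B else setT).
      by move=> j; case: ifP.
    rewrite setTI; apply/seteqP; split=> t /=.
      by move=> /(_ i); rewrite eqxx.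
    by move=> Bt j; case: ifPn => // /eqP ->.
  apply: smallest_sub; first exact: sigma_algebra_measurable.
  by move=> _ [A mA <-]; exact: measurable_tuple_box.
- move=> _ _ [A mA <-] [B mB <-]; exists (fun i => A i `&` B i).
    by move=> i; exact: measurableI.
  apply/seteqP; split=> t; first by move=> h; split=> i; have [] := h i.
  by move=> [hA hB] i; split; [exact: hA|exact: hB].
- by apply/seteqP; split=> // t _; exists 0%N.
- by move=> _ [A mA <-]; exact: m12.
Qed.

End MeasureTupleUnique.

Section ConsMeasure.
Context {R : realType} d (T : measurableType d) (k : nat).
Variables (mu : {finite_measure set T -> \bar R})
  (nu : {finite_measure set (k.-tuple T) -> \bar R}).

Let consp (p : T * k.-tuple T) : k.+1.-tuple T := [tuple of p.1 :: p.2].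

Let mconsp : measurable_fun setT consp.
Proof. exact: measurable_cons. Qed.

Definition cons_measure : set (k.+1.-tuple T) -> \bar R :=
  pushforward (mu \x nu)%E consp.

Let cons_measure0 : cons_measure set0 = 0%E.
Proof. by rewrite /cons_measure /pushforward preimage_set0 measure0. Qed.

Let cons_measure_ge0 A : (0 <= cons_measure A)%E.
Proof. exact: (measure_ge0 (mu \x nu)%E _). Qed.

Let cons_measure_sigma_additive : semi_sigma_additive cons_measure.
Proof.
exact: (@measure_semi_sigma_additive _ _ _
  (measure_function_pushforward__canonical__measure_function_Measure
     (mu \x nu)%E mconsp)).
Qed.

HB.instance Definition _ := isMeasure.Build _ _ _ cons_measure
  cons_measure0 cons_measure_ge0 cons_measure_sigma_additive.

Let cons_measure_fin : fin_num_fun cons_measure.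
Proof.
apply: lty_fin_num_fun; rewrite /= /cons_measure /pushforward preimage_setT -setXTT.
by rewrite /= product_measure1E// lte_mul_pinfty// ?fin_num_measure// ltey_eq fin_num_measure.
Qed.

HB.instance Definition _ := Measure_isFinite.Build _ _ _ cons_measure cons_measure_fin.

Lemma cons_measure_box A : (forall i, measurable (A i)) ->
  cons_measure (tuple_box A) = (mu (A ord0) * nu (tuple_box (fun i => A (lift ord0 i))))%E.
Proof.
move=> mA; rewrite /cons_measure /pushforward.
rewrite (_ : consp @^-1` _ = A ord0 `*` tuple_box (fun i => A (lift ord0 i))).
  by rewrite product_measure1E//; exact: measurable_tuple_box.
by apply/seteqP; split=> -[x t] /tuple_box_cons.
Qed.

Lemma integral_cons_measure (F : k.+1.-tuple T -> \bar R) :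
  measurable_fun [set: k.+1.-tuple T] F -> (forall t, 0 <= F t)%E ->
  (\int[cons_measure]_t F t = \int[mu]_x \int[nu]_t F [tuple of x :: t])%E.
Proof.
move=> mF F0.
transitivity (\int[mu \x nu]_p (F \o consp) p)%E.
  exact: (ge0_integral_pushforward mconsp (mu \x nu)%E).
rewrite fubini_tonelli1//.
  exact: measurableT_comp.
by move=> p /=; exact: F0.
Qed.

End ConsMeasure.

Section PowerMeasure.
Context {R : realType} d (T : measurableType d).
Variable mu : {finite_measure set T -> \bar R}.

Fixpoint power_measure (k : nat) : {finite_measure set (k.-tuple T) -> \bar R} :=
  match k with
  | 0 => [the {finite_measure set (0.-tuple T) -> \bar R} of dirac ([tuple] : 0.-tuple T)]
  | k'.+1 => [the {finite_measure set (k'.+1.-tuple T) -> \bar R} of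
                cons_measure mu (power_measure k')]
  end.

Lemma power_measure_box k (A : 'I_k -> set T) : (forall i, measurable (A i)) ->
  power_measure k (tuple_box A) = (\prod_(i < k) mu (A i))%E.
Proof.
elim: k A => [|k IH] A mA /=; first by rewrite big_ord0 diracE mem_set// => -[].
by rewrite big_ord_recl cons_measure_box// IH.
Qed.

End PowerMeasure.

(** * Poisson weights and independent counts *)

Section FactorialMoment.
Context {R : realType}.

Lemma nneseries_exp (x : R) : 0 <= x ->
  (\sum_(0 <= k <oo) (x ^+ k / k`!%:R)%:E = (expR x)%:E)%E.
Proof.
move=> x0; rewrite expRE -EFin_lim; last first.
  rewrite /pseries/=; under eq_fun do rewrite mulrC.
  exact: is_cvg_series_exp_coeff.
apply/congr_lim/funext => n/=; rewrite /pseries/= /series/= -sumEFin//.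
by under eq_bigr do rewrite mulrC.
Qed.

(** The first [r] terms vanish, and in the others the falling factorial cancels
    against [k`!], which leaves the exponential series shifted by [r]. *)
Lemma poisson_factorial_moment (x : R) (r : nat) : 0 <= x ->
  (\sum_(0 <= k <oo) ((k ^_ r)%:R)%:E * (poisson_weight x k)%:E = (x ^+ r)%:E)%E.
Proof.
move=> x0.
have w0 k : (0 <= ((k ^_ r)%:R)%:E * (poisson_weight x k)%:E)%E.
  by rewrite -EFinM lee_fin mulr_ge0// /poisson_weight mulr_ge0 ?expR_ge0// divr_ge0// exprn_ge0.
rewrite (nneseries_split _ r)//= add0n big1_seq ?add0e; last first.
  by move=> k /andP[_]; rewrite mem_index_iota => /andP[_ kr]; rewrite ffact_small// mul0e.
rewrite -nneseries_addn//.
transitivity (\sum_(0 <= k <oo) (x ^+ r * expR (- x))%:E * (x ^+ k / k`!%:R)%:E)%E.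
  apply: eq_eseriesr => k _; rewrite -!EFinM; congr (_%:E).
  rewrite /poisson_weight exprD.
  have -> : ((k + r)`!)%:R = ((k + r) ^_ r)%:R * k`!%:R :> R.
    by rewrite -natrM -{3}(addnK r k) ffact_fact// leq_addl.
  have f1 : k`!%:R != 0 :> R by rewrite pnatr_eq0 -lt0n fact_gt0.
  have f2 : ((k + r) ^_ r)%:R != 0 :> R by rewrite pnatr_eq0 -lt0n ffact_gt0 leq_addl.
  by field; rewrite f1 f2.
rewrite nneseriesZl; last by move=> k _; rewrite lee_fin divr_ge0// exprn_ge0.
by rewrite nneseries_exp// -EFinM -mulrA -expRD addNr expR0 mulr1.
Qed.

(** An exponential moment bound: for [k < M] the weight of [k] at [x] is at most
    [2 ^+ M * expR (- (x / 2))] times its weight at [x / 2]. *)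
Lemma poisson_small (x : R) (M : nat) : 0 <= x ->
  \sum_(k < M) poisson_weight x k <= 2 ^+ M * expR (- (x / 2)).
Proof.
move=> x0.
have x20 : 0 <= x / 2 by rewrite divr_ge0.
apply: (@le_trans _ _ (2 ^+ M * expR (- x) * \sum_(k < M) (x / 2) ^+ k / k`!%:R)).
  rewrite mulr_sumr; apply: ler_sum => k _.
  rewrite (_ : _ * _ * _ = 2 ^+ M * (x / 2) ^+ k * (expR (- x) / k`!%:R)); last by ring.
  rewrite /poisson_weight (_ : _ * _ = x ^+ k * (expR (- x) / k`!%:R)); last by ring.
  apply: ler_wpM2r; first by rewrite divr_ge0// expR_ge0.
  rewrite -{1}[x](divfK (_ : 2 != 0))// exprMn mulrC; apply: ler_wpM2r.
    exact: exprn_ge0.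
  by rewrite ler_eXn2l ?ltr1n// ltnW.
rewrite (_ : - (x / 2) = - x + x / 2); last by field.
rewrite expRD mulrA; apply: ler_wpM2l; first by rewrite mulr_ge0 ?expR_ge0.
rewrite -lee_fin -nneseries_exp// -sumEFin -(big_mkord xpredT (fun k => ((x / 2) ^+ k / k`!%:R)%:E)).
apply: nneseries_lim_ge => k _ _.
by rewrite lee_fin divr_ge0// exprn_ge0.
Qed.

Lemma nneseriesZl_ge0 (c : \bar R) (f : nat -> \bar R) :
  (0 <= c -> (forall k, 0 <= f k) ->
   \sum_(0 <= k <oo) (c * f k) = c * \sum_(0 <= k <oo) f k)%E.
Proof.
move=> c0 f0.
rewrite -(ge0_integral_count (a := fun k => c * f k)%E); last by move=> k; rewrite mule_ge0.
by rewrite ge0_integralZl// ge0_integral_count.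
Qed.

End FactorialMoment.

Section ExpectationProduct.
Context {R : realType} d (W : measurableType d) (P : probability W R) (p : nat).
Variables (Ev : 'I_p -> nat -> set W) (h : 'I_p -> nat -> R).
Hypothesis mEv : forall j k, measurable (Ev j k).
Hypothesis h0 : forall j k, 0 <= h j k.
Hypothesis indep : forall k : 'I_p -> nat,
  P [set w | forall j, Ev j (k j) w] = (\prod_(j < p) P (Ev j (k j)))%E.

Let H j w : \bar R := (\sum_(0 <= k <oo) (h j k)%:E * (\1_(Ev j k) w)%:E)%E.
Let EH j : \bar R := (\sum_(0 <= k <oo) (h j k)%:E * P (Ev j k))%E.

Let H0 j w : (0 <= H j w)%E.
Proof. by apply: nneseries_ge0 => k _ _; rewrite -EFinM lee_fin mulr_ge0. Qed.

Let mH j : measurable_fun setT (H j).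
Proof.
apply: ge0_emeasurable_sum => // k; first by move=> x _ _; rewrite -EFinM lee_fin mulr_ge0.
by move=> _; apply: measurable_funeM; apply/measurable_EFinP; exact: measurable_indic.
Qed.

(** The expectation of a product of functions of independent integer variables,
    where [Ev j k] is the event that the [j]-th variable takes the value [k].
    Independence is only known for the events of single values, so the sums are
    restored one variable at a time: in the proof [F r k] has the full sum for
    the variables of index less than [r] and an indicator for the others. *)
Lemma expectation_prod :
  (\int[P]_w \prod_(j < p) (\sum_(0 <= k <oo) (h j k)%:E * (\1_(Ev j k) w)%:E)
  = \prod_(j < p) \sum_(0 <= k <oo) (h j k)%:E * P (Ev j k))%E.
Proof.
pose F r (k : 'I_p -> nat) (j : 'I_p) w : \bar R :=
  if (j < r)%N then H j w else (\1_(Ev j (k j)) w)%:E.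
have F0 r k j w : (0 <= F r k j w)%E by rewrite /F; case: ifP => // _; rewrite lee_fin.
have mF r k j : measurable_fun setT (F r k j).
  rewrite /F; case: (j < r)%N => //; apply/measurable_EFinP; exact: measurable_indic.
have mprod (s : seq 'I_p) (q : pred 'I_p) r k : measurable_fun setT (fun w => \prod_(j <- s | q j) F r k j w)%E.
  elim: s => [|j s IH]; first by under eq_fun do rewrite big_nil; exact: measurable_cst.
  under eq_fun do rewrite big_cons; case: (q j) => //.
  exact: emeasurable_funM.
suff main r : (r <= p)%N -> forall k : 'I_p -> nat, (\int[P]_w \prod_(j < p) F r k j w =
    \prod_(j < p) if (j < r)%N then EH j else P (Ev j (k j)))%E.
  transitivity (\int[P]_w \prod_(j < p) F p (fun=> 0%N) j w)%E.
    by apply: eq_integral => w _; apply: eq_bigr => j _; rewrite /F ltn_ord.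
  by rewrite main//; apply: eq_bigr => j _; rewrite ltn_ord.
elim: r => [_ k|r IH rp k].
  rewrite [RHS](_ : _ = \prod_(j < p) P (Ev j (k j)))%E; last by apply: eq_bigr.
  rewrite -indep (_ : [set w | _] = \bigcap_(j in [set: 'I_p]) Ev j (k j)); last first.
    by apply/seteqP; split=> [w h1 j _|w h1 j]; [exact: h1|exact: (h1 j)].
  have mI : measurable (\bigcap_(j in [set: 'I_p]) Ev j (k j)).
    by apply: fin_bigcap_measurable => [|j _]; [exact: finite_finset|exact: mEv].
  rewrite -[X in P X]setIT -integral_indic//; apply: eq_integral => w _ /=.
  rewrite prodEFin; congr (_%:E).
  rewrite indicE; case: (boolP (w \in _)) => [/set_mem wI|/negP wI].
    by rewrite big1// => j _; rewrite indicE mem_set//; exact: wI.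
  have [j jE] : exists j, ~ Ev j (k j) w.
    by apply/existsNP => wE; apply: wI; rewrite inE => j _; exact: wE.
  by rewrite (bigD1 j)//= indicE memNset// mul0r.
pose j0 := Ordinal rp.
pose upd n (j : 'I_p) := if j == j0 then n else k j.
transitivity (\int[P]_w \sum_(0 <= n <oo) (h j0 n)%:E * \prod_(j < p) F r (upd n) j w)%E.
  apply: eq_integral => w _; rewrite (bigD1 j0)//= {1}/F ltnSn.
  have pr_eq n : (\prod_(j < p | j != j0) F r.+1 k j w = \prod_(j < p | j != j0) F r (upd n) j w)%E.
    apply: eq_bigr => j jj0; rewrite /F /upd (negbTE jj0) ltnS leq_eqVlt.
    by have /negbTE -> : (j : nat) != r by apply: contra jj0 => /eqP jr; apply/eqP/val_inj.
  have pr0 : (0 <= \prod_(j < p | j != j0) F r.+1 k j w)%E.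
    by apply: prode_ge0 => j _.
  rewrite /H muleC -nneseriesZl_ge0//; last by move=> n; rewrite -EFinM lee_fin mulr_ge0.
  apply: eq_eseriesr => n _; rewrite [in RHS](bigD1 j0)//= -pr_eq.
  have -> : F r (upd n) j0 w = (\1_(Ev j0 n) w)%:E by rewrite /F ltnn /upd eqxx.
  by rewrite muleC muleA.
rewrite integral_nneseries//; last first.
  - by move=> n w _; rewrite mule_ge0 ?lee_fin// prode_ge0.
  - by move=> n; apply: measurable_funeM; exact: mprod.
rewrite (bigD1 j0)//= ltnSn muleC.
rewrite -nneseriesZl_ge0//; last 2 first.
  - apply: prode_ge0 => j _; case: ifP => // _; apply: nneseries_ge0 => n _ _.
    by rewrite mule_ge0 ?lee_fin.
  - by move=> n; rewrite mule_ge0 ?lee_fin.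
apply: eq_eseriesr => n _.
rewrite ge0_integralZl ?lee_fin//; last by move=> w _; exact: prode_ge0.
rewrite IH ?(ltnW rp)// (bigD1 j0)//= ltnn /upd eqxx muleCA muleC muleA; congr (_ * _)%E.
rewrite muleC; congr (_ * _)%E; apply: eq_bigr => j jj0.
rewrite (negbTE jj0) ltnS [(j <= r)%N]leq_eqVlt.
by have /negbTE -> : (j : nat) != r by apply: contra jj0 => /eqP jr; apply/eqP/val_inj.
Qed.

End ExpectationProduct.

(** * Counting injections, and sums of measures *)

Section CountInjections.
Context {I J : finType}.

Lemma big_tuple_cons (k : nat) (F : k.+1.-tuple I -> nat) :
  (\sum_(t : k.+1.-tuple I) F t =
   \sum_(t : k.-tuple I) \sum_(x : I) F [tuple of x :: t])%N.
Proof.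
rewrite exchange_big pair_big /=.
rewrite (reindex (fun p : I * k.-tuple I => [tuple of p.1 :: p.2])) //.
exists (fun t => (thead t, [tuple of behead t])).
  by move=> [x t] _ /=; congr pair; apply: val_inj.
by move=> t _ /=; rewrite [RHS]tuple_eta.
Qed.

Variable S : J -> {set I}.
Hypothesis S_disj : forall i q q', i \in S q -> i \in S q' -> q = q'.

(** The tuples of distinct elements whose [l]-th entry lies in [S (tnth s l)]:
    the entries for each class [q] are chosen independently, and there are
    [#|S q| ^_ (count_mem q s)] choices.  The proof adds one entry at a time; the
    entries already chosen in its class are those of the same label in [s]. *)
Lemma count_injections k (s : k.-tuple J) :
  (\sum_(t : k.-tuple I | uniq t) [forall l, tnth t l \in S (tnth s l)] =
   \prod_(q : J) #|S q| ^_ (count_mem q s))%N.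
Proof.
rewrite big_mkcond; elim: k s => [|k IH] s.
  rewrite (bigD1 [tuple]) //= big1; last by move=> t; rewrite tuple0.
  rewrite big1; last by move=> q _; rewrite tuple0 /= ffactn0.
  by rewrite addn0; case: forallP => // -[] [].
case/tupleP: s => q0 s; rewrite big_tuple_cons.
transitivity (\sum_(t : k.-tuple I) (if uniq t then nat_of_bool [forall l, tnth t l \in S (tnth s l)] else 0) *
   (#|S q0| - count_mem q0 s))%N.
  apply: eq_bigr => t _.
  have E x : [forall l, tnth [tuple of x :: t] l \in S (tnth [tuple of q0 :: s] l)] =
     (x \in S q0) && [forall l, tnth t l \in S (tnth s l)].
    apply/forallP/andP => [h|[xS /forallP h] l].
      split; first by have := h ord0; rewrite !tnth0.
      by apply/forallP => l; have := h (lift ord0 l); rewrite !tnthS.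
    by case: (unliftP ord0 l) => [j ->|->]; rewrite ?tnthS ?tnth0.
  under eq_bigr do rewrite E /=.
  case: (boolP (uniq t)) => ut; last by rewrite mul0n big1// => x _; rewrite andbF.
  case: forallP => [tS|_]; last by rewrite mul0n big1// => x _; rewrite andbT andbF; case: ifP.
  rewrite mul1n.
  transitivity (#|[set x in S q0 | x \notin t]|).
    rewrite -sum1_card [RHS]big_mkcond; apply: eq_bigr => x _.
    by rewrite !inE !andbT; case: (x \in S q0); case: (x \notin t).
  rewrite -[in RHS](cardsID [set x in t] (S q0)).
  have -> : #|S q0 :&: [set x in t]| = count_mem q0 s.
    have -> : S q0 :&: [set x in t] = [set x in [seq x <- t | x \in S q0]].
      by apply/setP => x; rewrite !inE mem_filter.
    rewrite cardsE (card_uniqP (filter_uniq _ ut)) size_filter.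
    rewrite -(map_tnth_enum t) -(map_tnth_enum s) !count_map.
    apply: eq_count => l /=; apply/idP/eqP => [tl|<-]; last exact: tS.
    exact: S_disj (tS l) tl.
  rewrite addKn; apply: eq_card => x; rewrite !inE andbC //.
rewrite -big_distrl /= IH.
rewrite [in RHS](bigD1 q0) //= eqxx add1n ffactnSr mulnAC; congr (_ * _)%N.
rewrite (bigD1 q0) //=; congr (_ * _)%N; apply: eq_bigr => q qq0.
by rewrite eq_sym (negbTE qq0).
Qed.

End CountInjections.

Section Measures.
Context {R : realType}.

Definition image_measure d1 d2 (T1 : measurableType d1) (T2 : measurableType d2)
    (mu : {measure set T1 -> \bar R}) (f : T1 -> T2) (mf : measurable_fun setT f) :
    {measure set T2 -> \bar R} :=
  measure_function_pushforward__canonical__measure_function_Measure mu mf.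

Fixpoint sum_measure d (T : measurableType d) (s : seq {measure set T -> \bar R}) :
    {measure set T -> \bar R} :=
  if s is mu :: s' then [the {measure set T -> \bar R} of measure_add mu (sum_measure s')]
  else [the {measure set T -> \bar R} of mzero].

Lemma sum_measureE d (T : measurableType d) (s : seq {measure set T -> \bar R}) A :
  (sum_measure s A = \sum_(mu <- s) mu A)%E.
Proof. by elim: s => [|mu s IH]; rewrite ?big_nil// big_cons -IH -measure_addE. Qed.

Lemma integral_sum_measure d (T : measurableType d) (s : seq {measure set T -> \bar R})
    (f : T -> \bar R) : measurable_fun setT f -> (forall x, 0 <= f x)%E ->
  (\int[sum_measure s]_x f x = \sum_(mu <- s) \int[mu]_x f x)%E.
Proof.
move=> mf f0; elim: s => [|mu s IH]; first by rewrite big_nil integral_measure_zero.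
by rewrite big_cons -IH -ge0_integral_measure_add.
Qed.

Lemma integral_mrestr d (T : measurableType d) (mu : {measure set T -> \bar R})
    (D : set T) (mD : measurable D) (f : T -> \bar R) :
  measurable_fun setT f -> (forall x, 0 <= f x)%E ->
  (\int[mrestr mu mD]_x f x = \int[mu]_(x in D) f x)%E.
Proof.
move=> mf f0.
rewrite (@ge0_negligible_integral _ _ _ (mrestr mu mD) setT (~` D))//; last 2 first.
  - exact: measurableC.
  - by rewrite /= /mrestr setICl measure0.
rewrite setTD setCK; apply: eq_measure_integral => A mA AD.
by rewrite /= /mrestr setIidl.
Qed.

End Measures.

(** * The Mecke formula *)

Lemma prod_tuple_count {R : comRingType} {J : finType} (x : J -> R) k (s : k.-tuple J) :
  \prod_(l < k) x (tnth s l) = \prod_q x q ^+ count_mem q s.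
Proof.
rewrite -(big_tuple _ _ s xpredT x) /=.
elim: (tval s) => [|a l IH]; first by rewrite big_nil big1.
rewrite big_cons IH /=; under [RHS]eq_bigr do rewrite exprD.
rewrite big_split /=; congr (_ * _).
rewrite [RHS](bigD1 a) //= eqxx big1 ?mulr1//.
by move=> q; rewrite eq_sym => /negbTE ->.
Qed.

(** [B] is a set of finite volume such that the locations in [B] come first in
    the enumeration, as is the case for the cubes. *)
Section Mecke.
Context {R : realType} {d : nat} {lambda : R}.
Context {disp : measure_display} {W : measurableType disp} {P : probability W R}.
Context {X : nat -> {mfun W >-> Rspace R d}}.
Hypothesis pp : poisson_process lambda P X.
Hypothesis lambda0 : 0 <= lambda.
Variables (B : set (Rspace R d)) (mB : measurable B).
Hypothesis B_fin : (lebesgue d B < +oo)%E.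
Hypothesis B_down : forall w i j, (i <= j)%N -> B (X j w) -> B (X i w).

(** The event that [B] contains exactly [m] points, see [count_eventE]; these
    are then the points of index less than [m]. *)
Definition count_event (m : nat) : set W :=
  [set w | (forall i, (i < m)%N -> B (X i w)) /\ ~ B (X m w)].

Lemma measurable_location i (A : set (Rspace R d)) : measurable A ->
  measurable [set w | A (X i w)].
Proof. by move=> mA; rewrite -[X in measurable X]setTI; exact: measurable_funP. Qed.

Lemma measurable_count_event m : measurable (count_event m).
Proof.
rewrite (_ : count_event m =
  (\bigcap_(i in `I_m) [set w | B (X i w)]) `&` ~` [set w | B (X m w)])//.
apply: measurableI; last by apply: measurableC; exact: measurable_location.
by apply: fin_bigcap_measurable => [|i _]; [exact: finite_II|exact: measurable_location].
Qed.

Lemma trivIset_count_event : trivIset setT count_event.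
Proof.
apply/trivIsetP => i j _ _; wlog ij : i j / (i < j)%N.
  move=> H ne; have [ij|ji|ij] := ltngtP i j; [exact: H| |by rewrite ij eqxx in ne].
  by rewrite setIC H// eq_sym.
by move=> _; apply/seteqP; split=> // w [[_ nB] [/(_ _ ij) Bi _]].
Qed.

Lemma npointsE A w : npoints X A w = (\sum_(0 <= k <oo) (\1_A (X k w))%:E)%E.
Proof. by rewrite /npoints counting_dirac; apply: eq_eseriesr => k _. Qed.

Lemma measurable_npoints_eq A (x : \bar R) : measurable A ->
  measurable [set w | npoints X A w = x].
Proof.
move=> mA; have mn : measurable_fun setT (npoints X A).
  rewrite (_ : npoints X A = fun w => \sum_(0 <= k <oo) (\1_A (X k w))%:E)%E; last first.
    by apply/funext => w; rewrite npointsE.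
  apply: ge0_emeasurable_sum => // k _.
  apply/measurable_EFinP; apply: measurableT_comp => //; exact: measurable_indic.
rewrite -[X in measurable X]setTI (_ : [set w | _] = npoints X A @^-1` [set x])//.
exact: mn.
Qed.

Lemma npoints_count_event m w A : A `<=` B -> count_event m w ->
  npoints X A w = (#|[set i : 'I_m | `[<A (X i w)>] ]%SET|)%:R%:E.
Proof.
move=> AB [_ nB]; rewrite npointsE (nneseries_split _ m)// add0n.
rewrite [X in (_ + X)%E](_ : _ = 0%E) ?adde0; last first.
  apply: eseries0 => k mk _; rewrite indicE memNset// => /AB Bk; apply: nB.
  exact: B_down Bk.
rewrite big_mkord sumEFin -sum1_card natr_sum; congr (_%:E).
rewrite [RHS]big_mkcond; apply: eq_bigr => i _; rewrite indicE [i \in _]inE.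
by case: asboolP => [Ai|nA]; [rewrite (mem_set Ai)|rewrite (memNset nA)].
Qed.

Lemma count_eventE m : count_event m = [set w | npoints X B w = m%:R%:E].
Proof.
have nm w k : count_event k w -> npoints X B w = k%:R%:E.
  move=> wm; rewrite (npoints_count_event _ wm)// (_ : [set _ | _]%SET = [set: 'I_k]%SET) ?cardsT ?card_ord//.
  by apply/setP => i; rewrite !inE; apply/asboolP; apply: wm.1.
apply/seteqP; split=> w; first exact: nm.
move=> /= wm; have [ex|nex] := pselect (exists i, ~ B (X i w)).
  have exb : exists i, `[< ~ B (X i w) >] by case: ex => i; exists i; apply/asboolP.
  have [m' /asboolP nB m'min] := ex_minnP exb.
  suff wm' : count_event m' w.
    have := nm _ _ wm'; rewrite wm => -[] /eqP; rewrite eqr_nat => /eqP mm'.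
    by rewrite mm'.
  split=> // i im'; apply: contrapT => /asboolP /m'min; by rewrite leqNgt im'.
move: wm; rewrite /npoints (_ : [set i | _] = setT); last first.
  by apply/seteqP; split=> // i _; apply: contrapT => nBi; apply: nex; exists i.
by rewrite /counting asboolF//; exact: infinite_nat.
Qed.

Let leb := fine (lebesgue d B).
Let leb0 : 0 <= leb. Proof. exact: fine_ge0. Qed.

Lemma P_count_event m : P (count_event m) = (poisson_weight (lambda * leb) m)%:E.
Proof. by rewrite count_eventE (poisson_counts pp). Qed.

(** The Poisson weights sum to 1: this is the factorial moment of order 0. *)
Lemma P_bigcup_count_event : P (\bigcup_m count_event m) = 1%E.
Proof.
rewrite measure_bigcup//; [|by move=> i _; exact: measurable_count_event
  |exact: trivIset_count_event].
rewrite -(eq_eseriesl (P := xpredT)); last by move=> i; rewrite in_setT.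
have := @poisson_factorial_moment _ (lambda * leb) 0 (mulr_ge0 lambda0 leb0).
rewrite expr0 => <-; apply: eq_eseriesr => k _.
by rewrite /= ffactn0 mul1e P_count_event.
Qed.

Lemma P_outside_count_events : P (~` (\bigcup_m count_event m)) = 0%E.
Proof.
have mU : measurable (\bigcup_m count_event m).
  by apply: bigcupT_measurable => m; exact: measurable_count_event.
by rewrite probability_setC// P_bigcup_count_event subee.
Qed.

Definition location_tuple k m (t : k.-tuple 'I_m) (w : W) : k.-tuple (Rspace R d) :=
  [tuple X (tnth t l) w | l < k].

Lemma measurable_location_tuple k m (t : k.-tuple 'I_m) :
  measurable_fun setT (location_tuple t).
Proof.
apply/measurable_fun_tnthP => l.
rewrite (_ : _ \o _ = X (tnth t l)); first exact: measurable_funP.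
by apply/funext => w; rewrite /= tnth_mktuple.
Qed.

Lemma location_tuple_box k m (t : k.-tuple 'I_m) (A : 'I_k -> set (Rspace R d)) w :
  tuple_box A (location_tuple t w) <-> forall l, A l (X (tnth t l) w).
Proof. by split=> h l; have := h l; rewrite tnth_mktuple. Qed.

(** The factorial moment measure: the expected number of [k]-tuples of distinct
    points of [B] in a given set. *)
Definition factorial_measure (k : nat) : {measure set (k.-tuple (Rspace R d)) -> \bar R} :=
  [the {measure set _ -> \bar R} of mseries (fun m =>
    sum_measure [seq image_measure
         [the {measure set _ -> \bar R} of mrestr P (measurable_count_event m)]
         (measurable_location_tuple t)
       | t <- [seq t : k.-tuple 'I_m <- index_enum _ | uniq t]]) 0].

Lemma factorial_measureE k A : factorial_measure k A =
  (\sum_(0 <= m <oo) \sum_(t : k.-tuple 'I_m | uniq t)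
     P (location_tuple t @^-1` A `&` count_event m))%E.
Proof.
rewrite /factorial_measure /= /mseries; apply: eq_eseriesr => m _.
by rewrite sum_measureE big_map big_filter.
Qed.

Lemma integral_factorial_measure k (F : k.-tuple (Rspace R d) -> \bar R) :
  measurable_fun [set: k.-tuple (Rspace R d)] F -> (forall t, 0 <= F t)%E ->
  (\int[factorial_measure k]_t F t =
  \sum_(0 <= m <oo) \sum_(t : k.-tuple 'I_m | uniq t)
     \int[P]_(w in count_event m) F (location_tuple t w))%E.
Proof.
move=> mF F0; rewrite ge0_integral_measure_series//; apply: eq_eseriesr => m _.
rewrite integral_sum_measure// big_map big_filter; apply: eq_bigr => t ut.
rewrite ge0_integral_pushforward//; last exact: measurable_location_tuple.
rewrite preimage_setT integral_mrestr//; last by move=> x; exact: F0.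
by apply: measurableT_comp => //; exact: measurable_location_tuple.
Qed.

(** When each factor of the box is one of the disjoint sets [C q], the number of
    tuples is a product of falling factorials of the numbers of points of the
    [C q] ([count_injections]).  These numbers are independent Poisson variables,
    and the factorial moment of order [r] of a Poisson variable is the [r]-th
    power of its mean. *)
Lemma factorial_measure_disjoint k p (C : 'I_p -> set (Rspace R d)) (s : k.-tuple 'I_p) :
  (forall q, measurable (C q)) -> (forall q, C q `<=` B) -> trivIset setT C ->
  factorial_measure k (tuple_box (fun l => C (tnth s l))) =
  (\prod_(l < k) (lambda%:E * lebesgue d (C (tnth s l))))%E.
Proof.
move=> mC CB tC.
have C_fin q : (lebesgue d (C q) < +oo)%E.
  by apply: le_lt_trans B_fin; apply: le_measure; rewrite ?inE.
pose Ev (q : 'I_p) n := [set w | npoints X (C q) w = n%:R%:E].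
pose h (q : 'I_p) n : R := (n ^_ (count_mem q s))%:R.
have mEv q n : measurable (Ev q n) by exact: measurable_npoints_eq.
pose G w : \bar R := (\prod_(q < p) (\sum_(0 <= n <oo) (h q n)%:E * (\1_(Ev q n) w)%:E))%E.
have G0 w : (0 <= G w)%E.
  by apply: prode_ge0 => q _; apply: nneseries_ge0 => n _ _; rewrite -EFinM lee_fin mulr_ge0.
have mG : measurable_fun setT G.
  rewrite /G; elim: (index_enum _) => [|q l IH].
    by under eq_fun do rewrite big_nil; exact: measurable_cst.
  under eq_fun do rewrite big_cons.
  apply: emeasurable_funM => //; apply: ge0_emeasurable_sum => // n.
    by move=> x _ _; rewrite -EFinM lee_fin mulr_ge0.
  by move=> _; apply: measurable_funeM; apply/measurable_EFinP; exact: measurable_indic.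
transitivity (\int[P]_w G w)%E; last first.
  rewrite expectation_prod//; last first.
    by move=> n; apply: (poisson_indep pp).
  transitivity (\prod_(q < p) ((lambda * fine (lebesgue d (C q))) ^+ count_mem q s)%:E)%E.
    apply: eq_bigr => q _.
    rewrite -(@poisson_factorial_moment R _ (count_mem q s)); last first.
      by rewrite mulr_ge0// fine_ge0.
    by apply: eq_eseriesr => n _; rewrite /Ev (poisson_counts pp).
  rewrite prodEFin -(prod_tuple_count (fun q => lambda * fine (lebesgue d (C q)))) -prodEFin.
  by apply: eq_bigr => l _; rewrite EFinM fineK// ge0_fin_numE.
transitivity (\sum_(0 <= m <oo) \int[P]_(w in count_event m) G w)%E; last first.
  rewrite -ge0_integral_bigcup//; [|exact: measurable_count_event
    |exact: measurable_funTS|exact: trivIset_count_event].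
  rewrite [RHS](@ge0_negligible_integral _ _ _ _ _ (~` (\bigcup_m count_event m)))//.
  - by rewrite setTD setCK.
  - by apply: measurableC; apply: bigcupT_measurable => m; exact: measurable_count_event.
  - exact: P_outside_count_events.
rewrite factorial_measureE; apply: eq_eseriesr => m _.
pose T t := [set w | forall l, C (tnth s l) (X (tnth t l : 'I_m) w)].
have TE (t : k.-tuple 'I_m) : location_tuple t @^-1` tuple_box (fun l => C (tnth s l)) = T t.
  by apply/seteqP; split=> w wT /=; [move/location_tuple_box: wT|apply/location_tuple_box].
have mT (t : k.-tuple 'I_m) : measurable (T t).
  rewrite -TE -[X in measurable X]setTI; apply: measurable_location_tuple => //.
  exact: measurable_tuple_box.
transitivity (\int[P]_(w in count_event m)
    \sum_(t : k.-tuple 'I_m | uniq t) (\1_(T t) w)%:E)%E.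
  under [RHS]eq_integral do rewrite -big_filter.
  rewrite ge0_integral_sum//; last 2 first.
    - exact: measurable_count_event.
    - by move=> t; apply/measurable_EFinP; exact: measurable_indic.
  rewrite big_filter; apply: eq_bigr => t _; rewrite integral_indic ?TE//.
  exact: measurable_count_event.
apply: eq_integral => w; rewrite inE => wm.
pose S q := [set i : 'I_m | `[<C q (X i w)>] ]%SET.
rewrite sumEFin /G.
transitivity (((\prod_q #|S q| ^_ (count_mem q s))%N)%:R%:E : \bar R).
  rewrite -count_injections; last first.
    move=> i q q'; rewrite /S !inE => Cq Cq'.
  by apply: (@tC q q') => //; exists (X i w); split.
  rewrite natr_sum; congr (_%:E); apply: eq_bigr => t _; rewrite indicE; congr (_%:R).
  apply: congr1; apply/idP/forallP => [/set_mem Tw l|Cl].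
    by rewrite /S inE; apply/asboolP; exact: Tw.
  by rewrite inE => l; have := Cl l; rewrite /S inE; case: asboolP.
rewrite natr_prod -prodEFin; apply: eq_bigr => q _.
rewrite (@nneseriesD1 _ _ #|S q|)//; last by move=> n _; rewrite -EFinM lee_fin mulr_ge0.
rewrite eseries0 ?adde0.
  rewrite /h indicE mem_set ?mule1//.
  by rewrite /Ev /= (npoints_count_event (CB q) wm).
move=> n _ /= nS; rewrite indicE memNset ?mule0// /Ev /= (npoints_count_event (CB q) wm).
by move=> [] /eqP; rewrite eqr_nat eq_sym (negbTE nS).
Qed.

Let muB := [the {finite_measure set (Rspace R d) -> \bar R} of
  mfrestr mB B_fin].

(** It suffices to compare the two measures on boxes.  The sides of a box, cut
    by [B], are unions of atoms of the finite algebra which they generate, and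
    these atoms are disjoint; so the box is a finite disjoint union of boxes to
    which [factorial_measure_disjoint] applies. *)
Lemma factorial_measure_unique k A : measurable A ->
  factorial_measure k A =
  mscale (NngNum (exprn_ge0 k lambda0)) (power_measure muB k) A.
Proof.
pose p := #|{set 'I_k}|.
pose nu : {measure set (k.-tuple (Rspace R d)) -> \bar R} :=
  [the {measure set _ -> \bar R} of mscale (NngNum (exprn_ge0 k lambda0)) (power_measure muB k)].
have nu_box (A' : 'I_k -> set (Rspace R d)) : (forall l, measurable (A' l)) ->
    nu (tuple_box A') = (\prod_(l < k) (lambda%:E * lebesgue d (A' l `&` B)))%E.
  move=> mA'; rewrite /nu /= /mscale /= power_measure_box//.
  rewrite big_split /= prodEFin; congr (_%:E * _)%E.
  by rewrite prodr_const card_ord.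
suff box_eq (A' : 'I_k -> set (Rspace R d)) : (forall l, measurable (A' l)) ->
    factorial_measure k (tuple_box A') = nu (tuple_box A').
  move=> mA; apply: (measure_tuple_unique (m1 := factorial_measure k) (m2 := nu)) => //.
  rewrite (_ : setT = tuple_box (fun _ : 'I_k => [set: Rspace R d])); last first.
    by apply/seteqP; split.
  rewrite box_eq// nu_box// setTI.
  under eq_bigr do rewrite -[lebesgue d B]fineK ?ge0_fin_numE// -EFinM.
  by rewrite prodEFin ltry.
move=> mA'.
(* the atoms: q encodes the set of the sides that contain the atom C q *)
pose C (q : 'I_p) := B `&` \bigcap_(l in [set: 'I_k])
   (if l \in (enum_val q : {set 'I_k}) then A' l else ~` A' l).
have mC q : measurable (C q).
  apply: measurableI => //; apply: fin_bigcap_measurable => [|l _]; first exact: finite_finset.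
  by case: ifP => _ //; exact: measurableC.
have CB q : C q `<=` B by move=> x [].
have CE q x : C q x -> enum_val q = [set l | `[<A' l x>] ]%SET.
  move=> [_ xq]; apply/setP => l; have := xq l I.
  by rewrite inE; case: ifPn => _ Al; [rewrite asboolT|rewrite asboolF].
have tC : trivIset setT C.
  by move=> q q' _ _ [x [/CE Cq /CE]]; rewrite -Cq => /enum_val_inj.
pose D := [set s : k.-tuple 'I_p | forall l, l \in (enum_val (tnth s l) : {set 'I_k})].
have boxE : tuple_box (fun l => A' l `&` B) =
    \bigcup_(s in D) tuple_box (fun l => C (tnth s l)).
  apply/seteqP; split=> t.
    move=> tA; pose a l := [set l' | `[<A' l' (tnth t l)>] ]%SET.
    exists [tuple enum_rank (a l) | l < k].
      move=> l; rewrite tnth_mktuple enum_rankK /a inE; apply/asboolP.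
      exact: (tA l).1.
    move=> l; rewrite tnth_mktuple; split; first exact: (tA l).2.
    move=> l' _; rewrite enum_rankK /a inE; by case: asboolP.
  move=> [s sD tC'] l; split; last exact: (CB _ _ (tC' l)).
  have := (tC' l).2 l I; by rewrite sD.
have tD : trivIset D (fun s : k.-tuple 'I_p => tuple_box (fun l => C (tnth s l))).
  move=> s s' _ _ [t [ts ts']]; apply: eq_from_tnth => l.
  by apply: (tC (tnth s l) (tnth s' l)) => //; exists (tnth t l); split; [exact: ts|exact: ts'].
have dec (m : {measure set (k.-tuple (Rspace R d)) -> \bar R}) :
    m (tuple_box (fun l => A' l `&` B)) =
    (\sum_(s \in D) m (tuple_box (fun l => C (tnth s l))))%E.
  rewrite boxE measure_fin_bigcup//; first exact: finite_finset.
  by move=> s _; exact: measurable_tuple_box.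
transitivity (factorial_measure k (tuple_box (fun l => A' l `&` B))).
  rewrite !factorial_measureE; apply: eq_eseriesr => m _; apply: eq_bigr => t _.
  congr (P _); apply/seteqP; split=> w [wA wm]; split=> //.
    apply/location_tuple_box => l; move/location_tuple_box: wA => /(_ l) wA.
    by split=> //; apply: wm.1.
  apply/location_tuple_box => l; move/location_tuple_box: wA => /(_ l) wA.
  exact: wA.1.
transitivity (nu (tuple_box (fun l => A' l `&` B))); last first.
  rewrite !nu_box//; last by move=> l; exact: measurableI.
  by apply: eq_bigr => l _; rewrite -setIA setIid.
rewrite !dec; apply: eq_fsbigr => s _.
rewrite factorial_measure_disjoint// nu_box//.
by apply: eq_bigr => l _; rewrite (setIidl (CB _)).
Qed.

(** The multivariate Mecke formula (for functions that do not depend on the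
    process): the tuples of distinct points of [B] have intensity
    [lambda ^+ k] with respect to the power of Lebesgue measure on [B]. *)
Lemma mecke k (F : k.-tuple (Rspace R d) -> \bar R) :
  measurable_fun [set: k.-tuple (Rspace R d)] F -> (forall t, 0 <= F t)%E ->
  (\sum_(0 <= m <oo) \sum_(t : k.-tuple 'I_m | uniq t)
     \int[P]_(w in count_event m) F (location_tuple t w) =
   (lambda ^+ k)%:E * \int[power_measure muB k]_t F t)%E.
Proof.
move=> mF F0; rewrite -integral_factorial_measure//.
transitivity (\int[mscale (NngNum (exprn_ge0 k lambda0)) (power_measure muB k)]_t F t)%E;
  last by rewrite ge0_integral_mscale.
by apply: eq_measure_integral => A mA _; rewrite factorial_measure_unique.
Qed.

End Mecke.

Arguments count_event {R d disp W} X B m.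
Arguments location_tuple {R d disp W} X {k m} t w.

(** * Integrals along geodesic paths *)

(** The integral of a nonnegative function, measurable or not, is a supremum over
    the simple functions below it. *)
Lemma le_integral_ge0 {R : realType} d (T : measurableType d)
    (mu : {measure set T -> \bar R}) (D : set T) (f1 f2 : T -> \bar R) :
  (forall x, 0 <= f1 x)%E -> (forall x, f1 x <= f2 x)%E ->
  (\int[mu]_(x in D) f1 x <= \int[mu]_(x in D) f2 x)%E.
Proof.
move=> f10 f12; have f20 x : (0 <= f2 x)%E by apply: le_trans (f12 x).
rewrite !(integral_mkcond D).
have le_patch x : ((f1 \_ D) x <= (f2 \_ D) x)%E by rewrite /patch; case: ifP.
rewrite !ge0_integralTE; [|by move=> x; apply: erestrict_ge0..].
apply: le_ereal_sup => _ [h hf <-]; exists h => // x.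
exact: le_trans (hf x) (le_patch x).
Qed.

Section PathIntegral.
Context {R : realType} d (T : measurableType d).
Variable mu : {finite_measure set T -> \bar R}.
Variable h : T -> T -> R.
Hypothesis mh : measurable_fun setT (fun p : T * T => h p.1 p.2).
Hypothesis h_rng : forall x y, 0 <= h x y <= 1.

Let h_ge0 x y : 0 <= h x y. Proof. by case/andP: (h_rng x y). Qed.
Let h_le1 x y : 0 <= 1 - h x y. Proof. by case/andP: (h_rng x y); rewrite subr_ge0. Qed.

Lemma measurable_bivariate d' (U : measurableType d') (f g : U -> T) :
  measurable_fun setT f -> measurable_fun setT g ->
  measurable_fun setT (fun u => h (f u) (g u)).
Proof.
move=> mf mg.
exact: (measurableT_comp (f := fun p : T * T => h p.1 p.2) (g := fun u => (f u, g u)) mh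
  (measurable_fun_pair mf mg)).
Qed.

Lemma geodesic_weight_ge0 x p : 0 <= geodesic_weight h x p.
Proof.
apply: prodr_ge0 => -[[y z] b] _.
by rewrite /bern; case: b; [exact: h_ge0|exact: h_le1].
Qed.

Lemma geodesic_weight_step x y1 y2 y3 p :
  geodesic_weight h x [:: y1, y2, y3 & p] =
  h x y1 * h y1 y2 * h y2 y3 * (1 - h x y3) * geodesic_weight h y3 p.
Proof. by rewrite /geodesic_weight /= !big_cons /= !mulrA. Qed.

Lemma measurable_geodesic_weight k :
  measurable_fun [set: k.+1.-tuple T] (fun t => geodesic_weight h (thead t) (behead t)).
Proof.
pose tl n (t : n.+1.-tuple T) : n.-tuple T := [tuple of behead t].
have mtl n : measurable_fun setT (@tl n) by exact: measurable_behead.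
pose i1 n : 'I_n.+2 := lift ord0 ord0.
pose i2 n : 'I_n.+3 := lift ord0 (i1 n).
pose i3 n : 'I_n.+4 := lift ord0 (i2 n).
have [n] := ubnP k; elim: n k => // n IH [|[|[|k]]] kn.
- rewrite (_ : (fun _ => _) = cst 1)//; apply/funext => t.
  by case/tupleP: t => x t; rewrite tuple0 /geodesic_weight big_nil.
- rewrite (_ : (fun _ => _) = fun t : 2.-tuple T => h (tnth t ord0) (tnth t (i1 _))).
    by apply: measurable_bivariate; exact: measurable_tnth.
  apply/funext; do 2 case/tupleP => ?; move=> t; rewrite tuple0.
  by rewrite /geodesic_weight /i1 !tnthS !tnth0 theadE /= big_cons big_nil mulr1.
- rewrite (_ : (fun _ => _) = fun t : 3.-tuple T => h (tnth t ord0) (tnth t (i1 _)) * h (tnth t (i1 _)) (tnth t (i2 _))).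
    by apply: measurable_funM; apply: measurable_bivariate; exact: measurable_tnth.
  apply/funext; do 3 case/tupleP => ?; move=> t; rewrite tuple0.
  by rewrite /geodesic_weight /i2 /i1 !tnthS !tnth0 theadE /= !big_cons big_nil mulr1.
- pose G3 (t : k.+4.-tuple T) := geodesic_weight h (thead (tl _ (tl _ (tl _ t)))) (behead (tl _ (tl _ (tl _ t)))).
  rewrite (_ : (fun _ => _) = fun t : k.+4.-tuple T =>
    h (tnth t ord0) (tnth t (i1 _)) * h (tnth t (i1 _)) (tnth t (i2 _)) * h (tnth t (i2 _)) (tnth t (i3 _)) *
    (1 - h (tnth t ord0) (tnth t (i3 _))) * G3 t).
    have mk (i j : 'I_k.+4) : measurable_fun setT (fun t : k.+4.-tuple T => h (tnth t i) (tnth t j)).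
      by apply: measurable_bivariate; exact: measurable_tnth.
    apply: measurable_funM.
      apply: measurable_funM; last by apply: measurable_funB => //; exact: mk.
      exact: (measurable_funM (measurable_funM (mk _ _) (mk _ _)) (mk _ _)).
    apply: (measurableT_comp (f := fun t : k.+1.-tuple T => geodesic_weight h (thead t) (behead t))).
      by apply: IH; lia.
    exact: (measurableT_comp (mtl _) (measurableT_comp (mtl _) (mtl _))).
  apply/funext; do 4 case/tupleP => ?; move=> t.
  rewrite /G3 /tl theadE /= geodesic_weight_step /i3 /i2 /i1 !tnthS !tnth0.
  by congr (_ * geodesic_weight h _ _).
Qed.

Lemma measurable_geodesic_weight_cons k x :
  measurable_fun [set: k.-tuple T] (fun t => geodesic_weight h x t).
Proof.
rewrite (_ : (fun _ => _) = (fun t : k.+1.-tuple T => geodesic_weight h (thead t) (behead t)) \o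
  (fun t : k.-tuple T => [tuple of x :: t])); last by apply/funext => t /=; rewrite theadE.
apply: measurableT_comp; first exact: measurable_geodesic_weight.
exact: measurable_cons.
Qed.

Variables G beta : R.
Hypothesis G0 : 0 <= G.
Hypothesis beta0 : 0 <= beta.
Hypothesis degree_bound : forall x, (\int[mu]_y (h x y)%:E <= G%:E)%E.
Hypothesis block_bound : forall x,
  (\int[mu]_y1 \int[mu]_y2 \int[mu]_y3
    (h x y1 * h y1 y2 * h y2 y3 * (1 - h x y3))%:E <= beta%:E)%E.

Let J k x : \bar R := (\int[power_measure mu k]_t (geodesic_weight h x t)%:E)%E.

Let J_ge0 k x : (0 <= J k x)%E.
Proof. by apply: integral_ge0 => t _; rewrite lee_fin geodesic_weight_ge0. Qed.

(** The last [k %% 3] steps of a path from [x] contribute a factor [G] each, and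
    each block of three steps contributes [beta], uniformly in its starting
    point; so the integral is peeled off by blocks from the start, with the
    remaining path starting at the end point of the block. *)
Lemma path_integral_from k x :
  (J k x <= (beta ^+ (k %/ 3) * G ^+ (k %% 3))%:E)%E.
Proof.
have cons_int n (F : n.+1.-tuple T -> R) : measurable_fun setT F -> (forall t, 0 <= F t) ->
  (\int[power_measure mu n.+1]_t (F t)%:E =
   \int[mu]_y \int[power_measure mu n]_t (F [tuple of y :: t])%:E)%E.
  move=> mF F0; rewrite integral_cons_measure//.
  exact/measurable_EFinP.
have J0 y : J 0 y = 1%E.
  rewrite /J (eq_integral (cst 1%E)); last first.
    by move=> t _; rewrite tuple0 /geodesic_weight big_nil.
  by rewrite integral_cst//= diracT mule1.
have [n] := ubnP k; elim: n k x => // n IH [|[|[|k]]] x kn.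
- by rewrite J0 !expr0 mulr1.
- rewrite /J cons_int; [|exact: measurable_geodesic_weight_cons
    |by move=> t; exact: geodesic_weight_ge0].
  rewrite divn_small// modn_small// expr0 mul1r expr1.
  apply: le_trans (degree_bound x); apply: le_integral_ge0 => y.
    by apply: integral_ge0 => t _; rewrite lee_fin geodesic_weight_ge0.
  rewrite (eq_integral (cst (h x y)%:E)); last first.
    by move=> t _; rewrite tuple0 /geodesic_weight /= big_cons big_nil mulr1.
  by rewrite integral_cst//= diracT mule1.
- rewrite /J cons_int; [|exact: measurable_geodesic_weight_cons
    |by move=> t; exact: geodesic_weight_ge0].
  rewrite divn_small// modn_small// expr0 mul1r expr2 EFinM.
  apply: (@le_trans _ _ (\int[mu]_y (G%:E * (h x y)%:E))%E); last first.
    rewrite ge0_integralZl ?lee_fin//; last 2 first.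
      - by apply/measurable_EFinP; exact: measurable_bivariate.
      - by move=> y _; rewrite lee_fin.
    by apply: lee_wpmul2l; rewrite ?lee_fin.
  apply: le_integral_ge0 => y.
    by apply: integral_ge0 => t _; rewrite lee_fin geodesic_weight_ge0.
  rewrite (eq_integral (fun t : 1.-tuple T => (h x y)%:E * (geodesic_weight h y t)%:E))%E; last first.
    move=> t _; case/tupleP: t => z t; rewrite tuple0 -EFinM.
    by rewrite /geodesic_weight /= !big_cons big_nil !mulr1.
  rewrite ge0_integralZl ?lee_fin//; last 2 first.
    - by apply/measurable_EFinP; exact: measurable_geodesic_weight_cons.
    - by move=> t _; rewrite lee_fin geodesic_weight_ge0.
  rewrite muleC; apply: lee_wpmul2r; first by rewrite lee_fin.
  have := IH 1%N y; rewrite divn_small// modn_small// expr0 mul1r expr1; apply.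
  by lia.
- have -> : (k.+3 %/ 3 = (k %/ 3).+1)%N by rewrite -addn3 divnDr// divnn addn1.
  have -> : (k.+3 %% 3 = k %% 3)%N by rewrite -addn3 modnDr.
  set c := beta ^+ _ * _; have c0 : 0 <= beta ^+ (k %/ 3) * G ^+ (k %% 3).
    by rewrite mulr_ge0 ?exprn_ge0.
  rewrite {}/c exprS -mulrA mulrC EFinM.
  apply: (@le_trans _ _ ((beta ^+ (k %/ 3) * G ^+ (k %% 3))%:E * (\int[mu]_y1 \int[mu]_y2 \int[mu]_y3
    (h x y1 * h y1 y2 * h y2 y3 * (1 - h x y3))%:E))%E); last first.
    by apply: lee_wpmul2l; rewrite ?lee_fin.
  pose A (p : (T * T) * T) : \bar R :=
    (h x p.1.1 * h p.1.1 p.1.2 * h p.1.2 p.2 * (1 - h x p.2))%:E.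
  have A0 p : (0 <= A p)%E by rewrite lee_fin !mulr_ge0.
  have mA : measurable_fun setT A.
    apply/measurable_EFinP; apply: measurable_funM; last first.
      by apply: measurable_funB => //; exact: measurable_bivariate.
    have m11 : measurable_fun setT (fun p : (T * T) * T => p.1.1) by exact: measurableT_comp.
    have m12 : measurable_fun setT (fun p : (T * T) * T => p.1.2) by exact: measurableT_comp.
    by apply: measurable_funM; [apply: measurable_funM|]; exact: measurable_bivariate.
  pose A2 (p : T * T) := (\int[mu]_y3 A (p, y3))%E.
  have mA2 : measurable_fun setT A2 by exact: (measurable_fun_fubini_tonelli_F (m2 := mu) A mA A0).
  have A20 p : (0 <= A2 p)%E by apply: integral_ge0 => y _; exact: A0.
  have mA1 : measurable_fun setT (fun y1 => \int[mu]_y2 A2 (y1, y2))%E.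
    exact: (measurable_fun_fubini_tonelli_F (m2 := mu) A2 mA2 A20).
  set c := (beta ^+ _ * _)%R in c0 *.
  rewrite -ge0_integralZl ?lee_fin//; last by move=> y1 _; apply: integral_ge0 => y2 _; exact: (A20 (y1, y2)).
  rewrite /J cons_int; [|exact: measurable_geodesic_weight_cons
    |by move=> t; exact: geodesic_weight_ge0].
  apply: le_integral_ge0 => y1.
    by apply: integral_ge0 => t _; rewrite lee_fin geodesic_weight_ge0.
  rewrite -ge0_integralZl ?lee_fin//; last 2 first.
    - exact: (measurableT_comp mA2 (pair1_measurable y1)).
    - by move=> y2 _; exact: (A20 (y1, y2)).
  have mgw1 : measurable_fun setT (fun t : k.+2.-tuple T => geodesic_weight h x (y1 :: t)).
    exact: (measurableT_comp (@measurable_geodesic_weight_cons k.+3 x)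
      (measurable_cons (measurable_cst y1) (@measurable_id _ _ setT))).
  rewrite cons_int//; last by move=> t; exact: geodesic_weight_ge0.
  apply: le_integral_ge0 => y2.
    by apply: integral_ge0 => t _; rewrite lee_fin geodesic_weight_ge0.
  rewrite -ge0_integralZl ?lee_fin//; last 2 first.
    - exact: (measurableT_comp mA (pair1_measurable (y1, y2))).
    - by move=> y3 _; exact: (A0 ((y1, y2), y3)).
  have mgw2 : measurable_fun setT (fun t : k.+1.-tuple T => geodesic_weight h x [:: y1, y2 & t]).
    exact: (measurableT_comp mgw1 (measurable_cons (measurable_cst y2) (@measurable_id _ _ setT))).
  rewrite cons_int//; last by move=> t; exact: geodesic_weight_ge0.
  apply: le_integral_ge0 => y3.
    by apply: integral_ge0 => t _; rewrite lee_fin geodesic_weight_ge0.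
  rewrite (eq_integral (fun t : k.-tuple T => A ((y1, y2), y3) * (geodesic_weight h y3 t)%:E))%E; last first.
    by move=> t _; rewrite /= geodesic_weight_step EFinM.
  rewrite ge0_integralZl//; last 2 first.
    - by apply/measurable_EFinP; exact: measurable_geodesic_weight_cons.
    - by move=> t _; rewrite lee_fin geodesic_weight_ge0.
  by rewrite muleC; apply: lee_wpmul2r => //; apply: IH; lia.
Qed.

Lemma path_integral_bound k :
  (\int[power_measure mu k.+1]_t (geodesic_weight h (thead t) (behead t))%:E
   <= mu setT * (beta ^+ (k %/ 3) * G ^+ (k %% 3))%:E)%E.
Proof.
rewrite integral_cons_measure//; last 2 first.
  - by apply/measurable_EFinP; exact: measurable_geodesic_weight.
  - by move=> t /=; rewrite lee_fin geodesic_weight_ge0.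
rewrite muleC -integral_cst//; apply: le_integral_ge0 => x.
  by apply: integral_ge0 => t _; rewrite lee_fin geodesic_weight_ge0.
exact: path_integral_from.
Qed.

End PathIntegral.

(** * Translation invariance of Lebesgue measure *)

Section Translation.
Context {R : realType}.

Lemma lebesgue_measure_translation (a : R) (A : set (measurableTypeR R)) : measurable A ->
  pushforward (@lebesgue_measure R) (fun x : measurableTypeR R => (x + a : measurableTypeR R)) A
  = lebesgue_measure A.
Proof.
move=> mA; have ma : measurable_fun setT (fun x : measurableTypeR R => (x + a : measurableTypeR R)).
  exact: measurable_funD.
apply/esym.
apply: (lebesgue_measure_unique (mu := measure_function_pushforward__canonical__measure_function_Measure
  (@lebesgue_measure R) ma)) => // _ [[p q]] _ <-.
rewrite /= /pushforward.
rewrite (_ : _ @^-1` _ = `]p - a, q - a]%classic); last first.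
  by apply/seteqP; split=> x /=; rewrite !in_itv/= ltrBlDr lerBrDr.
rewrite !lebesgue_measure_itv/= !lte_fin ltrD2r; case: ifP => // _.
by rewrite -!EFinB; congr (_%:E); ring.
Qed.

Lemma integral_translation1 (a : R) (F : measurableTypeR R -> \bar R) :
  measurable_fun setT F -> (forall x, 0 <= F x)%E ->
  (\int[lebesgue_measure]_x F (x + a)%R = \int[lebesgue_measure]_x F x)%E.
Proof.
move=> mF F0.
have ma : measurable_fun setT (fun x : measurableTypeR R => (x + a : measurableTypeR R)).
  exact: measurable_funD.
rewrite -[LHS](ge0_integral_pushforward ma lebesgue_measure (D := setT))//.
by apply: eq_measure_integral => A mA _; exact: lebesgue_measure_translation.
Qed.

Lemma integral_lebesgueS d (F : Rspace R d.+1 -> \bar R) :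
  measurable_fun setT F -> (forall t, 0 <= F t)%E ->
  (\int[lebesgue d.+1]_t F t =
   \int[lebesgue_measure]_x \int[lebesgue d]_t F [tuple of x :: t])%E.
Proof.
move=> mF F0.
transitivity (\int[@lebesgue_measure R \x lebesgue d]_p (F \o @cons_pair R d) p)%E.
  exact: (ge0_integral_pushforward (@measurable_cons_pair R d) (@lebesgue_measure R \x lebesgue d)%E).
rewrite (fubini_tonelli1 (m1 := @lebesgue_measure R) (m2 := lebesgue d))//.
  by apply: measurableT_comp => //; exact: measurable_cons_pair.
by move=> p /=; exact: F0.
Qed.

Definition translate {d} (a x : Rspace R d) : Rspace R d :=
  [tuple (tnth x k + tnth a k : R) | k < d].

Lemma measurable_translate d (a : Rspace R d) : measurable_fun setT (translate a).
Proof.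
apply/measurable_fun_tnthP => i.
rewrite (_ : _ \o _ = fun x : Rspace R d => (tnth x i + tnth a i : R)); last first.
  by apply/funext => x /=; rewrite tnth_mktuple.
by apply: measurable_funD => //; exact: measurable_tnth.
Qed.

Lemma integral_translation d (a : Rspace R d) (F : Rspace R d -> \bar R) :
  measurable_fun setT F -> (forall x, 0 <= F x)%E ->
  (\int[lebesgue d]_x F (translate a x) = \int[lebesgue d]_x F x)%E.
Proof.
elim: d a F => [|d IH] a F mF F0.
  by apply: eq_integral => x _; rewrite (tuple0 (translate a x)) (tuple0 x).
have mFa : measurable_fun setT (fun x => F (translate a x)).
  by apply: measurableT_comp => //; exact: measurable_translate.
rewrite !integral_lebesgueS//; case/tupleP: a mFa => a0 a mFa.
have mFc x : measurable_fun setT (fun t : Rspace R d => F [tuple of x :: t]).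
  by apply: (measurableT_comp mF); apply: measurable_cons.
rewrite -[RHS](integral_translation1 a0); last 2 first.
- apply: (measurable_fun_fubini_tonelli_F (m2 := lebesgue d) (fun p => F (cons_pair p))).
    by apply: measurableT_comp => //; exact: measurable_cons_pair.
  by move=> p; exact: F0.
- by move=> x; apply: integral_ge0.
apply: eq_integral => x _.
rewrite -[RHS](IH a)//; apply: eq_integral => t _; congr F.
apply: eq_from_tnth => i; rewrite !tnth_mktuple.
by case: (unliftP ord0 i) => [j ->|->]; rewrite ?tnthS ?tnth0// tnth_mktuple.
Qed.

Lemma edist_translate d (a x y : Rspace R d) : Defs.edist (translate a x) (translate a y) = Defs.edist x y.
Proof.
rewrite /Defs.edist; congr Num.sqrt; apply: eq_bigr => k _; rewrite !tnth_mktuple.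
by congr (_ ^+ 2); ring.
Qed.

Lemma edistC d (x y : Rspace R d) : Defs.edist x y = Defs.edist y x.
Proof.
by rewrite /Defs.edist; congr Num.sqrt; apply: eq_bigr => k _; rewrite -sqrrN opprB.
Qed.

Definition origin d : Rspace R d := [tuple 0 | _ < d].

Lemma translate_origin d (a : Rspace R d) : translate a (origin d) = a.
Proof. by apply: eq_from_tnth => i; rewrite !tnth_mktuple add0r. Qed.

Lemma edist_origin d (x : Rspace R d) : Defs.edist x (origin d) = enorm x.
Proof.
by rewrite /Defs.edist /enorm; congr Num.sqrt; apply: eq_bigr => k _; rewrite tnth_mktuple subr0.
Qed.

Lemma measurable_edist d :
  measurable_fun setT (fun p : Rspace R d * Rspace R d => Defs.edist p.1 p.2).
Proof.
have ms : measurable_fun setT (fun p : Rspace R d * Rspace R d =>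
    \sum_(k < d) ((tnth p.1 k : R) - tnth p.2 k) ^+ 2).
  apply: measurable_sum => k; apply: measurable_funX; apply: measurable_funB.
    exact: (measurableT_comp (measurable_tnth k) measurable_fst).
  exact: (measurableT_comp (measurable_tnth k) measurable_snd).
exact: (measurableT_comp (continuous_measurable_fun (@sqrt_continuous R)) ms).
Qed.

Lemma measurable_enorm d : measurable_fun setT (fun x : Rspace R d => enorm x).
Proof.
have ms : measurable_fun setT (fun x : Rspace R d => \sum_(k < d) (tnth x k : R) ^+ 2).
  by apply: measurable_sum => k; apply: measurable_funX; exact: measurable_tnth.
exact: (measurableT_comp (continuous_measurable_fun (@sqrt_continuous R)) ms).
Qed.

End Translation.

(** * The mass of a block *)

Lemma integral_mrestr_le {R : realType} d (T : measurableType d)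
    (mu : {measure set T -> \bar R}) (D : set T) (mD : measurable D) (f : T -> \bar R) :
  measurable_fun setT f -> (forall x, 0 <= f x)%E ->
  (\int[mrestr mu mD]_x f x <= \int[mu]_x f x)%E.
Proof.
by move=> mf f0; rewrite integral_mrestr//; apply: ge0_subset_integral.
Qed.

Section Block.
Context {R : realType} {d : nat}.
Variable g : R -> R.
Hypothesis mg : measurable_fun setT g.
Hypothesis g_rng : forall r, 0 <= g r <= 1.
Variable G : R.
Hypothesis GE : (\int[lebesgue d]_x (g (enorm x))%:E = G%:E)%E.
Hypothesis G_gt0 : 0 < G.

Local Notation T := (Rspace R d).
Local Notation leb := (lebesgue d).

(** Being a function of the distance, [h] is symmetric and invariant under
    translations, so that all the integrals below do not depend on the base
    point. *)
Definition dist_kernel (x y : T) : R := g (Defs.edist x y).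
Local Notation h := dist_kernel.

Lemma measurable_dist_kernel : measurable_fun setT (fun p : T * T => h p.1 p.2).
Proof. exact: (measurableT_comp mg (@measurable_edist R d)). Qed.
Let mh := measurable_dist_kernel.

Lemma dist_kernel_rng x y : 0 <= h x y <= 1.
Proof. exact: g_rng. Qed.

Let h0 x y : 0 <= h x y. Proof. by case/andP: (dist_kernel_rng x y). Qed.
Let h1 x y : 0 <= 1 - h x y. Proof. by case/andP: (dist_kernel_rng x y); rewrite subr_ge0. Qed.

Lemma dist_kernelC x y : h x y = h y x.
Proof. by rewrite /h edistC. Qed.

Lemma dist_kernel_translate a x y : h (translate a x) (translate a y) = h x y.
Proof. by rewrite /h edist_translate. Qed.

Let mhl x : measurable_fun setT (fun y => (h x y)%:E).
Proof. by apply/measurable_EFinP; exact: (measurable_bivariate mh). Qed.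

Lemma integral_dist_kernel x : (\int[leb]_y (h x y)%:E = G%:E)%E.
Proof.
rewrite -GE -(integral_translation x) ?mhl//; last by move=> y; rewrite lee_fin.
apply: eq_integral => y _.
by rewrite -{1}(translate_origin x) dist_kernel_translate dist_kernelC /h edist_origin.
Qed.

(** The convolution of [g] with itself: the weight of the paths of two steps
    from [x] to [y]. *)
Let K x y : \bar R := (\int[leb]_z (h x z * h z y)%:E)%E.

Let K0 x y : (0 <= K x y)%E.
Proof. by apply: integral_ge0 => z _; rewrite lee_fin mulr_ge0. Qed.

Let mhh : measurable_fun setT (fun p : (T * T) * T => (h p.1.1 p.2 * h p.2 p.1.2)%:E).
Proof.
have m11 : measurable_fun setT (fun p : (T * T) * T => p.1.1) by exact: measurableT_comp.
have m12 : measurable_fun setT (fun p : (T * T) * T => p.1.2) by exact: measurableT_comp.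
by apply/measurable_EFinP; apply: measurable_funM; exact: (measurable_bivariate mh).
Qed.

Let mK : measurable_fun setT (fun p : T * T => K p.1 p.2).
Proof.
pose F (p : (T * T) * T) : \bar R := (h p.1.1 p.2 * h p.2 p.1.2)%:E.
have F0 p : (0 <= F p)%E by rewrite lee_fin mulr_ge0.
exact: (measurable_fun_fubini_tonelli_F (m2 := leb) F mhh F0).
Qed.

Let mKl x : measurable_fun setT (K x).
Proof. exact: (measurableT_comp mK (pair1_measurable x)). Qed.

Let KC x y : K x y = K y x.
Proof.
apply: eq_integral => z _.
by rewrite (dist_kernelC x) [h z y]dist_kernelC mulrC.
Qed.

Let K_translate a x y : K (translate a x) (translate a y) = K x y.
Proof.
rewrite /K -(integral_translation a).
- by apply: eq_integral => z _; rewrite !dist_kernel_translate.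
- apply/measurable_EFinP; apply: measurable_funM; exact: (measurable_bivariate mh).
- by move=> z; rewrite lee_fin mulr_ge0.
Qed.

(** The weight of the 4-cycles through a point, two opposite vertices of which
    are joined by two paths of two steps. *)
Let delta : \bar R := (\int[leb]_y (K (origin d) y * K (origin d) y))%E.

Let integral_KK x : (\int[leb]_y (K x y * K x y) = delta)%E.
Proof.
rewrite -(integral_translation x); last 2 first.
- exact: emeasurable_funM.
- by move=> y; rewrite mule_ge0.
by apply: eq_integral => y _; rewrite -{1 3}(translate_origin x) !K_translate.
Qed.

Let measurable_hhh x : measurable_fun setT (fun p : (T * T) * T =>
   h x p.1.1 * h p.1.1 p.1.2 * h p.1.2 p.2).
Proof.
have m11 : measurable_fun setT (fun p : (T * T) * T => p.1.1) by exact: measurableT_comp.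
have m12 : measurable_fun setT (fun p : (T * T) * T => p.1.2) by exact: measurableT_comp.
by apply: measurable_funM; [apply: measurable_funM|]; exact: (measurable_bivariate mh).
Qed.

Let mx2 x : measurable_fun setT (fun p : (T * T) * T => h x p.2).
Proof. exact: (measurable_bivariate mh). Qed.

Let triple (A : (T * T) * T -> R) : \bar R :=
  (\int[leb]_y1 \int[leb]_y2 \int[leb]_y3 (A ((y1, y2), y3))%:E)%E.

Let triple_measurable (A : (T * T) * T -> R) : measurable_fun setT A -> (forall p, 0 <= A p) ->
  [/\ measurable_fun setT (fun p => \int[leb]_y3 (A (p, y3))%:E)%E,
      forall y1, measurable_fun setT (fun y2 => \int[leb]_y3 (A ((y1, y2), y3))%:E)%E &
      measurable_fun setT (fun y1 => \int[leb]_y2 \int[leb]_y3 (A ((y1, y2), y3))%:E)%E].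
Proof.
move=> mA A0; have mEA : measurable_fun setT (EFin \o A) by exact/measurable_EFinP.
have m2 : measurable_fun setT (fun p => \int[leb]_y3 (A (p, y3))%:E)%E.
  by apply: (measurable_fun_fubini_tonelli_F (m2 := leb) _ mEA) => p; rewrite lee_fin.
split=> //; first by move=> y1; exact: (measurableT_comp m2 (pair1_measurable y1)).
apply: (measurable_fun_fubini_tonelli_F (m2 := leb) _ m2) => p.
by apply: integral_ge0 => y _; rewrite lee_fin.
Qed.

Let tripleD (A1 A2 : (T * T) * T -> R) : measurable_fun setT A1 -> measurable_fun setT A2 ->
  (forall p, 0 <= A1 p) -> (forall p, 0 <= A2 p) ->
  triple (fun p => A1 p + A2 p) = (triple A1 + triple A2)%E.
Proof.
move=> mA1 mA2 A10 A20.
have [m11 m12 m13] := triple_measurable mA1 A10.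
have [m21 m22 m23] := triple_measurable mA2 A20.
have int0 (A : (T * T) * T -> R) (p : T * T) : (forall p, 0 <= A p) -> (0 <= \int[leb]_y3 (A (p, y3))%:E)%E.
  by move=> A0; apply: integral_ge0 => y _; rewrite lee_fin.
rewrite /triple -ge0_integralD//; last 2 first.
- by move=> y1 _; apply: integral_ge0 => y2 _; exact: int0.
- by move=> y1 _; apply: integral_ge0 => y2 _; exact: int0.
apply: eq_integral => y1 _; rewrite -ge0_integralD//; last 2 first.
- by move=> y2 _; exact: int0.
- by move=> y2 _; exact: int0.
apply: eq_integral => y2 _; rewrite -ge0_integralD//.
- by move=> y3 _; rewrite lee_fin.
- by apply/measurable_EFinP; exact: (measurableT_comp mA1 (pair1_measurable (y1, y2))).
- by move=> y3 _; rewrite lee_fin.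
- by apply/measurable_EFinP; exact: (measurableT_comp mA2 (pair1_measurable (y1, y2))).
Qed.

Let triple_hhh x : triple (fun p => h x p.1.1 * h p.1.1 p.1.2 * h p.1.2 p.2) = (G ^+ 3)%:E.
Proof.
have intZ c (y : T) : 0 <= c -> (\int[leb]_z (c * h y z)%:E = (c * G)%:E)%E.
  move=> c0; under eq_integral do rewrite EFinM.
  rewrite ge0_integralZl ?lee_fin ?integral_dist_kernel//.
  by move=> z _; rewrite lee_fin.
rewrite /triple (eq_integral (fun y1 => ((G ^+ 2) * h x y1)%:E)); last first.
  move=> y1 _; rewrite (eq_integral (fun y2 => (h x y1 * G * h y1 y2)%:E)); last first.
    move=> y2 _ /=; rewrite intZ ?mulr_ge0//; congr (_%:E); ring.
  by rewrite intZ ?mulr_ge0 ?(ltW G_gt0)//; congr (_%:E); ring.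
by rewrite intZ ?exprn_ge0 ?(ltW G_gt0)//; congr (_%:E); ring.
Qed.

Let triple_hhhh x :
  triple (fun p => h x p.1.1 * h p.1.1 p.1.2 * h p.1.2 p.2 * h x p.2) = delta.
Proof.
rewrite -(integral_KK x) /triple.
transitivity (\int[leb]_y1 \int[leb]_y2 ((h x y1 * h y1 y2)%:E * K x y2))%E.
  apply: eq_integral => y1 _; apply: eq_integral => y2 _ /=.
  rewrite (eq_integral (fun y3 => (h x y1 * h y1 y2)%:E * (h y2 y3 * h y3 x)%:E)%E); last first.
    by move=> y3 _; rewrite -EFinM (dist_kernelC y3) !mulrA.
  rewrite ge0_integralZl//; [by rewrite -/(K y2 x) KC| | |by rewrite lee_fin mulr_ge0].
    by apply/measurable_EFinP; apply: measurable_funM; exact: (measurable_bivariate mh).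
  by move=> y3 _; rewrite lee_fin mulr_ge0.
have mF : measurable_fun setT (fun p : T * T => ((h x p.1 * h p.1 p.2)%:E * K x p.2)%E).
  apply: emeasurable_funM; last exact: (measurableT_comp (mKl x)).
  by apply/measurable_EFinP; apply: measurable_funM; exact: (measurable_bivariate mh).
rewrite (fubini_tonelli (m1 := leb) (m2 := leb) _ mF)/=; last first.
  by move=> p; rewrite mule_ge0// lee_fin mulr_ge0.
apply: eq_integral => y2 _; under eq_integral do rewrite muleC.
rewrite ge0_integralZl//.
- by apply/measurable_EFinP; apply: measurable_funM; exact: (measurable_bivariate mh).
- by move=> y3 _; rewrite lee_fin mulr_ge0.
Qed.

(** If [delta] were 0, then [K] would vanish almost everywhere; but its integral
    is [G ^+ 2] by Tonelli. *)
Let delta_gt0 : (0 < delta)%E.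
Proof.
rewrite lt0e; apply/andP; split; last by apply: integral_ge0 => y _; exact: mule_ge0.
apply/eqP => delta0.
have mKK : measurable_fun setT (fun y => K (origin d) y * K (origin d) y)%E by exact: emeasurable_funM.
have /(ae_eq_integral_abs leb measurableT mKK) KK0 :
    (\int[leb]_y `|K (origin d) y * K (origin d) y| = 0)%E.
  by rewrite -delta0; apply: eq_integral => y _; rewrite gee0_abs// mule_ge0.
have intK : (\int[leb]_y K (origin d) y = (G ^+ 2)%:E)%E.
  rewrite /K -(fubini_tonelli (m1 := leb) (m2 := leb) (fun p : T * T => (h (origin d) p.1 * h p.1 p.2)%:E))/=.
  - rewrite (eq_integral (fun z => (G%:E * (h (origin d) z)%:E))%E); last first.
      move=> z _; under eq_integral do rewrite EFinM.
      rewrite ge0_integralZl ?lee_fin ?integral_dist_kernel// 1?muleC//.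
      by move=> y _; rewrite lee_fin.
    rewrite ge0_integralZl ?lee_fin ?integral_dist_kernel ?(ltW G_gt0)//.
    by move=> y _; rewrite lee_fin.
  - by apply/measurable_EFinP; apply: measurable_funM; exact: (measurable_bivariate mh).
  - by move=> p; rewrite lee_fin mulr_ge0.
have : (\int[leb]_y K (origin d) y = 0)%E.
  rewrite (ge0_ae_eq_integral (g := cst 0%E) measurableT) ?integral0//.
  apply: filterS KK0 => y /= yK _; have /eqP := yK I.
  by rewrite mule_eq0 orbb => /eqP.
by rewrite intK => -[] /eqP; rewrite expf_eq0 gt_eqF.
Qed.

(** Without the factor [1 - h x y3] the integral is [G ^+ 3], and the part which
    this factor removes is the weight of the 4-cycles through [x]. *)
Lemma block_integral : exists delta : R, 0 < delta <= G ^+ 3 /\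
  forall x, (\int[leb]_y1 \int[leb]_y2 \int[leb]_y3
    (h x y1 * h y1 y2 * h y2 y3 * (1 - h x y3))%:E = (G ^+ 3 - delta)%:E)%E.
Proof.
pose blk x (p : (T * T) * T) : R := (h x p.1.1 * h p.1.1 p.1.2 * h p.1.2 p.2) * (1 - h x p.2).
have split_eq x : (triple (blk x) + delta = (G ^+ 3)%:E)%E.
  rewrite -(triple_hhhh x) -tripleD.
  - rewrite -(triple_hhh x) /triple; do 3 (apply: eq_integral => ? _).
    by congr (_%:E); rewrite /blk /=; ring.
  - apply: measurable_funM; first exact: measurable_hhh.
    by apply: measurable_funB => //; exact: mx2.
  - by apply: measurable_funM; [exact: measurable_hhh|exact: mx2].
  - by move=> p; rewrite !mulr_ge0.
  - by move=> p; rewrite !mulr_ge0.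
have triple_ge0 x : (0 <= triple (blk x))%E.
  by do 3 (apply: integral_ge0 => ? _); rewrite lee_fin !mulr_ge0.
have delta_le : (delta <= (G ^+ 3)%:E)%E by rewrite -(split_eq (origin d)) leeDr.
have delta_fin : delta \is a fin_num.
  by rewrite ge0_fin_numE ?(ltW delta_gt0)//; apply: le_lt_trans delta_le _; rewrite ltry.
exists (fine delta); split.
  by rewrite -!lee_fin -lte_fin fineK// delta_gt0.
move=> x; rewrite EFinB fineK// -(split_eq x) addeK//.
Qed.

End Block.

(** * Radial functions with zero integral *)

Section Radial.
Context {R : realType}.
Local Notation mu := (@lebesgue_measure R).

(** Cover [N] by intervals of small total length.  The image of an interval lies
    in an interval of twice its length. *)
Lemma lipschitz_image_null (phi : R -> R) (N A : set (measurableTypeR R)) :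
  (forall x y, `|phi x - phi y| <= `|x - y|) ->
  measurable N -> mu N = 0%E -> measurable A -> A `<=` phi @` N -> mu A = 0%E.
Proof.
move=> phi_lip mN N0 mA AN; apply/eqP; rewrite eq_le measure_ge0 andbT.
apply/lee_addgt0Pr => e e0; rewrite add0e.
have NE : mu N = (((@wlength R idfun)^* N)%mu)%E by [].
have [F [Fitv NF] Fe] : exists2 F, open_itv_cover N F &
    (\sum_(0 <= k <oo) (@wlength R idfun) (F k) < (e / 2)%:E)%E.
  have lfin : ((@wlength R idfun)^* N)%mu \is a fin_num by rewrite -NE N0.
  have := lfin; rewrite outer_measure_open_itv_cover.
  move=> /lb_ereal_inf_adherent-/(_ (e / 2)); rewrite divr_gt0// => /(_ isT).
  rewrite -outer_measure_open_itv_cover -NE N0 add0e => -[_ [F NF <-] Fe].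
  by exists F.
pose a k := (sval (cid (Fitv k))).1; pose b k := (sval (cid (Fitv k))).2.
have FE k : F k = `]a k, b k[%classic by rewrite /a /b; case: cid => -[].
pose G k : set (measurableTypeR R) := `[phi (a k) - (b k - a k), phi (a k) + (b k - a k)]%classic.
have AG : A `<=` \bigcup_k G k.
  move=> y /AN[x Nx <-]; have [k _] := NF _ Nx; rewrite FE /= in_itv/= => /andP[ax xb].
  exists k => //; rewrite /G /= in_itv/= -ler_distl; apply: le_trans (phi_lip _ _) _.
  by rewrite ger0_norm ?subr_ge0 ?(ltW ax)//; lra.
apply: (@le_trans _ _ (\sum_(0 <= k <oo) mu (G k))%E).
  by apply: measure_sigma_subadditive => // k; exact: measurable_itv.
apply: (@le_trans _ _ (\sum_(0 <= k <oo) (2%:E * (@wlength R idfun) (F k)))%E).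
  apply: lee_nneseries => [k _ _|k _]; first exact: measure_ge0.
  rewrite FE wlength_itv/= /G lebesgue_measure_itv/= !lte_fin.
  case: (ltP (a k) (b k)) => ab; case: ifP => ab'.
  - by rewrite -!EFinB -EFinM lee_fin; lra.
  - by rewrite -EFinB -EFinM lee_fin; lra.
  - by exfalso; move: ab'; lra.
  - by rewrite mule0.
rewrite nneseriesZl; last by move=> k _; exact: wlength_ge0.
rewrite (_ : e = 2 * (e / 2)); last by field.
by rewrite EFinM; apply: lee_wpmul2l; rewrite ?lee_fin// ltW.
Qed.

Lemma sqrt_add_sqr_lipschitz (s : R) : 0 <= s -> forall x y : R,
  `|Num.sqrt (x ^+ 2 + s) - Num.sqrt (y ^+ 2 + s)| <= `|x - y|.
Proof.
move=> s0 x y; set u := Num.sqrt _; set v := Num.sqrt _.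
have u2 : u ^+ 2 = x ^+ 2 + s by rewrite sqr_sqrtr// addr_ge0// sqr_ge0.
have v2 : v ^+ 2 = y ^+ 2 + s by rewrite sqr_sqrtr// addr_ge0// sqr_ge0.
have [u0 v0] : 0 <= u /\ 0 <= v by rewrite !sqrtr_ge0.
have xu : `|x| <= u by rewrite -sqrtr_sqr ler_wsqrtr// lerDl.
have yv : `|y| <= v by rewrite -sqrtr_sqr ler_wsqrtr// lerDl.
have [uv0|uv_gt0] : u + v = 0 \/ 0 < u + v.
  by have := addr_ge0 u0 v0; rewrite le_eqVlt => /predU1P[->|]; auto.
  have [-> ->] : u = 0 /\ v = 0 by lra.
  by rewrite subrr normr0.
rewrite -(ler_pM2r uv_gt0) -{1}(gtr0_norm uv_gt0) -normrM.
rewrite (_ : (u - v) * (u + v) = (x - y) * (x + y)); last first.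
  by rewrite -!subr_sqr u2 v2; ring.
rewrite normrM; apply: ler_wpM2l => //.
by apply: le_trans (ler_normD _ _) _; exact: lerD.
Qed.

Lemma enorm_cons d (x : R) (t : Rspace R d) :
  enorm [tuple of (x : measurableTypeR R) :: t] =
  Num.sqrt (x ^+ 2 + \sum_(k < d) (tnth t k : R) ^+ 2).
Proof.
rewrite /enorm big_ord_recl tnth0; congr (Num.sqrt (_ + _)).
by apply: eq_bigr => k _; rewrite tnthS.
Qed.

(** By Tonelli there are points [t] of R^d, as close to the origin as one likes,
    such that [g (enorm (x :: t))] vanishes for almost every first coordinate
    [x].  On such a line the radius is a 1-Lipschitz function of [x] which takes
    all values above the norm of [t], so the radii above this norm where [g] does
    not vanish are in the Lipschitz image of a null set. *)
Lemma radial_integral_eq0 d (g : R -> R) : measurable_fun setT g -> (forall r, 0 <= g r) ->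
  (\int[lebesgue d.+1]_x (g (enorm x))%:E = 0)%E ->
  {ae mu, forall r : R, 0 <= r -> g r = 0}.
Proof.
move=> mg g0 int0.
pose s (t : Rspace R d) : R := \sum_(k < d) (tnth t k : R) ^+ 2.
have s0 t : 0 <= s t by apply: sumr_ge0 => k _; exact: sqr_ge0.
pose F (p : measurableTypeR R * Rspace R d) : \bar R := (g (enorm (cons_pair p)))%:E.
have F0 p : (0 <= F p)%E by rewrite lee_fin.
have mge : measurable_fun setT (fun x : Rspace R d.+1 => (g (enorm x))%:E).
  by apply/measurable_EFinP; exact: (measurableT_comp mg (@measurable_enorm R d.+1)).
have mF : measurable_fun setT F by exact: (measurableT_comp mge (@measurable_cons_pair R d)).
pose Phi (t : Rspace R d) : \bar R := (\int[mu]_x F (x, t))%E.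
have Phi0 t : (0 <= Phi t)%E by apply: integral_ge0.
have mPhi : measurable_fun setT Phi.
  exact: (measurable_fun_fubini_tonelli_G (m1 := mu) F mF F0).
have intPhi : (\int[lebesgue d]_t Phi t = 0)%E.
  rewrite -int0 integral_lebesgueS//; last by move=> t; rewrite lee_fin.
  by rewrite -(fubini_tonelli (m1 := mu) (m2 := lebesgue d) F mF F0).
(* otherwise Phi would not vanish on a cube around the origin, of positive volume *)
have small (eta : R) : 0 < eta -> exists2 t, s t < eta & Phi t = 0%E.
  move=> eta0; apply: contrapT => nex.
  have : (\int[lebesgue d]_t `|Phi t| = 0)%E.
    by rewrite -intPhi; apply: eq_integral => t _; rewrite gee0_abs.
  move=> /(ae_eq_integral_abs (lebesgue d) measurableT mPhi).
  move=> [N [mN N0 subN]].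
  pose eps : R := Num.min 1 (eta / d.+1%:R).
  have eps0 : 0 < eps by rewrite lt_min ltr01 divr_gt0.
  pose Q := [set x : Rspace R d | forall i, `]-eps, eps[%classic (tnth x i : R)].
  have Qvol : (0 < lebesgue d Q)%E.
    rewrite (lebesgue_box (A := fun=> `]-eps, eps[%classic)); last by move=> i; exact: measurable_itv.
    rewrite (eq_bigr (fun=> (2 * eps)%:E)); last first.
      move=> i _; rewrite lebesgue_measure_itv/= lte_fin ifT; last by lra.
      by rewrite -EFinB; congr (_%:E); ring.
    by rewrite prodEFin lte_fin; apply: prodr_gt0 => i _; lra.
  suff : (lebesgue d Q <= lebesgue d N)%E by rewrite N0 leNgt Qvol.
  have mQ : measurable Q.
    apply: (measurable_tuple_box (A := fun=> `]-eps, eps[%classic : set (measurableTypeR R))) => i.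
    exact: measurable_itv.
  apply: le_measure; rewrite ?inE// => t tQ; apply: subN => /= /(_ I) Pt0.
  apply: nex; exists t => //.
  apply: (@le_lt_trans _ _ (d%:R * (eta / d.+1%:R))); last first.
    by rewrite mulrCA gtr_pMr// ltr_pdivrMr// mul1r ltr_nat.
  rewrite mulr_natl -[X in _ *+ X]card_ord -sumr_const; apply: ler_sum => k _.
  have := tQ k; rewrite /= in_itv/= -ltr_norml => tk.
  have [e1 e2] : eps <= 1 /\ eps <= eta / d.+1%:R by rewrite /eps !ge_min !lexx orbT.
  rewrite -real_normK ?num_real//; apply: le_trans e2.
  rewrite expr2; apply: (@le_trans _ _ (`|tnth t k : R| * 1)); last by rewrite mulr1 ltW.
  by apply: ler_wpM2l => //; apply/ltW/(lt_le_trans tk).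
pose A n := [set r : measurableTypeR R | n.+1%:R^-1 < r /\ g r != 0].
have mA n : measurable (A n).
  rewrite (_ : A n = `]n.+1%:R^-1, +oo[%classic `&` g @^-1` [set~ 0]).
    apply: measurableI; [exact: measurable_itv|rewrite -[X in measurable X]setTI; apply: mg => //].
    by apply: measurableC; exact: measurable_set1.
  by apply/seteqP; split=> r /=; rewrite in_itv/= andbT => -[? /eqP ?].
have A0 n : mu (A n) = 0%E.
  have eta0 : (0 : R) < n.+1%:R^-1 ^+ 2 by rewrite exprn_gt0.
  have [t st Pt0] := small _ eta0.
  pose phi (x : R) := Num.sqrt (x ^+ 2 + s t).
  have mFt : measurable_fun setT (fun x => F (x, t)) by exact: (measurableT_comp mF (pair2_measurable t)).
  have : (\int[mu]_x `|F (x, t)| = 0)%E.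
    by rewrite -Pt0; apply: eq_integral => x _; rewrite gee0_abs.
  move=> /(ae_eq_integral_abs mu measurableT mFt)[N [mN N0 subN]].
  apply: (lipschitz_image_null (sqrt_add_sqr_lipschitz (s0 t)) mN N0 (mA n)).
  move=> r [rn gr0]; have r0 : 0 < r by apply: lt_trans rn.
  have r2 : s t <= r ^+ 2.
    apply: ltW; apply: (lt_trans st); rewrite ltr_sqr ?nnegrE//; exact: ltW.
  have phiE : Num.sqrt (Num.sqrt (r ^+ 2 - s t) ^+ 2 + s t) = r.
    by rewrite sqr_sqrtr ?subr_ge0// subrK sqrtr_sqr gtr0_norm.
  exists (Num.sqrt (r ^+ 2 - s t)) => //.
  apply: subN => /= /(_ I); rewrite /F /cons_pair /= enorm_cons -/(s t) phiE => -[] /eqP.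
  by rewrite (negbTE gr0).
have negA : mu.-negligible (\bigcup_n A n `|` [set 0]).
  apply: negligibleU.
    by apply: negligible_bigcup => n; apply/negligibleP; [exact: mA|exact: A0].
  by apply/negligibleP; [exact: measurable_set1|exact: lebesgue_measure_set1].
apply: negligibleS negA => r /= /not_implyP[r0 /eqP gr0].
move: r0; rewrite le_eqVlt => /predU1P[<-|r0]; [by right|left].
have [n] := ltr_add_invr r0; rewrite add0r => rn.
by exists n.
Qed.

End Radial.

(** * Recovery with a given number of vertices *)

Lemma prod_pairs {R : comRingType} m (F : nat -> nat -> R) :
  \prod_(j < m) \prod_(i < j) F i j =
  \prod_(e : 'I_m * 'I_m | (e.1 < e.2)%N) F e.1 e.2.
Proof.
transitivity (\prod_(j < m) \prod_(i < m | (i < j)%N) F i j).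
  by apply: eq_bigr => j _; rewrite (big_ord_widen m (fun i => F i j))// ltnW.
rewrite (exchange_big_dep xpredT)//= (pair_big_dep xpredT (fun i j : 'I_m => (i < j)%N)
  (fun i j : 'I_m => F i j)) /=.
by apply: eq_bigl.
Qed.

Section Gap.
Context {R : realType} {d : nat} {f_in f_out : R -> R}.
Hypothesis sc : sparse_connection d f_in f_out.

(** Only the values of the connection functions at nonnegative reals are
    constrained, so they are replaced by 0 elsewhere. *)
Definition restrict_half (f : R -> R) (r : R) : R := if 0 <= r then f r else 0.

Lemma measurable_restrict_half f : measurable_fun (`[0, +oo[ : set R) f ->
  measurable_fun setT (restrict_half f).
Proof.
move=> /(measurable_restrictT _ _).1 mf.
rewrite (_ : restrict_half f = f \_ `[0, +oo[); first exact: mf.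
apply/funext => r; rewrite /restrict_half patchE; case: (boolP (r \in _)).
  by rewrite inE /= in_itv/= andbT => ->.
by rewrite notin_setE /= in_itv/= andbT => /negP/negbTE ->.
Qed.

Definition gap (r : R) : R := restrict_half f_in r - restrict_half f_out r.

Lemma measurable_gap : measurable_fun setT gap.
Proof.
apply: measurable_funB; apply: measurable_restrict_half.
  exact: measurable_f_in sc.
exact: measurable_f_out sc.
Qed.

Lemma gap_rng r : 0 <= gap r <= 1.
Proof.
rewrite /gap /restrict_half; case: ifP => r0; last by rewrite subrr lexx ler01.
have := f_in_range sc r0; have := f_out_range sc r0; have := f_out_le_f_in sc r0; lra.
Qed.

End Gap.

Arguments gap {R} f_in f_out r.

Section Realisation.
Context {R : realType} {d : nat} {f_in f_out : R -> R} {lambda : R}.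
Context {disp : measure_display} {W : measurableType disp} {P : probability W R}.
Context {X : nat -> {mfun W >-> Rspace R d}} {Z : nat -> {mfun W >-> bool}}.
Context {E : nat -> nat -> {mfun W >-> bool}}.
Hypothesis sc : sparse_connection d f_in f_out.
Hypothesis cg : community_graph f_in f_out lambda P X Z E.

Lemma edist_ge0 (x y : Rspace R d) : 0 <= Defs.edist x y.
Proof. exact: sqrtr_ge0. Qed.

Lemma sigma_of_locations k (A : set (k.-tuple (Rspace R d))) : measurable A ->
  sigma_of X ((fun w => locations X k w) @^-1` A).
Proof.
move=> mA; pose GX := \bigcup_i preimage_set_system setT (X i) measurable.
pose f : g_sigma_algebraType GX -> k.-tuple (Rspace R d) := fun w => locations X k w.
have mf : measurable_fun setT f.
  apply/measurable_fun_tnthP => l.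
  rewrite (_ : _ \o f = X l); last by apply/funext => w; rewrite /= tnth_mktuple.
  by move=> _ Y mY; apply: sub_sigma_algebra; exists (l : nat) => //; exists Y.
by have := mf measurableT A mA; rewrite setTI.
Qed.

Lemma sigma_of_labels m (s : nat -> bool) :
  sigma_of Z [set w | forall i, (i < m)%N -> Z i w = s i].
Proof.
pose GZ := \bigcup_i preimage_set_system setT (Z i) measurable.
rewrite (_ : [set w | _] = \bigcap_(i in `I_m) (Z i @^-1` [set s i]))//.
apply: (@fin_bigcap_measurable _ (g_sigma_algebraType GZ)) => [|i _]; first exact: finite_II.
apply: sub_sigma_algebra; exists i => //; exists [set s i] => //.
by rewrite setTI.
Qed.

Lemma measurable_locations k : measurable_fun setT (fun w => locations X k w).
Proof.
apply/measurable_fun_tnthP => l.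
rewrite (_ : _ \o _ = X l); first exact: measurable_funP.
by apply/funext => w; rewrite /= tnth_mktuple.
Qed.

Lemma measurable_label_event m (s : nat -> bool) :
  measurable [set w | forall i, (i < m)%N -> Z i w = s i].
Proof.
rewrite (_ : [set w | _] = \bigcap_(i in `I_m) (Z i @^-1` [set s i]))//.
apply: fin_bigcap_measurable => [|i _]; first exact: finite_II.
by rewrite -[X in measurable X]setTI; apply: measurable_funP.
Qed.

Lemma measurable_edge_event m (a : nat -> nat -> bool) :
  measurable [set w | forall i j, (i < j < m)%N -> E i j w = a i j].
Proof.
rewrite (_ : [set w | _] = \bigcap_(j in `I_m) \bigcap_(i in `I_j) (E i j @^-1` [set a i j])).
  apply: fin_bigcap_measurable => [|j _]; first exact: finite_II.
  apply: fin_bigcap_measurable => [|i _]; first exact: finite_II.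
  by rewrite -[X in measurable X]setTI; apply: measurable_funP.
apply/seteqP; split=> w h; first by move=> j /= jm i /= ij; apply: h; rewrite ij.
by move=> i j /andP[ij jm]; exact: (h j jm i ij).
Qed.

(** The labels are uniform and independent of the locations: both sides are the
    integral of [F] against the law of the locations. *)
Lemma integral_labels_indep m k (s : nat -> bool) (F : k.-tuple (Rspace R d) -> \bar R) :
  measurable_fun [set: k.-tuple (Rspace R d)] F -> (forall x, 0 <= F x)%E ->
  (\int[P]_(w in [set w | forall i, (i < m)%N -> Z i w = s i]) F (locations X k w)
   = (2^-1 ^+ m)%:E * \int[P]_w F (locations X k w))%E.
Proof.
move=> mF F0; set Ls := [set w | _]; have mLs : measurable Ls by exact: measurable_label_event.
have mX := @measurable_locations k.
have m0 : 0 <= 2^-1 ^+ m :> R by rewrite exprn_ge0.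
rewrite -integral_mrestr//; last first.
  exact: (measurableT_comp mF mX).
rewrite -[LHS](ge0_integral_pushforward mX (mrestr P mLs) (D := setT) (f := F))//.
transitivity (\int[mscale (NngNum m0) (image_measure P mX)]_x F x)%E; last first.
  rewrite ge0_integral_mscale//; congr (_ * _)%E.
  exact: (ge0_integral_pushforward mX P (D := setT) (f := F)).
apply: eq_measure_integral => A mA _.
rewrite /= /mscale /pushforward /= /mrestr (labels_indep_locations cg).
- by rewrite (labels_iid_uniform cg) muleC.
- exact: sigma_of_locations.
- exact: sigma_of_labels.
Qed.

Lemma measure_finite_cover (I : finType) (V : I -> set W) (S : set W) :
  (forall i, measurable (V i)) -> measurable S -> S `<=` \bigcup_i V i ->
  (P S <= \sum_i P (V i))%E.
Proof.
move=> mV mS SV; have finI : finite_set [set: I] by exact: finite_finset.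
apply: (le_trans (content_sub_fsum P finI (fun i _ => mV i) mS SV)).
rewrite fsbig_finite//=.
rewrite le_eqVlt; apply/orP; left; apply/eqP; apply: perm_big.
rewrite uniq_perm ?finmap.fset_uniq ?index_enum_uniq// => i.
by rewrite mem_index_enum in_fset_set//; exact: mem_set.
Qed.

(** Whether [B] contains exactly [m] points is a condition on the first [m.+1]
    locations, which is why the locations are recorded as [m.+1]-tuples. *)
Section Recovery.
Variable m : nat.

Let pos (x : m.+1.-tuple (Rspace R d)) (i : 'I_m) : Rspace R d := tnth x (widen_ord (leqnSn m) i).

Let pos_locations w i : pos (locations X m.+1 w) i = X i w.
Proof. by rewrite /pos tnth_mktuple. Qed.

Let init (x : m.+1.-tuple (Rspace R d)) : m.-tuple (Rspace R d) := [tuple pos x i | i < m].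

Let init_locations w : init (locations X m.+1 w) = locations X m w.
Proof. by apply: eq_from_tnth => i; rewrite !tnth_mktuple pos_locations. Qed.

Let measurable_pos i : measurable_fun setT (pos ^~ i).
Proof. exact: measurable_tnth. Qed.

Let measurable_init : measurable_fun setT init.
Proof.
apply/measurable_fun_tnthP => i.
rewrite (_ : _ \o _ = pos ^~ i); first exact: measurable_pos.
by apply/funext => x; rewrite /= tnth_mktuple.
Qed.

Let pair_prob (f : R -> R) (x : m.+1.-tuple (Rspace R d)) (e : 'I_m * 'I_m) : R :=
  if (e.1 < e.2)%N then restrict_half f (Defs.edist (pos x e.1) (pos x e.2)) else 0.

Let measurable_pair_prob f e : measurable_fun (`[0, +oo[ : set R) f ->
  measurable_fun setT (pair_prob f ^~ e).
Proof.
move=> mf; rewrite /pair_prob; case: (e.1 < e.2)%N; last exact: measurable_cst.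
have mr := measurable_restrict_half mf.
have mh : measurable_fun setT (fun p : Rspace R d * Rspace R d =>
    restrict_half f (Defs.edist p.1 p.2)).
  exact: (measurableT_comp mr (@measurable_edist R d)).
exact: (measurable_bivariate (h := fun x y => restrict_half f (Defs.edist x y)) mh
  (@measurable_pos e.1) (@measurable_pos e.2)).
Qed.

Let q_rng x e : [/\ 0 <= pair_prob f_out x e, pair_prob f_out x e <= pair_prob f_in x e
  & pair_prob f_in x e <= 1].
Proof.
rewrite /pair_prob /restrict_half; case: ifP => _; last by rewrite lexx ler01.
rewrite edist_ge0; have := f_in_range sc (edist_ge0 (pos x e.1) (pos x e.2)).
have := f_out_range sc (edist_ge0 (pos x e.1) (pos x e.2)).
have := f_out_le_f_in sc (edist_ge0 (pos x e.1) (pos x e.2)).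
by move=> ? /andP[? ?] /andP[? ?]; split.
Qed.

Definition graph_of (a : {ffun 'I_m * 'I_m -> bool}) : 'M[bool]_m :=
  \matrix_(i, j) (if (i < j)%N then a (i, j) else (j < i)%N && a (j, i)).

(** A graph is encoded by the function of its ordered pairs that vanishes at the
    pairs which are not increasing, so that the graphs are counted once. *)
Let canonical (a : {ffun 'I_m * 'I_m -> bool}) := [forall e, a e ==> (e.1 < e.2)%N].

(** Labellings and graphs on the first [m] vertices, extended to all the integers
    as the hypotheses on the model require. *)
Let znat (z : {ffun 'I_m -> bool}) (i : nat) : bool := oapp z false (insub i).
Let anat (a : {ffun 'I_m * 'I_m -> bool}) (i j : nat) : bool :=
  if insub i is Some i' then oapp (fun j' => a (i', j')) false (insub j) else false.

Let znatE z (i : 'I_m) : znat z i = z i.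
Proof. by rewrite /znat valK. Qed.

Let anatE a (i j : 'I_m) : anat a i j = a (i, j).
Proof. by rewrite /anat !valK. Qed.

Variables (B : set (Rspace R d)) (c : R).
Hypothesis mB : measurable B.
Hypothesis c_gt0 : 0 < c.
Variable T : m.-tuple (Rspace R d) -> 'M[bool]_m -> 'I_m -> bool.
Hypothesis mT : forall G i, measurable_fun setT (fun x => T x G i).

Definition recovery_event : set W :=
  count_event X B m `&`
  [set w | c <= `|\sum_(i < m) spin (T (locations X m w) (graph_on E m w) i) * spin (Z i w)|].

Let Lz z := [set w | forall i, (i < m)%N -> Z i w = znat z i].
Let Ea a := [set w | forall i j, (i < j < m)%N -> E i j w = anat a i j].

Let A z a : set (m.+1.-tuple (Rspace R d)) :=
  [set x | [/\ forall i, B (pos x i), ~ B (tnth x ord_max) &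
    c <= `|\sum_(i < m) spin (T (init x) (graph_of a) i) * spin (z i)|]].

Let measurable_A z a : measurable (A z a).
Proof.
pose u x : R := `|\sum_(i < m) spin (T (init x) (graph_of a) i) * spin (z i)|.
have mu : measurable_fun setT u.
  apply: (measurableT_comp (@normr_measurable R setT)).
  apply: measurable_sum => i; apply: measurable_funM => //.
  rewrite /spin; apply: measurable_fun_ifT => //.
  exact: (measurableT_comp (mT (graph_of a) i) measurable_init).
rewrite (_ : A z a = (\bigcap_(i in [set: 'I_m]) (pos ^~ i) @^-1` B) `&`
  (~` ((fun x => tnth x ord_max) @^-1` B) `&` u @^-1` `[c, +oo[)); last first.
  apply/seteqP; split=> x /=; rewrite in_itv/= andbT.
    by move=> [xB xnB xc]; split=> // i _; exact: xB.
  by move=> [xB [xnB xc]]; split=> // i; exact: xB.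
apply: measurableI.
  apply: fin_bigcap_measurable => [|i _]; first exact: finite_finset.
  by rewrite -[X in measurable X]setTI; apply: measurable_pos.
apply: measurableI; last by rewrite -[X in measurable X]setTI; apply: mu => //; exact: measurable_itv.
by apply: measurableC; rewrite -[X in measurable X]setTI; apply: measurable_tnth.
Qed.

Let graph_onE a w : Ea a w -> graph_on E m w = graph_of a.
Proof.
move=> Eaw; apply/matrixP => i j; rewrite !mxE; case: ltngtP => ij /=.
- by rewrite Eaw ?anatE// ij ltn_ord.
- by rewrite (edges_sym cg) Eaw ?anatE// ij ltn_ord.
- by rewrite (val_inj ij) (edges_irrefl cg).
Qed.

Let V (za : {ffun 'I_m -> bool} * {ffun 'I_m * 'I_m -> bool}) : set W :=
  if canonical za.2 then
    (fun w => locations X m.+1 w) @^-1` A za.1 za.2 `&` Lz za.1 `&` Ea za.2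
  else set0.

Let recovery_cover : recovery_event = \bigcup_za V za.
Proof.
apply/seteqP; split=> w.
  move=> [[wB wnB] wc].
  pose z : {ffun 'I_m -> bool} := [ffun i : 'I_m => Z i w].
  pose a : {ffun 'I_m * 'I_m -> bool} := [ffun e : 'I_m * 'I_m => (e.1 < e.2)%N && E e.1 e.2 w].
  have zE i : (i < m)%N -> Z i w = znat z i.
    by move=> im; rewrite -[i]/(nat_of_ord (Ordinal im)) znatE ffunE.
  have aE i j : (i < j < m)%N -> E i j w = anat a i j.
    move=> /andP[ij jm]; rewrite -[j]/(nat_of_ord (Ordinal jm)).
    by rewrite -[i]/(nat_of_ord (Ordinal (ltn_trans ij jm))) anatE ffunE /= ij.
  have ca : canonical a by apply/forallP => e; rewrite ffunE; apply/implyP => /andP[].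
  exists (z, a) => //; rewrite /V /= ca; split=> //; split=> //; split=> /=.
  - by move=> i; rewrite pos_locations; exact: wB.
  - by rewrite tnth_mktuple.
  - rewrite init_locations -(graph_onE aE); apply: le_trans wc _.
    by rewrite le_eqVlt; apply/orP; left; apply/eqP; congr `|_|; apply: eq_bigr => i _; rewrite ffunE.
move=> [[z a] _]; rewrite /V /=; case: ifP => // _ [[[wB wnB wc] wz] wa]; split.
  split=> [i im|]; last by move: wnB; rewrite tnth_mktuple.
  by have := wB (Ordinal im); rewrite pos_locations.
rewrite /= (graph_onE wa) -init_locations; apply: le_trans wc _.
rewrite le_eqVlt; apply/orP; left; apply/eqP; congr `|_|; apply: eq_bigr => i _.
by rewrite wz ?znatE// ltn_ord.
Qed.

Let mV za : measurable (V za).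
Proof.
rewrite /V; case: ifP => _ //; apply: measurableI; last exact: measurable_edge_event.
apply: measurableI; last exact: measurable_label_event.
rewrite -[X in measurable X]setTI; apply: measurable_locations => //; exact: measurable_A.
Qed.

Lemma measurable_recovery_event : measurable recovery_event.
Proof.
rewrite recovery_cover; apply: fin_bigcup_measurable => // ; exact: finite_finset.
Qed.

Let dens z a x : R := \prod_e bern (a e) (sbm_prob (pair_prob f_in x) (pair_prob f_out x) z e).

Let F z a x : \bar R := (\1_(A z a) x * dens z a x)%:E.

Let dens_ge0 z a x : 0 <= dens z a x.
Proof.
apply: prodr_ge0 => e _; have [? ? ?] := q_rng x e.
by rewrite /bern /sbm_prob; case: (a e); case: ifP => _; lra.
Qed.

Let measurable_dens z a : measurable_fun setT (dens z a).
Proof.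
apply: measurable_prod => e _.
have min := measurable_pair_prob e (measurable_f_in sc).
have mout := measurable_pair_prob e (measurable_f_out sc).
rewrite /bern /sbm_prob; case: (a e); case: (z e.1 == z e.2) => //; exact: measurable_funB.
Qed.

Let F_ge0 z a x : (0 <= F z a x)%E.
Proof. by rewrite lee_fin mulr_ge0. Qed.

Let measurable_F z a : measurable_fun setT (F z a).
Proof.
apply/measurable_EFinP; apply: measurable_funM; last exact: measurable_dens.
by apply: measurable_indic; exact: measurable_A.
Qed.

Let densE z a w : canonical a -> Lz z w ->
  dens z a (locations X m.+1 w) =
  \prod_(j < m) \prod_(i < j) (if anat a i j then edge_prob f_in f_out X Z i j w
    else 1 - edge_prob f_in f_out X Z i j w).
Proof.
move=> /forallP ca wz.
rewrite (prod_pairs m (fun i j => if anat a i j then edge_prob f_in f_out X Z i j w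
    else 1 - edge_prob f_in f_out X Z i j w)).
rewrite /dens (bigID (fun e : 'I_m * 'I_m => (e.1 < e.2)%N)) /= [X in _ * X]big1 ?mulr1.
  apply: eq_bigr => -[i j] /= ij; rewrite anatE /bern /sbm_prob /edge_prob /=.
  rewrite !wz ?ltn_ord// !znatE /pair_prob /= ij !pos_locations /restrict_half.
  by rewrite edist_ge0.
move=> e ne; have := ca e; rewrite (negbTE ne) implybF => /negbTE ->.
by rewrite /bern /sbm_prob /pair_prob (negbTE ne) if_same subr0.
Qed.

(** The law of the edges given the rest, then the independence of the labels and
    the locations. *)
Let P_V z a : canonical a ->
  P (V (z, a)) = ((2^-1 ^+ m)%:E * \int[P]_w F z a (locations X m.+1 w))%E.
Proof.
move=> ca; rewrite /V /= ca.
set D := _ @^-1` A z a.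
rewrite (edge_law cg); last first.
  apply: (@measurableI _ (g_sigma_algebraType (sigma_of X `|` sigma_of Z))).
    by apply: sub_sigma_algebra; left; apply: sigma_of_locations; exact: measurable_A.
  by apply: sub_sigma_algebra; right; exact: sigma_of_labels.
rewrite integral_mkcondl -(integral_labels_indep m (znat z) (measurable_F z a) (F_ge0 z a)).
apply: eq_integral => w; rewrite inE => wz; rewrite patchE /F indicE.
have -> : (locations X m.+1 w \in A z a) = (w \in D).
  by apply/idP/idP => /set_mem h; apply: mem_set.
by case: (boolP (w \in D)) => wD; rewrite ?mul0r// mul1r densE.
Qed.

Let kernel_edge w (i j : 'I_m) : i != j ->
  pair_prob f_in (locations X m.+1 w) (edge_of i j) - pair_prob f_out (locations X m.+1 w) (edge_of i j)
  = dist_kernel (gap f_in f_out) (X i w) (X j w).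
Proof.
move=> ij; rewrite /pair_prob /dist_kernel /gap /edge_of.
case: (ltnP i j) => ij' /=; first by rewrite ij' !pos_locations.
rewrite ltn_neqAle eq_sym ij ij' /= !pos_locations edistC //.
Qed.

Let weightE w k (t : k.+1.-tuple 'I_m) : uniq t ->
  geodesic_weight (fun i j => pair_prob f_in (locations X m.+1 w) (edge_of i j)
    - pair_prob f_out (locations X m.+1 w) (edge_of i j)) (thead t) (behead t) =
  geodesic_weight (dist_kernel (gap f_in f_out)) (thead (location_tuple X t w))
    (behead (location_tuple X t w)).
Proof.
move=> ut.
rewrite (eq_geodesic_weight (h' := fun i j : 'I_m => dist_kernel (gap f_in f_out) (X i w) (X j w))); last 2 first.
- by move=> i j _ _; exact: kernel_edge.
- by rewrite {1}(tuple_eta t) in ut.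
rewrite -(geodesic_weight_map (fun i : 'I_m => X i w)); congr geodesic_weight.
  by rewrite /thead tnth_mktuple.
have -> : tval (location_tuple X t w) = [seq (X i w : Rspace R d) | i : 'I_m <- t].
  rewrite -[RHS]/(tval (map_tuple (fun i : 'I_m => X i w) t)); congr tval.
  by apply: eq_from_tnth => l; rewrite tnth_mktuple tnth_map.
by case: (tval t).
Qed.

(** Split the event according to the labels and the graph.  Given the locations,
    the probabilities add up to the left-hand side of [overlap_bound], where the
    pairs have probabilities computed from the distances; it remains to integrate
    that bound over the locations. *)
Lemma recovery_event_bound :
  (P recovery_event <= (c ^- 2)%:E * \sum_(k < m) \sum_(t : k.+1.-tuple 'I_m | uniq t)
    \int[P]_(w in count_event X B m)
       (geodesic_weight (dist_kernel (gap f_in f_out)) (thead (location_tuple X t w))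
       (behead (location_tuple X t w)))%:E)%E.
Proof.
have m0 : 0 <= 2^-1 ^+ m :> R by rewrite exprn_ge0.
pose N := count_event X B m.
have mN : measurable N by exact: measurable_count_event.
pose gw k (t : k.+1.-tuple 'I_m) w : R :=
  geodesic_weight (dist_kernel (gap f_in f_out)) (thead (location_tuple X t w))
    (behead (location_tuple X t w)).
have gw0 k (t : k.+1.-tuple 'I_m) w : 0 <= gw k t w.
  by apply: geodesic_weight_ge0 => x y; exact: dist_kernel_rng (gap_rng sc) _ _.
have mgw k (t : k.+1.-tuple 'I_m) : measurable_fun setT (gw k t).
  have mk := measurable_dist_kernel (d := d) (measurable_gap sc).
  have mgt := measurable_geodesic_weight mk (k := k).
  exact: (measurableT_comp mgt (@measurable_location_tuple _ _ _ _ X _ _ t)).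
pose L (za : {ffun 'I_m -> bool} * {ffun 'I_m * 'I_m -> bool}) w : \bar R :=
  if canonical za.2 then ((2^-1 ^+ m)%:E * F za.1 za.2 (locations X m.+1 w))%E else 0%E.
have L0 za w : (0 <= L za w)%E.
  by rewrite /L; case: ifP => // _; rewrite mule_ge0// lee_fin.
have mL za : measurable_fun setT (L za).
  rewrite /L; case: (canonical za.2) => //; apply: measurable_funeM.
  exact: (measurableT_comp (measurable_F _ _) (@measurable_locations _)).
apply: (@le_trans _ _ (\sum_za \int[P]_w L za w)%E).
  apply: (@le_trans _ _ (\sum_za P (V za))%E).
    apply: measure_finite_cover => //; first exact: measurable_recovery_event.
    by rewrite recovery_cover.
  apply: lee_sum => -[z a] _; rewrite /L /=.
  case: (boolP (canonical a)) => ca; last by rewrite /V /= (negbTE ca) measure0 integral0.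
  rewrite P_V// ge0_integralZl ?lee_fin//.
  exact: (measurableT_comp (measurable_F _ _) (@measurable_locations _)).
rewrite -ge0_integral_sum//.
apply: (@le_trans _ _ (\int[P]_(w in N) ((c ^- 2)%:E * \sum_(k < m) \sum_(t : k.+1.-tuple 'I_m | uniq t) (gw k t w)%:E))%E); last first.
  have mgwE k (t : k.+1.-tuple 'I_m) : measurable_fun N (fun w => (gw k t w)%:E).
    by apply: measurable_funTS; apply/measurable_EFinP.
  have msum k : measurable_fun N (fun w => \sum_(t : k.+1.-tuple 'I_m | uniq t) (gw k t w)%:E)%E.
    by under eq_fun do rewrite -big_filter; apply: emeasurable_sum => t; exact: mgwE.
  rewrite ge0_integralZl//; last 3 first.
  - exact: emeasurable_sum.
  - by move=> w _; do 2 (apply: sume_ge0 => ? _); rewrite lee_fin.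
  - by rewrite lee_fin invr_ge0 exprn_ge0// ltW.
  rewrite ge0_integral_sum//; last by move=> k w _; apply: sume_ge0 => ? _; rewrite lee_fin.
  rewrite le_eqVlt; apply/orP; left; apply/eqP; congr (_ * _)%E; apply: eq_bigr => k _.
  under eq_integral do rewrite -big_filter.
  by rewrite ge0_integral_sum ?big_filter// => t w _; rewrite lee_fin.
rewrite [leRHS]integral_mkcond; apply: le_integral_ge0 => w.
  by apply: sume_ge0 => za _.
rewrite patchE; case: (boolP (w \in N)) => [/set_mem [wB wnB]|/negP wN]; last first.
  rewrite big1// => -[z a] _; rewrite /L /F /= indicE memNset ?mul0r ?mule0 ?if_same//.
  move=> [xB xnB _]; apply: wN; rewrite inE; split.
    by move=> i im; have := xB (Ordinal im); rewrite pos_locations.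
  by move: xnB; rewrite tnth_mktuple.
pose x := locations X m.+1 w.
have q0 (e : 'I_m * 'I_m) : ~~ (e.1 < e.2)%N -> pair_prob f_in x e = 0 by rewrite /pair_prob => /negbTE ->.
have := overlap_bound (q_rng x) q0 (fun a i => T (init x) (graph_of a) i) c_gt0.
rewrite -lee_fin; set bnd := (_ * _)%R; set lhs := \sum_z _.
have -> : bnd%:E = ((c ^- 2)%:E * \sum_(k < m) \sum_(t : k.+1.-tuple 'I_m | uniq t) (gw k t w)%:E)%E.
  rewrite /bnd EFinM -sumEFin; congr (_ * _)%E; apply: eq_bigr => k _.
  by rewrite -sumEFin; apply: eq_bigr => t ut; rewrite weightE.
apply: le_trans; rewrite /lhs pair_bigA -sumEFin; apply: lee_sum => -[z a] _.
rewrite /L /=; case: ifP => _; last first.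
  by rewrite lee_fin mulr_ge0// mulr_ge0// dens_ge0.
rewrite /F -EFinM lee_fin /dens mulrCA; apply: ler_wpM2r.
  by rewrite mulr_ge0// dens_ge0.
rewrite indicE ler_nat.
case: (boolP (_ \in A z a)) => // /set_mem [_ _ ->]; exact: leqnn.
Qed.

End Recovery.

End Realisation.

Arguments recovery_event {R d disp W} X Z E {m} B c T.

(** * The expected number of geodesic paths *)

(** The terms of index [k.+3] are [lambda ^+ 3 * beta] times those of index [k]:
    a geometric series of ratio less than 1 for each residue modulo 3. *)
Lemma geometric_blocks {R : realType} (lambda G beta : R) (n : nat) :
  0 <= lambda -> 0 <= G -> 0 <= beta -> lambda ^+ 3 * beta < 1 ->
  \sum_(k < n) lambda ^+ k * (beta ^+ (k %/ 3) * G ^+ (k %% 3))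
  <= (1 + lambda * G + (lambda * G) ^+ 2) / (1 - lambda ^+ 3 * beta).
Proof.
move=> l0 G0 b0 rho1; set rho := lambda ^+ 3 * beta in rho1 *.
have r0 : 0 < 1 - rho by rewrite subr_gt0.
have rho0 : 0 <= rho by rewrite mulr_ge0// exprn_ge0.
pose u k : R := lambda ^+ k * (beta ^+ (k %/ 3) * G ^+ (k %% 3)).
have u3 k : u k.+3 = rho * u k.
  rewrite /u; have -> : (k.+3 %/ 3 = (k %/ 3).+1)%N by rewrite -addn3 divnDr// divnn addn1.
  have -> : (k.+3 %% 3 = k %% 3)%N by rewrite -addn3 modnDr.
  rewrite -[in lambda ^+ _]addn3 exprD (exprS beta) /rho.
  move: (lambda ^+ k) (lambda ^+ 3) (beta ^+ _) (G ^+ _) => a b c e; ring.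
have u0 : u 0 = 1 by rewrite /u !expr0; ring.
have u1 : u 1 = lambda * G by rewrite /u /= !expr1 expr0; ring.
have u2 : u 2 = (lambda * G) ^+ 2 by rewrite /u /= expr0; ring.
have lG : 0 <= lambda * G by rewrite mulr_ge0.
have lG2 : 0 <= (lambda * G) ^+ 2 by rewrite exprn_ge0.
rewrite ler_pdivlMr//; set c := 1 + _ + _.
have c0 : 0 <= c by rewrite /c; lra.
have [N] := ubnP n; elim: N n => // N IH [|[|[|n]]] nN.
- by rewrite big_ord0 mul0r.
- rewrite big_ord_recl big_ord0 -/(u 0) u0 addr0 mul1r /c; lra.
- rewrite !big_ord_recl big_ord0 -/(u 0) -/(u 1) u0 u1 addr0.
  apply: (@le_trans _ _ (1 + lambda * G)); last by rewrite /c; lra.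
  by rewrite ler_piMr//; lra.
- rewrite !big_ord_recl /=.
  rewrite -/(u 0) -/(u 1) -/(u 2) u0 u1 u2.
  rewrite (eq_bigr (fun k : 'I_n => rho * u k)); last first.
    by move=> k _; rewrite -u3.
  rewrite -mulr_sumr; have := IH n; rewrite -/rho => /(_ _)IHn.
  have {}IHn : (\sum_(k < n) u k) * (1 - rho) <= c by apply: IHn; lia.
  have := ler_wpM2l rho0 IHn.
  by rewrite /c; lra.
Qed.

Section Unsolvable.
Context {R : realType} {d' : nat} {f_in f_out : R -> R}.
Local Notation d := d'.+1.
Hypothesis sc : sparse_connection d f_in f_out.
Variables G delta : R.
Hypothesis GE : (\int[lebesgue d]_x (gap f_in f_out (enorm x))%:E = G%:E)%E.
Hypothesis G_gt0 : 0 < G.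
Hypothesis delta_rng : 0 < delta <= G ^+ 3.
Local Notation h := (dist_kernel (d := d) (gap f_in f_out)).
Hypothesis block : forall x, (\int[lebesgue d]_y1 \int[lebesgue d]_y2 \int[lebesgue d]_y3
    (h x y1 * h y1 y2 * h y2 y3 * (1 - h x y3))%:E = (G ^+ 3 - delta)%:E)%E.
Variable lambda : R.
Hypothesis lambda_gt0 : 0 < lambda.
Local Notation beta := (G ^+ 3 - delta).
Hypothesis subcritical : lambda ^+ 3 * beta < 1.

Let beta0 : 0 <= beta. Proof. by case/andP: delta_rng; rewrite subr_ge0. Qed.

Definition path_constant : R :=
  lambda * ((1 + lambda * G + (lambda * G) ^+ 2) / (1 - lambda ^+ 3 * beta)).

Lemma path_constant_ge0 : 0 <= path_constant.
Proof.
rewrite /path_constant mulr_ge0 ?(ltW lambda_gt0)// divr_ge0//.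
  by rewrite !addr_ge0// ?exprn_ge0// mulr_ge0 ?ltW.
by rewrite subr_ge0 ltW.
Qed.

Section Mass.
Variable B : set (Rspace R d).
Hypothesis mB : measurable B.
Hypothesis B_fin : (lebesgue d B < +oo)%E.
Let muB := [the {finite_measure set (Rspace R d) -> \bar R} of mfrestr mB B_fin].

Let mh := measurable_dist_kernel (d := d) (measurable_gap sc).
Let h_rng := dist_kernel_rng (d := d) (gap_rng sc).

(** Restricting the integrals to [B] decreases the masses of a step and of a
    block, which are constant on the whole space. *)
Lemma restricted_degree x : (\int[muB]_y (h x y)%:E <= G%:E)%E.
Proof.
rewrite -(integral_dist_kernel (measurable_gap sc) (gap_rng sc) GE x).
apply: integral_mrestr_le.
  by apply/measurable_EFinP; exact: (measurable_bivariate mh).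
by move=> y; rewrite lee_fin; case/andP: (h_rng x y).
Qed.

Lemma restricted_block x : (\int[muB]_y1 \int[muB]_y2 \int[muB]_y3
    (h x y1 * h y1 y2 * h y2 y3 * (1 - h x y3))%:E <= beta%:E)%E.
Proof.
rewrite -(block x).
pose A (p : (Rspace R d * Rspace R d) * Rspace R d) : \bar R :=
    (h x p.1.1 * h p.1.1 p.1.2 * h p.1.2 p.2 * (1 - h x p.2))%:E.
have A0 p : (0 <= A p)%E.
  have hk y z : 0 <= h y z /\ 0 <= 1 - h y z.
    by case/andP: (h_rng y z) => ? ?; split=> //; rewrite subr_ge0.
  by rewrite lee_fin !mulr_ge0 ?(hk _ _).1 ?(hk _ _).2.
have mA : measurable_fun setT A.
  apply/measurable_EFinP; apply: measurable_funM; last first.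
    by apply: measurable_funB => //; exact: (measurable_bivariate mh).
  have m11 : measurable_fun setT (fun p : (Rspace R d * Rspace R d) * Rspace R d => p.1.1) by exact: measurableT_comp.
  have m12 : measurable_fun setT (fun p : (Rspace R d * Rspace R d) * Rspace R d => p.1.2) by exact: measurableT_comp.
  by apply: measurable_funM; [apply: measurable_funM|]; exact: (measurable_bivariate mh).
pose A2 (p : Rspace R d * Rspace R d) := (\int[lebesgue d]_y3 A (p, y3))%E.
have mA2 : measurable_fun setT A2 by exact: (measurable_fun_fubini_tonelli_F (m2 := lebesgue d) A mA A0).
have A20 p : (0 <= A2 p)%E by apply: integral_ge0 => y _; exact: A0.
have mA1 : measurable_fun setT (fun y1 => \int[lebesgue d]_y2 A2 (y1, y2))%E.
  exact: (measurable_fun_fubini_tonelli_F (m2 := lebesgue d) A2 mA2 A20).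
apply: (@le_trans _ _ (\int[muB]_y1 \int[lebesgue d]_y2 A2 (y1, y2))%E); last first.
  by apply: integral_mrestr_le => // y1; apply: integral_ge0.
apply: le_integral_ge0 => y1.
  by do 2 (apply: integral_ge0 => ? _); exact: (A0 (_, _, _)).
apply: (@le_trans _ _ (\int[muB]_y2 A2 (y1, y2))%E); last first.
  by apply: integral_mrestr_le => [|z]; last exact: (A20 (y1, z)); exact: (measurableT_comp mA2 (pair1_measurable y1)).
apply: le_integral_ge0 => y2.
  by apply: integral_ge0 => ? _; exact: (A0 (_, _, _)).
by apply: integral_mrestr_le => [|z]; last exact: (A0 (y1, y2, z)); exact: (measurableT_comp mA (pair1_measurable (y1, y2))).
Qed.

Context {disp : measure_display} {W : measurableType disp} {P : probability W R}.
Context {X : nat -> {mfun W >-> Rspace R d}}.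
Hypothesis pp : poisson_process lambda P X.
Hypothesis B_down : forall w i j, (i <= j)%N -> B (X j w) -> B (X i w).

Let path_sum m k : \bar R := (\sum_(t : k.+1.-tuple 'I_m | uniq t)
    \int[P]_(w in count_event X B m)
       (geodesic_weight h (thead (location_tuple X t w))
       (behead (location_tuple X t w)))%:E)%E.

Let gw0 x p : 0 <= geodesic_weight h x p.
Proof. exact: geodesic_weight_ge0. Qed.

Let path_sum_ge0 m k : (0 <= path_sum m k)%E.
Proof. by apply: sume_ge0 => t _; apply: integral_ge0 => w _; rewrite lee_fin. Qed.

(** The Mecke formula turns the expected weight of the paths of [k] steps into
    [lambda ^+ k.+1] times an integral over the paths in [B], which is bounded by
    the volume of [B] times powers of the masses of a block and of a step. *)
Lemma expected_paths :
  (\sum_(0 <= m <oo) \sum_(k < m) path_sum m k <=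
   path_constant%:E * lebesgue d B)%E.
Proof.
apply: (@le_trans _ _ (\sum_(0 <= m <oo) \sum_(0 <= k <oo) path_sum m k)%E).
  apply: lee_nneseries => [m _ _|m _]; first by apply: sume_ge0.
  by rewrite -(big_mkord xpredT (path_sum m)); apply: nneseries_lim_ge.
rewrite nneseries_interchange//.
have lv : 0 <= fine (lebesgue d B) by exact: fine_ge0.
have leE : (lebesgue d B = (fine (lebesgue d B))%:E)%E by rewrite fineK// ge0_fin_numE.
apply: lime_le; first by apply: is_cvg_nneseries => k _ _; apply: nneseries_ge0.
apply: nearW => n; rewrite big_mkord.
apply: (@le_trans _ _ (\sum_(k < n) (lambda * fine (lebesgue d B) *
    (lambda ^+ k * (beta ^+ (k %/ 3) * G ^+ (k %% 3))))%:E)%E).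
  apply: lee_sum => k _.
  rewrite (mecke pp (ltW lambda_gt0) mB B_fin B_down
    (F := fun t => (geodesic_weight h (thead t) (behead t))%:E)); last 2 first.
  - by apply/measurable_EFinP; exact: measurable_geodesic_weight mh _.
  - by move=> t; rewrite lee_fin.
  have := path_integral_bound (mu := muB) mh h_rng (ltW G_gt0) beta0 restricted_degree restricted_block k.
  have -> : muB setT = lebesgue d B by rewrite /muB /= /mfrestr /mrestr setTI.
  rewrite leE -EFinM => bnd.
  apply: (@le_trans _ _ ((lambda ^+ k.+1)%:E * (fine (lebesgue d B) * (beta ^+ (k %/ 3) * G ^+ (k %% 3)))%:E)%E).
    by apply: lee_wpmul2l; rewrite ?lee_fin ?exprn_ge0 ?(ltW lambda_gt0).
  by rewrite -EFinM lee_fin exprS le_eqVlt; apply/orP; left; apply/eqP; ring.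
rewrite leE sumEFin -EFinM lee_fin -mulr_sumr /path_constant.
rewrite [leRHS]mulrAC.
apply: ler_wpM2l; first by rewrite mulr_ge0// ltW.
by apply: geometric_blocks => //; exact: ltW.
Qed.

End Mass.

End Unsolvable.

(** * Failure of weak recovery *)

Lemma box_tuple_box {R : realType} d n : @box R d n =
  tuple_box (fun=> [set` `[- (n%:R `^ d%:R^-1 / 2), n%:R `^ d%:R^-1 / 2]%R]).
Proof. by apply/seteqP; split=> x /= xn k; move: (xn k); rewrite /= in_itv. Qed.

Lemma measurable_box {R : realType} d n : measurable (@box R d n).
Proof. by rewrite box_tuple_box; apply: measurable_tuple_box. Qed.

Lemma lebesgue_cube {R : realType} d n : lebesgue d.+1 (@box R d.+1 n) = n%:R%:E.
Proof.
rewrite box_tuple_box lebesgue_box//.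
pose s : R := n%:R `^ d.+1%:R^-1.
rewrite (eq_bigr (fun=> s%:E)); last first.
  move=> i _; rewrite lebesgue_measure_itv /= lte_fin.
  have s0 : 0 <= s := powR_ge0 _ _.
  case: ltP => [_|]; rewrite -/s; first by rewrite -EFinB; congr (_%:E); field.
  by move=> ?; congr (_%:E); lra.
rewrite prodEFin prodr_const card_ord /s -powR_mulrn ?powR_ge0// -powRrM mulVf ?pnatr_eq0//.
by rewrite powRr1.
Qed.

Lemma box_down {R : realType} d n {disp} {W : measurableType disp}
    (X : nat -> {mfun W >-> Rspace R d}) :
  (forall w i j, (i <= j)%N -> maxnorm (X i w) <= maxnorm (X j w)) ->
  forall w i j, (i <= j)%N -> box n (X j w) -> box n (X i w).
Proof.
by move=> mono w i j ij /box_maxnorm xj; apply/box_maxnorm/(le_trans (mono w _ _ ij)).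
Qed.

Section NumberOfVertices.
Context {R : realType} {d : nat} {disp : measure_display} {W : measurableType disp}.
Context {X : nat -> {mfun W >-> Rspace R d}}.
Hypothesis ordered : forall w i j, (i <= j)%N -> maxnorm (X i w) <= maxnorm (X j w).
Variable n : nat.

Lemma Nbox_count_event m w : count_event X (box n) m w -> Nbox X n w = m.
Proof.
move=> [inside outside]; rewrite /Nbox (_ : [set i | _] = `I_m).
  exact: (card_fset_set (card_eqxx _)).
apply/seteqP; split=> i /=; last exact: inside.
move=> bi; rewrite ltnNge; apply/negP => mi.
exact/outside/(box_down ordered mi).
Qed.

(** Then every point is in the cube, and [Nbox] is 0 by convention. *)
Lemma Nbox_outside w : ~ (\bigcup_m count_event X (box n) m) w -> Nbox X n w = 0%N.
Proof.
move=> out.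
have inside i : box n (X i w).
  elim/ltn_ind: i => i IH; apply: contrapT => Ni; apply: out.
  by exists i; [|split; [exact: IH|exact: Ni]].
rewrite /Nbox (_ : [set i | _] = setT); last by apply/seteqP; split=> // i _; exact: inside.
rewrite /fset_set; case: pselect => //.
by move=> fin; case: (infinite_nat fin).
Qed.

End NumberOfVertices.

(** With [M] close to [v / 4], a Poisson variable of mean [v] is less than [M]
    with exponentially small probability, and [M ^- 2 * v] is of order
    [1 / v]. *)
Lemma poisson_tail_bound {R : realType} (v a : R) : 8 <= v -> 0 <= a ->
  exists2 M : nat, (0 < M)%N &
    \sum_(k < M) poisson_weight v k + (M%:R ^- 2) * (a * v) <= (4 + 64 * a) / v.
Proof.
move=> v8 a0; have v0 : 0 < v by lra.
have v40 : 0 <= v / 4 by lra.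
exists (Num.truncn (v / 4)).
  by rewrite truncn_gt0; lra.
have /andP[Mle Mgt] := truncn_itv v40; set M := Num.truncn _ in Mle Mgt *.
have Mge : v / 8 <= M%:R by move: Mgt; rewrite -[M.+1%:R]natr1; lra.
have tail : \sum_(k < M) poisson_weight v k <= 4 / v.
  apply: (le_trans (poisson_small M (ltW v0))).
  have e2 : (2 : R) ^+ M <= expR (v / 4).
    apply: (@le_trans _ _ (expR (M%:R : R))); last by rewrite ler_expR.
    rewrite -[M%:R]mul1r expRM_natr.
    by apply: lerXn2r; rewrite ?nnegrE ?expR_ge0//; have := @expR_ge1Dx R 1; lra.
  apply: (@le_trans _ _ (expR (- (v / 4)))).
    rewrite (_ : - (v / 4) = v / 4 + - (v / 2)); last by field.
    by rewrite expRD; apply: ler_wpM2r => //; exact: expR_ge0.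
  rewrite expRN (_ : 4 / v = (v / 4)^-1); last by field; lra.
  rewrite lef_pV2 ?posrE ?expR_gt0//; last lra.
  by have := @expR_ge1Dx R (v / 4); lra.
have M0 : 0 < M%:R :> R by lra.
(* M is at least v / 8, whence the constant 64 = 8 ^ 2 *)
have sq : (M%:R ^- 2) * (a * v) <= 64 * a / v.
  rewrite (_ : 64 * a / v = ((v / 8) ^+ 2)^-1 * (a * v)); last by field; lra.
  apply: ler_wpM2r; first by rewrite mulr_ge0// ltW.
  rewrite lef_pV2 ?posrE ?exprn_gt0//; last lra.
  by apply: lerXn2r => //; rewrite nnegrE; lra.
by rewrite mulrDl; apply: lerD.
Qed.

Section Realised.
Context {R : realType} {d' : nat} {f_in f_out : R -> R}.
Local Notation d := d'.+1.
Hypothesis sc : sparse_connection d f_in f_out.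
Variables G delta : R.
Hypothesis GE : (\int[lebesgue d]_x (gap f_in f_out (enorm x))%:E = G%:E)%E.
Hypothesis G_gt0 : 0 < G.
Hypothesis delta_rng : 0 < delta <= G ^+ 3.
Local Notation h := (dist_kernel (d := d) (gap f_in f_out)).
Hypothesis block : forall x, (\int[lebesgue d]_y1 \int[lebesgue d]_y2 \int[lebesgue d]_y3
    (h x y1 * h y1 y2 * h y2 y3 * (1 - h x y3))%:E = (G ^+ 3 - delta)%:E)%E.
Variable lambda : R.
Hypothesis lambda_gt0 : 0 < lambda.
Hypothesis subcritical : lambda ^+ 3 * (G ^+ 3 - delta) < 1.

Context {disp : measure_display} {W : measurableType disp} {P : probability W R}.
Context {X : nat -> {mfun W >-> Rspace R d}} {Z : nat -> {mfun W >-> bool}}.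
Context {E : nat -> nat -> {mfun W >-> bool}}.
Hypothesis cg : community_graph f_in f_out lambda P X Z E.

Variables (gamma : R) (n : nat) (t : estimator R d).
Hypothesis gamma_gt0 : 0 < gamma.
Hypothesis mt : measurable_estimator t.

Let C : R := path_constant G delta lambda.
Let B : set (Rspace R d) := box n.
Let mB : measurable B. Proof. exact: measurable_box. Qed.
Let B_fin : (lebesgue d B < +oo)%E. Proof. by rewrite lebesgue_cube ltry. Qed.
Let B_down : forall w i j, (i <= j)%N -> B (X j w) -> B (X i w).
Proof. exact: box_down (locations_ordered cg). Qed.
Let pp := locations_poisson cg.

Local Notation Ncount := (count_event X B).
Let success := [set w | gamma <= overlap X Z E t n w].
Let outside := ~` (\bigcup_m Ncount m).

Let success_count m : success `&` Ncount m =
  if m == 0%N then if gamma <= 1 then Ncount m else set0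
  else recovery_event X Z E B (gamma * m%:R) (@t m).
Proof.
apply/seteqP; split=> w.
  move=> [] sw Nw; have NE := Nbox_count_event (locations_ordered cg) Nw.
  move: sw; rewrite /success /= /overlap NE.
  case: eqP => [m0|/eqP m0] /= ; first by move=> ->.
  move=> le; split=> //=; rewrite mulrC -ler_pdivlMl// ltr0n lt0n//.
case: eqP => [m0|/eqP m0].
  case: ifP => // g1 Nw; split=> //; have NE := Nbox_count_event (locations_ordered cg) Nw.
  by rewrite /success /= /overlap NE m0 eqxx.
move=> [Nw le]; split=> //; have NE := Nbox_count_event (locations_ordered cg) Nw.
rewrite /success /= /overlap NE (negbTE m0) ler_pdivlMl ?ltr0n ?lt0n// mulrC.
exact: le.
Qed.

Let success_outside : success `&` outside = if gamma <= 1 then outside else set0.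
Proof.
have oE w : outside w -> overlap X Z E t n w = 1.
  by move=> /Nbox_outside N0; rewrite /overlap N0 eqxx.
apply/seteqP; split=> w.
  by move=> [] sw ow; move: sw; rewrite /success /= oE// => ->.
by case: ifP => // g1 ow; split=> //; rewrite /success /= oE.
Qed.

Let measurable_outside : measurable outside.
Proof. by apply: measurableC; apply: bigcupT_measurable => m; exact: measurable_count_event. Qed.

Let measurable_piece m : measurable (success `&` Ncount m).
Proof.
rewrite success_count; case: eqP => _; last exact: (measurable_recovery_event cg _ mB (@mt m)).
by case: ifP => // _; exact: measurable_count_event.
Qed.

Let path_sum m : \bar R := (\sum_(k < m) \sum_(s : k.+1.-tuple 'I_m | uniq s)
    \int[P]_(w in Ncount m)
       (geodesic_weight h (thead (location_tuple X s w))
       (behead (location_tuple X s w)))%:E)%E.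

Let path_sum_ge0 m : (0 <= path_sum m)%E.
Proof.
apply: sume_ge0 => k _; apply: sume_ge0 => s _; apply: integral_ge0 => w _.
by rewrite lee_fin; apply: geodesic_weight_ge0; exact: (dist_kernel_rng (gap_rng sc)).
Qed.

(** There are either few points, which is unlikely, or at least [M] points, in
    which case the overlap is large with probability at most
    [(gamma * M) ^- 2] times the expected number of geodesic paths. *)
Lemma success_bound (M : nat) : (0 < M)%N ->
  (P [set w | (gamma <= overlap X Z E t n w)%R] <=
   (\sum_(k < M) poisson_weight (lambda * n%:R) k
    + M%:R ^- 2 * (gamma ^- 2 * C * n%:R))%:E)%E.
Proof.
move=> M0; rewrite -/success.
have cover : success = (\bigcup_m (success `&` Ncount m)) `|` (success `&` outside).
  by rewrite -setI_bigcupr -setIUr /outside setUv setIT.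
have mU : measurable (\bigcup_m (success `&` Ncount m)) by exact: bigcupT_measurable.
have mO : measurable (success `&` outside) by rewrite success_outside; case: ifP.
have PO : P (success `&` outside) = 0%E.
  rewrite success_outside; case: ifP => _; last exact: measure0.
  exact: (P_outside_count_events pp (ltW lambda_gt0) mB B_fin B_down).
rewrite cover measureU0//.
rewrite measure_semi_bigcup//; last first.
  apply: trivIset_setIl; exact: trivIset_count_event.
(* bound the probability of success with m points by that of m when m < M, and
   by the path sum otherwise; both bounds are summed over all m *)
pose few m : \bar R := if (m < M)%N then (poisson_weight (lambda * n%:R) m)%:E else 0%E.
have v0 : 0 <= lambda * n%:R by rewrite mulr_ge0 // ltW.
have few0 m : (0 <= few m)%E.
  rewrite /few; case: ifP => // _; rewrite lee_fin.
  by rewrite /poisson_weight mulr_ge0 ?expR_ge0// divr_ge0// exprn_ge0.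
have gM : 0 < gamma * M%:R by rewrite mulr_gt0// ltr0n.
have c0 : (0 <= ((gamma * M%:R) ^- 2)%:E)%E by rewrite lee_fin invr_ge0 exprn_ge0 // ltW.
have PN m : P (Ncount m) = (poisson_weight (lambda * n%:R) m)%:E.
  by rewrite (P_count_event pp mB B_fin B_down) /B lebesgue_cube.
apply: (@le_trans _ _ (\sum_(0 <= m <oo) (few m + ((gamma * M%:R) ^- 2)%:E * path_sum m)))%E.
  apply: lee_nneseries => // m _; rewrite /few; case: ltnP => mM.
    rewrite -PN; apply: (@le_trans _ _ (P (Ncount m))).
      apply: le_measure; rewrite ?inE//; first exact: measurable_count_event.
    by rewrite leeDl// mule_ge0.
  rewrite add0e success_count; have m0 : (0 < m)%N by exact: leq_trans mM.
  rewrite gtn_eqF//.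
  have gm : 0 < gamma * m%:R by rewrite mulr_gt0// ltr0n.
  apply: (le_trans (recovery_event_bound sc cg mB gm (@mt m))).
  apply: lee_wpmul2r; first exact: path_sum_ge0.
  rewrite lee_fin lef_pV2 ?posrE ?exprn_gt0//.
  by apply: lerXn2r; rewrite ?nnegrE ?(ltW gM) ?(ltW gm)// ler_wpM2l ?ler_nat// ltW.
rewrite nneseriesD//; last by move=> m _ _; rewrite mule_ge0.
rewrite EFinD; apply: leeD.
  rewrite (nneseries_split 0 M)// add0n eseries0 ?adde0; last first.
    by move=> m Mm _; rewrite /few ltnNge Mm.
  rewrite big_mkord -sumEFin; apply: lee_sum => k _.
  by rewrite /few ltn_ord.
rewrite nneseriesZl_ge0//.
have := expected_paths sc GE G_gt0 delta_rng block lambda_gt0 subcritical mB B_fin pp B_down.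
rewrite {2}/B lebesgue_cube -EFinM => paths.
apply: (@le_trans _ _ (((gamma * M%:R) ^- 2)%:E * (C * n%:R)%:E)%E).
  exact: lee_wpmul2l.
by rewrite -EFinM lee_fin exprMn invfM le_eqVlt; apply/orP; left; apply/eqP; ring.
Qed.

End Realised.

(** The probability of success in the cube of volume [n] is O(1/n), so it cannot
    tend to 1. *)
Lemma weak_recovery_unsolvable {R : realType} d' (f_in f_out : R -> R) (G delta lambda : R) :
  sparse_connection d'.+1 f_in f_out ->
  (\int[lebesgue d'.+1]_x (gap f_in f_out (enorm x))%:E = G%:E)%E -> 0 < G ->
  0 < delta <= G ^+ 3 ->
  (forall x, \int[lebesgue d'.+1]_y1 \int[lebesgue d'.+1]_y2 \int[lebesgue d'.+1]_y3
    (dist_kernel (gap f_in f_out) x y1 * dist_kernel (gap f_in f_out) y1 y2 *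
     dist_kernel (gap f_in f_out) y2 y3 * (1 - dist_kernel (gap f_in f_out) x y3))%:E
    = (G ^+ 3 - delta)%:E)%E ->
  0 < lambda -> lambda ^+ 3 * (G ^+ 3 - delta) < 1 ->
  ~ weak_recovery_solvable d'.+1 f_in f_out lambda.
Proof.
move=> sc GE G0 delta_rng block lambda0 sub.
move=> [disp [W [P [X [Z [E [cg [gamma [t [gamma0 mt cvg1]]]]]]]]]].
pose a := gamma ^- 2 * path_constant G delta lambda / lambda.
have a0 : 0 <= a.
  rewrite /a divr_ge0 ?(ltW lambda0)// mulr_ge0 ?invr_ge0 ?exprn_ge0 ?(ltW gamma0)//.
  exact: path_constant_ge0.
have small : \forall n \near \oo,
    (P [set w | (gamma <= overlap X Z E (t n) n w)%R] <= (2^-1)%:E)%E.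
  near=> n.
  have vn : Num.max 8 (2 * (4 + 64 * a)) <= lambda * n%:R.
    rewrite -ler_pdivrMl//; near: n; exact: nbhs_infty_ger.
  have v8 : 8 <= lambda * n%:R by apply: le_trans vn; rewrite le_max lexx.
  have v2 : 2 * (4 + 64 * a) <= lambda * n%:R by apply: le_trans vn; rewrite le_max lexx orbT.
  have [M M0 bnd] := poisson_tail_bound v8 a0.
  have sb := success_bound sc GE G0 delta_rng block lambda0 sub cg n gamma0 (mt n) M0.
  apply: (le_trans sb).
  rewrite lee_fin.
  have -> : gamma ^- 2 * path_constant G delta lambda * n%:R = a * (lambda * n%:R).
    by rewrite /a; field; rewrite gt_eqF// gt_eqF.
  apply: (le_trans bnd); rewrite ler_pdivrMr; last lra.
  by rewrite mulrC; lra.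
have : (1%:E <= (2^-1 : R)%:E)%E.
  by rewrite -[leLHS](cvg_lim _ cvg1)//; exact: lime_le (cvgP _ cvg1) small.
by rewrite lee_fin leNgt invf_lt1 ?ltr1n.
Unshelve. all: by end_near.
Qed.

(** With [th = delta / G ^+ 3] in (0, 1], the claim follows from
    [(1 + th / 8) ^+ 3 * (1 - th) < 1]. *)
Lemma subcritical_margin {R : realType} (G delta lambda : R) :
  0 < G -> 0 < delta <= G ^+ 3 -> 0 < lambda ->
  lambda <= (1 + delta / G ^+ 3 / 8) / G -> lambda ^+ 3 * (G ^+ 3 - delta) < 1.
Proof.
move=> G0 /andP[delta0 deltaG] lambda0 le.
have G30 : 0 < G ^+ 3 by rewrite exprn_gt0.
set th := delta / G ^+ 3 in le *.
have th0 : 0 < th by rewrite divr_gt0.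
have th1 : th <= 1 by rewrite ler_pdivrMr// mul1r.
have lG : lambda * G <= 1 + th / 8 by rewrite -ler_pdivlMr.
have -> : lambda ^+ 3 * (G ^+ 3 - delta) = (lambda * G) ^+ 3 * (1 - th).
  by rewrite /th; field; rewrite gt_eqF.
apply: (@le_lt_trans _ _ ((1 + th / 8) ^+ 3 * (1 - th))).
  apply: ler_wpM2r; first lra.
  by apply: lerXn2r; rewrite ?nnegrE//; [rewrite mulr_ge0// ltW|lra].
by rewrite !exprS expr0; nra.
Qed.

Theorem corollary2 (R : realType) (d : nat) (f_in f_out : R -> R) :
  (2 <= d)%N ->
  sparse_connection d f_in f_out ->
  ~ {ae @lebesgue_measure R, forall r : R, 0 <= r -> f_in r = f_out r} ->
  (forall lambda : R, 0 < lambda ->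
     (lambda%:E <= lambda_lower d f_in f_out)%E ->
     ~ weak_recovery_solvable d f_in f_out lambda) /\
  (lambda_lower d f_in f_out < lambda_c d f_in f_out)%E.
Proof.
case: d => // d _ sc neq.
have gapE r : 0 <= r -> gap f_in f_out r = f_in r - f_out r.
  by move=> r0; rewrite /gap /restrict_half r0.
have enorm0 (x : Rspace R d.+1) : 0 <= enorm x by exact: sqrtr_ge0.
set I : \bar R := (\int[lebesgue d.+1]_x (gap f_in f_out (enorm x))%:E)%E.
have I0 : (0 <= I)%E.
  by apply: integral_ge0 => x _; rewrite lee_fin; case/andP: (gap_rng sc (enorm x)).
have Ioo : (I < +oo)%E.
  apply: le_lt_trans (degree_lty sc); apply: le_integral_ge0 => x; rewrite lee_fin.
    by case/andP: (gap_rng sc (enorm x)).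
  by rewrite gapE// lerD2l ge0_cp//; case/andP: (f_out_range sc (enorm0 x)).
have Ipos : (0 < I)%E.
  rewrite lt_def I0 andbT; apply/eqP => Ieq0; apply: neq.
  have gap0 r : 0 <= gap f_in f_out r by case/andP: (gap_rng sc r).
  have := radial_integral_eq0 (measurable_gap sc) gap0 Ieq0.
  apply: negligibleS; apply: subsetC => r gr r0.
  by apply/eqP; rewrite -subr_eq0 -gapE// gr.
have IE : I = (fine I)%:E by rewrite fineK// ge0_fin_numE.
have G0 : 0 < fine I by rewrite -lte_fin -IE.
have lowerE : lambda_lower d.+1 f_in f_out = (fine I)^-1%:E.
  have -> : lambda_lower d.+1 f_in f_out = (I^-1)%E.
    by congr (_^-1)%E; apply: eq_integral => x _; rewrite gapE.
  by rewrite IE inver gt_eqF.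
(* weak recovery fails up to lambda1, which is larger than the inverse of G *)
have [delta [delta_rng block]] := block_integral (measurable_gap sc) (gap_rng sc) IE G0.
pose lambda1 := (1 + delta / fine I ^+ 3 / 8) / fine I.
have lower_lt : (fine I)^-1 < lambda1.
  rewrite /lambda1 ltr_pdivlMr// mulVf ?gt_eqF// ltrDl.
  by case/andP: delta_rng => ? _; rewrite !divr_gt0// exprn_gt0.
have unsolvable lambda : 0 < lambda -> lambda <= lambda1 ->
    ~ weak_recovery_solvable d.+1 f_in f_out lambda.
  move=> lambda0 le; apply: (weak_recovery_unsolvable sc IE G0 delta_rng block lambda0).
  exact: subcritical_margin le.
rewrite lowerE; split.
  move=> lambda lambda0; rewrite lee_fin => le; apply: unsolvable => //.
  exact: le_trans le (ltW lower_lt).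
apply: (@lt_le_trans _ _ lambda1%:E); first by rewrite lte_fin.
apply: le_ereal_inf_tmp => _ [lambda [lambda0 slv] <-]; rewrite lee_fin leNgt.
by apply/negP => /ltW/(unsolvable _ lambda0).
Qed.
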